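(* Let $1<p<\infty$ and $0<s<1$. Let $\Omega\subset\mathbb{R}^N$ be an open set. Then $$s\,(1-s)\,\lambda^s_{p}(\Omega)\le 2^{p(1-s)}\,N\,\omega_N\,\big(\lambda^1_{p}(\Omega)\big)^s.$$ If in addition: (a) $\Omega$ is bounded with Lipschitz boundary, then we also have the reverse inequality $$\frac{1}{C_1}\,\big(\lambda^1_{p}(\Omega)\big)^s\le s\,(1-s)\,\lambda^s_{p}(\Omega),$$ where $C_1>0$ is a constant depending only on $N$, $p$, $\mathrm{diam}(\Omega)$ and the Lipschitz constant of $\partial\Omega$, for which $\|u\|^p_{\mathcal{X}^{s,p}_0(\Omega)}\le C_1\,\|u\|^p_{\mathcal{D}_0^{s,p}(\Omega)}$ also holds for every $u\in C^\infty_0(\Omega)$; (b) $\Omega$ is convex, then we also have the reverse inequality $$\frac{1}{C_2}\,\big(\lambda^1_{p}(\Omega)\big)^s\le s\,(1-s)\,\lambda^s_{p}(\Omega),\qquad C_2=\frac{\big(\lambda^1_p(B_1(0))\big)^s}{\mathcal{C}},$$ where $\mathcal{C}=\mathcal{C}(N,p)>0$ is the constant in the fractional Hardy inequality for convex sets.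
   Context: $\omega_N$ is the Lebesgue measure of the unit ball $B_1(0)\subset\mathbb{R}^N$. $C^\infty_0(\Omega)$ is the space of smooth functions with compact support in $\Omega$ (extended by $0$ to $\mathbb{R}^N$). For $u\in C^\infty_0(\Omega)$, $$\|u\|_{\mathcal{D}^{s,p}_0(\Omega)}:=[u]_{W^{s,p}(\mathbb{R}^N)}:=\left(\iint_{\mathbb{R}^N\times\mathbb{R}^N}\frac{|u(x)-u(y)|^p}{|x-y|^{N+sp}}\,dx\,dy\right)^{1/p},$$ $$\|u\|_{\mathcal{X}^{s,p}_0(\Omega)}:=\left(\int_0^{+\infty}\left(\frac{1}{t^s}\inf_{v\in C^\infty_0(\Omega)}\Big\{\|u-v\|_{L^p(\Omega)}+t\,\|\nabla v\|_{L^p(\Omega)}\Big\}\right)^p\frac{dt}{t}\right)^{1/p}.$$ The sharp Poincaré constants are $$\lambda^1_p(\Omega)=\inf_{u\in C^\infty_0(\Omega)}\Big\{\|\nabla u\|^p_{L^p(\Omega)}:\|u\|_{L^p(\Omega)}=1\Big\},\qquad \lambda^s_p(\Omega)=\inf_{u\in C^\infty_0(\Omega)}\Big\{[u]^p_{W^{s,p}(\mathbb{R}^N)}:\|u\|_{L^p(\Omega)}=1\Big\}.$$ A bounded open set $\Omega$ has Lipschitz boundary if there are $r>0$, $m\in\mathbb{N}$, $M>0$ and finitely many open sets $U_1,\dots,U_k$ such that: for each $x\in\partial\Omega$ the ball $B_r(x)$ is contained in some $U_i$; no point of $\mathbb{R}^N$ belongs to more than $m$ of the $U_i$; and for each $i$,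 up to a rigid motion, $\Omega\cap U_i=U_i\cap\{(x',x_N): x_N>\phi_i(x')\}$ with $\phi_i:\mathbb{R}^{N-1}\to\mathbb{R}$ Lipschitz with Lipschitz constant at most $M$. Dependence on ''the Lipschitz constant of $\partial\Omega$'' is understood as dependence on the data $(r,m,M)$ of such a description. The constant $\mathcal{C}=\mathcal{C}(N,p)>0$ is a constant depending only on $N$ and $p$ for which the following fractional Hardy inequality of Brasco and Cinti (a known result) holds: for every $0<s<1$, every open convex set $K\subsetneq\mathbb{R}^N$ and every $u\in C^\infty_0(K)$, $$\frac{\mathcal{C}}{s(1-s)}\int_K\frac{|u(x)|^p}{\mathrm{dist}(x,\partial K)^{sp}}\,dx\le [u]^p_{W^{s,p}(\mathbb{R}^N)}.$$ In particular $s(1-s)\lambda^s_p(K)\ge \mathcal{C}\,R_K^{-sp}$ if $R_K=\sup_{x\in K}\mathrm{dist}(x,\partial K)<+\infty$. *)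

(* Defs.v *)
From HB Require Import structures.
From mathcomp Require Import all_boot all_order all_algebra.
From mathcomp Require Import all_classical all_reals all_analysis.

Set Implicit Arguments.
Unset Strict Implicit.
Unset Printing Implicit Defensive.

Import Order.TTheory GRing.Theory Num.Theory.
Import numFieldNormedType.Exports.

Local Open Scope classical_set_scope.
Local Open Scope ring_scope.

(* Product sigma-algebra on R^n, generated by the coordinate projections (it is
   the Borel sigma-algebra); Lebesgue measure on R^n is the n-fold product of
   the one on R. *)
Fact rV_display : measure_display.
Proof. exact: default_measure_display. Qed.

Section rV_measurable.
Variables (R : realType) (n : nat).

Definition rV_coord (i : 'I_n) (x : 'rV[R]_n) : R := x ord0 i.

Let rV_set0 : g_sigma_preimage rV_coord set0.
Proof. exact: sigma_algebra0. Qed.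

Let rV_setC A : g_sigma_preimage rV_coord A -> g_sigma_preimage rV_coord (~` A).
Proof. exact: sigma_algebraC. Qed.

Let rV_bigcup (F : (set 'rV[R]_n)^nat) :
  (forall i, g_sigma_preimage rV_coord (F i)) ->
  g_sigma_preimage rV_coord (\bigcup_i (F i)).
Proof. exact: sigma_algebra_bigcup. Qed.

HB.instance Definition _ := @isMeasurable.Build rV_display
  'rV[R]_n (g_sigma_preimage rV_coord) rV_set0 rV_setC rV_bigcup.

Lemma measurable_rV_coord (i : 'I_n) : measurable_fun setT (rV_coord i).
Proof.
move=> _ Y mY; rewrite setTI; apply: sub_sigma_algebra => /=.
rewrite -bigcup_seq/=; exists i => /=; first by rewrite mem_index_enum.
by exists Y => //; rewrite setTI.
Qed.

Lemma measurable_fun_rV d (T : measurableType d) (f : T -> 'rV[R]_n) :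
  (forall i, measurable_fun setT (rV_coord i \o f)) -> measurable_fun setT f.
Proof.
move=> mf _ A mA; rewrite setTI.
suff : g_sigma_preimage rV_coord `<=` [set A | measurable (f @^-1` A)].
  exact.
apply: smallest_sub.
  split => /=.
  - by rewrite preimage_set0.
  - by move=> B mB; rewrite setTD preimage_setC; exact: measurableC.
  - by move=> F mF; rewrite preimage_bigcup; exact: bigcupT_measurable.
rewrite -bigcup_seq; apply: bigcup_sub => i _ _ [B mB <-] /=.
rewrite setTI -comp_preimage -[X in measurable X]setTI.
exact: mf.
Qed.

End rV_measurable.

Section rV_cons.
Variables (R : realType) (n : nat).

Definition rV_cons (z : R * 'rV[R]_n) : 'rV[R]_n.+1 :=
  \row_i oapp (z.2 ord0) z.1 (unlift ord0 i).

Definition rV_uncons (x : 'rV[R]_n.+1) : R * 'rV[R]_n :=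
  (x ord0 ord0, \row_i x ord0 (lift ord0 i)).

Lemma rV_uncons_cons z : rV_uncons (rV_cons z) = z.
Proof.
case: z => a v; congr pair; first by rewrite mxE unlift_none.
by apply/rowP => i; rewrite !mxE liftK.
Qed.

Lemma measurable_rV_cons : measurable_fun setT rV_cons.
Proof.
apply: measurable_fun_rV => i; case: (unliftP ord0 i) => [j ->|->].
- rewrite (_ : _ \o _ = @rV_coord R n j \o snd).
    by apply: measurableT_comp => //; exact: measurable_rV_coord.
  by apply/funext => z; rewrite /rV_coord /= mxE liftK.
- rewrite (_ : _ \o _ = fst) //.
  by apply/funext => z; rewrite /rV_coord /= mxE unlift_none.
Qed.

Lemma measurable_rV_uncons : measurable_fun setT rV_uncons.
Proof.
apply: measurable_fun_pair; first exact: measurable_rV_coord.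
apply: measurable_fun_rV => i.
rewrite (_ : _ \o _ = @rV_coord R n.+1 (lift ord0 i)).
  exact: measurable_rV_coord.
by apply/funext => z; rewrite /rV_coord /= mxE.
Qed.

End rV_cons.

Section lebesgue_rV.
Context {R : realType}.

Section step.
Let leb : {sigma_finite_measure set (measurableTypeR R) -> \bar R} :=
  @lebesgue_measure R.

Variables (n : nat) (m : {sigma_finite_measure set 'rV[R]_n -> \bar R}).

Definition lebesgue_rV_step : set 'rV[R]_n.+1 -> \bar R :=
  pushforward (leb \x m)%E (@rV_cons R n).

Let step0 : lebesgue_rV_step set0 = 0%E.
Proof. by rewrite /lebesgue_rV_step /pushforward preimage_set0 measure0. Qed.

Let step_ge0 A : (0 <= lebesgue_rV_step A)%E.
Proof. by rewrite /lebesgue_rV_step /pushforward; exact: measure_ge0. Qed.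

Let step_sigma_additive : semi_sigma_additive lebesgue_rV_step.
Proof.
move=> F mF tF mUF; rewrite /lebesgue_rV_step /pushforward preimage_bigcup.
apply: measure_semi_sigma_additive.
- by move=> n0; rewrite -[X in measurable X]setTI; exact: measurable_rV_cons.
- apply/trivIsetP => /= i j _ _ ij; rewrite -preimage_setI.
  by move/trivIsetP : tF => /(_ _ _ _ _ ij) ->//; rewrite preimage_set0.
- rewrite -preimage_bigcup -[X in measurable X]setTI.
  exact: measurable_rV_cons.
Qed.

HB.instance Definition _ := isMeasure.Build _ _ _ lebesgue_rV_step
  step0 step_ge0 step_sigma_additive.

Let step_sigma_finite : sigma_finite setT lebesgue_rV_step.
Proof.
have /sigma_finiteP[F [TF ndF Foo]] := sigma_finiteT leb.
have /sigma_finiteP[G [TG ndG Goo]] := sigma_finiteT m.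
exists (fun k => @rV_uncons R n @^-1` (F k `*` G k)).
  rewrite -preimage_bigcup (_ : \bigcup_k _ = setT) ?preimage_setT//.
  rewrite -setXTT TF TG predeqE => -[x y]; split.
    by move=> [k _ []/= ? ?]; split; exists k.
  move=> [/= [k _ Fkx] [l _ Gly]]; exists (maxn k l) => //; split.
  - by move: x Fkx; exact/subsetPset/ndF/leq_maxl.
  - by move: y Gly; exact/subsetPset/ndG/leq_maxr.
move=> k; have [mF Fk] := Foo k; have [mG Gk] := Goo k; split.
  rewrite -[X in measurable X]setTI; apply: measurable_rV_uncons => //.
  exact: measurableX.
rewrite /lebesgue_rV_step /pushforward -comp_preimage.
rewrite (_ : _ \o _ = id); last by rewrite funeqE => z /=; rewrite rV_uncons_cons.
by rewrite preimage_id product_measure1E// lte_mul_pinfty// ge0_fin_numE.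
Qed.

HB.instance Definition _ := Measure_isSigmaFinite.Build _ _ _ lebesgue_rV_step
  step_sigma_finite.

End step.

Fixpoint lebesgue_rV (n : nat) : {sigma_finite_measure set 'rV[R]_n -> \bar R} :=
  match n with
  | 0 => dirac (0 : 'rV[R]_0)
  | n.+1 => lebesgue_rV_step (lebesgue_rV n)
  end.

End lebesgue_rV.

Section euclidean.
Context {R : realType} {n : nat}.
Implicit Types (x y : 'rV[R]_n) (A : set 'rV[R]_n).

(* The library norm on ['rV_n] is the sup norm, hence a separate Euclidean one.
   Both induce the same topology, so [open], [compact], [bounded_set] etc. are
   those of the library. *)
Definition enorm x : R := Num.sqrt (\sum_(i < n) x ord0 i ^+ 2).

Definition eball x (r : R) : set 'rV[R]_n := [set y | enorm (y - x) < r].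

Definition boundary A : set 'rV[R]_n := closure A `\` interior A.

Definition edistance x A : R := inf [set enorm (x - y) | y in A].

Definition ediam A : R := sup [set enorm (z.1 - z.2) | z in A `*` A].

End euclidean.

Section test_functions.
Context {R : realType} {n : nat}.
Implicit Types (u : 'rV[R]_n -> R) (x : 'rV[R]_n) (Omega : set 'rV[R]_n).

Definition partial (i : 'I_n) u : 'rV[R]_n -> R := 'D_(delta_mx ord0 i) u.

Fixpoint Ck (k : nat) u : Prop :=
  continuous u /\
  match k with
  | 0 => True
  | k.+1 => forall i : 'I_n,
      (forall x, derivable u x (delta_mx ord0 i)) /\ Ck k (partial i u)
  end.

Definition smooth u : Prop := forall k, Ck k u.

Definition grad u x : 'rV[R]_n := \row_i partial i u x.

Definition tsupport u : set 'rV[R]_n := closure [set x | u x != 0].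

(* C^oo_0(Omega), as functions on the whole space (extension by 0). *)
Definition test_fun Omega : set ('rV[R]_n -> R) :=
  [set u | [/\ smooth u, compact (tsupport u) & tsupport u `<=` Omega]].

End test_functions.

Section norms.
Context {R : realType} {n : nat}.
Implicit Types (u v f : 'rV[R]_n -> R) (Omega : set 'rV[R]_n) (s p t : R).
Local Open Scope ereal_scope.

Local Notation mu := (@lebesgue_rV R n).

Definition Lp_norm Omega p f : \bar R :=
  'N[mu]_(p%:E)[(EFin \o f) \_ Omega].

Definition Lp_grad Omega p u : \bar R :=
  Lp_norm Omega p (fun x => enorm (grad u x)).

Definition gagliardo s p u : \bar R :=
  (\int[mu \x mu]_z
     (`|u z.1 - u z.2| `^ p / enorm (z.1 - z.2) `^ (n%:R + s * p))%R%:E) `^ p^-1.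

Definition K_functional Omega p u t : \bar R :=
  ereal_inf [set Lp_norm Omega p (u \- v)%R + t%:E * Lp_grad Omega p v
            | v in test_fun Omega].

Definition X_norm Omega s p u : \bar R :=
  (\int[@lebesgue_measure R]_(t in `]0%R, +oo[)
     ((((t `^ s)^-1)%R%:E * K_functional Omega p u t) `^ p * (t^-1)%R%:E)) `^ p^-1.

Definition lambda1 p Omega : \bar R :=
  ereal_inf [set Lp_grad Omega p u `^ p
            | u in [set u | test_fun Omega u /\ Lp_norm Omega p u = 1]].

Definition lambda_frac s p Omega : \bar R :=
  ereal_inf [set gagliardo s p u `^ p
            | u in [set u | test_fun Omega u /\ Lp_norm Omega p u = 1]].

Definition omega_ball : \bar R := mu (eball 0%R 1%R).

(* C is admissible in the fractional Hardy inequality on convex sets of R^n. *)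
Definition hardy_constant p (C : R) : Prop :=
  (0 < C)%R /\
  forall s (K : set 'rV[R]_n) u, (0 < s < 1)%R ->
    open K -> convex_set K -> K != setT -> test_fun K u ->
    (C / (s * (1 - s)))%R%:E *
      \int[mu]_(x in K)
        (`|u x| `^ p / edistance x (boundary K) `^ (s * p))%R%:E
    <= gagliardo s p u `^ p.

End norms.

Section lipschitz_boundary.
Context {R : realType} {n : nat}.

(* [x |-> x *m Q + b] is the rigid motion; Q may have determinant -1 (which is
   needed in dimension 1). *)
Definition lipschitz_chart (M : R) (Omega U : set 'rV[R]_n.+1) : Prop :=
  exists (Q : 'M[R]_n.+1) (b : 'rV[R]_n.+1) (phi : 'rV[R]_n -> R),
    [/\ Q *m Q^T = 1%:M,
        forall x y, `|phi x - phi y| <= M * enorm (x - y) &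
        Omega `&` U = U `&` [set x | let y := x *m Q + b in
                                     phi (col' ord_max y) < y ord0 ord_max]].

Definition lipschitz_domain (r : R) (m : nat) (M : R)
    (Omega : set 'rV[R]_n.+1) : Prop :=
  exists (k : nat) (U : 'I_k -> set 'rV[R]_n.+1),
    [/\ forall i, open (U i),
        forall x, boundary Omega x -> exists i, eball x r `<=` U i,
        forall x, (#|[set i | `[< U i x >]]%SET| <= m)%N &
        forall i, lipschitz_chart M Omega (U i)].

End lipschitz_boundary.

(* Main.v *)
(** Upper bound: [||u(. + h) - u||_p] is at most [2 ||u||_p] and at most
    [|h| ||grad u||_p]; integrating the minimum against [|h|^(-N-sp)] gives the
    constant.

    Convex sets: if [K] contains the ball of radius [d] centred at [x], rescaling
    test functions of the unit ball gives [d^p lambda1(K) <= lambda1(B_1)]. With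
    [d = dist(x, bd K)] this bounds the weight [d^(-sp)] of the Hardy inequality
    from below by [(lambda1(K) / lambda1(B_1))^s].

    Lipschitz sets: for small [t], test the K-functional with [v] obtained from [u]
    by a translation of length [t] into [Omega], along a direction that is constant
    on each cell of a finite grid, followed by a mollification at scale [c t]. By
    Jensen, [||u - v||_p^p + t^p ||grad v||_p^p] is at most
    [C t^(-N)] times the integral over [|h| < 2 t] of [||u(. + h) - u||_p^p], and
    integrating in [t] produces the Gagliardo seminorm. For large [t] take [v = 0]:
    [||u||_p] is controlled by the part [|h| > diam Omega] of the seminorm, where
    [u] and [u(. + h)] have disjoint supports. Conversely [K(u, t)] is at least
    [min(1, t lambda1^(1/p)) ||u||_p], so the interpolation norm bounds
    [lambda1^s ||u||_p^p / (s (1 - s))]. *)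

Require Import Defs.
From mathcomp Require Import all_boot all_order all_algebra.
From mathcomp Require Import all_classical all_reals all_analysis.
From mathcomp Require Import measurable_realfun ring lra.

Import Order.TTheory GRing.Theory Num.Theory.
Import numFieldNormedType.Exports.

Local Open Scope classical_set_scope.
Local Open Scope ring_scope.

Set Implicit Arguments.
Unset Strict Implicit.
Unset Printing Implicit Defensive.

(** * Lebesgue measure and Euclidean balls in R^n *)

(** In the Lipschitz case the constant may see [Omega] only through its data. The translated
    function jumps from cell to cell, which is harmless for two reasons: the mollified function
    takes all its derivatives from the kernel, and the error [u(x) - u(z - t E)] is compared with
    whole-space differences of [u] one direction at a time, at the price of a factor equal to the
    number of cell codes. That number and the admissible range of [t] depend only on [r], [M], the
    diameter and the dimension. Uniformity in [s] rests on the origin of the factor [s (1 - s)]. In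
    the upper bound the radial integral of the minimum produces [1 / (p s (1 - s))]. In the lower
    bound the integral in [t] splits at [t = 1 / G] into terms with denominators [s p] and
    [p - s p], the larger of which is at least [1 / (2 p s (1 - s))]. For large [t] a factor
    [1 / (s p)] occurs on both sides and cancels. Since [lambda1] may be [0] or infinite, real
    parameters [g > lambda1] or [G^p <= lambda1] stand in for it in the estimates. *)

Section integral_monotone.
Context d (T : measurableType d) (R : realType).
Variable mu : {measure set T -> \bar R}.
Local Open Scope ereal_scope.

(* Unlike [ge0_le_integral] of the library, measurability is not assumed: the
   integral of a nonnegative function is a supremum over simple functions. *)
Lemma ge0_le_integral_nomeas (D : set T) (f g : T -> \bar R) :
  (forall x, D x -> 0 <= f x) -> (forall x, D x -> f x <= g x) ->
  \int[mu]_(x in D) f x <= \int[mu]_(x in D) g x.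
Proof.
move=> f0 fg.
rewrite (integral_mkcond D f) (integral_mkcond D g).
have f0' x : 0 <= (f \_ D) x by exact: erestrict_ge0.
have fg' x : (f \_ D) x <= (g \_ D) x.
  by rewrite /patch; case: ifPn => // /set_mem; exact: fg.
rewrite !ge0_integralTE//; last by move=> x; exact: le_trans (fg' x).
apply: le_ereal_sup => _ [h hf <-]; exists h => // x.
exact: le_trans (fg' x).
Qed.

End integral_monotone.

Section affine_real.
Context {R : realType}.
Local Open Scope ereal_scope.
Local Notation leb := (@lebesgue_measure R).

(** Uniqueness of Lebesgue measure: [|a|] times the push-forward agrees with it on half-open
    intervals. For [a < 0] the preimage of such an interval is closed at the other end, hence two
    computations. *)
Lemma lebesgue_measure_affine (a b : R) (A : set R) : a != 0%R ->
  measurable A ->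
  leb ((fun x => a * x + b)%R @^-1` A) = `|a|^-1%:E * leb A.
Proof.
move=> a0 mA.
pose phi : measurableTypeR R -> measurableTypeR R := fun x => (a * x + b)%R.
have mphi : measurable_fun setT phi.
  by apply: measurable_funD => //; exact: measurable_funM.
pose m : {measure set (measurableTypeR R) -> \bar R} :=
  measure_function_pushforward__canonical__measure_function_Measure leb mphi.
have a0' : (0 < `|a|)%R by rewrite normr_gt0.
have na0 : (0 <= `|a|)%R by [].
pose m' := mscale (NngNum na0) m.
have H X : ocitv X -> leb X = m' X.
  move=> -[[l r]] _ <- /=.
  rewrite /m' /mscale /m /pushforward /=.
  have [a_gt0|a_lt0|a_eq0] := ltgtP 0%R a; last by rewrite -a_eq0 eqxx in a0.
  - rewrite (_ : pushforward leb phi _ = leb `]((l - b) / a)%R, ((r - b) / a)%R]%classic); last first.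
      congr (leb _); apply/seteqP; split => x /=; rewrite !in_itv/= /phi.
        by rewrite ltr_pdivrMr// ler_pdivlMr// ltrBlDr lerBrDr mulrC.
      by rewrite ltr_pdivrMr// ler_pdivlMr// ltrBlDr lerBrDr mulrC.
    rewrite !lebesgue_measure_itv/= !lte_fin ltr_pM2r ?invr_gt0// ltrD2r.
    case: ifPn => lr; last by rewrite mule0.
    by rewrite -EFinB -EFinM gtr0_norm//; congr EFin; field; rewrite gt_eqF.
  - rewrite (_ : pushforward leb phi _ = leb `[((r - b) / a)%R, ((l - b) / a)%R[%classic); last first.
      congr (leb _); apply/seteqP; split => x /=; rewrite !in_itv/= /phi.
        by rewrite ler_ndivrMr// ltr_ndivlMr// ltrBlDr lerBrDr mulrC andbC.
      by rewrite ler_ndivrMr// ltr_ndivlMr// ltrBlDr lerBrDr mulrC andbC.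
    rewrite !lebesgue_measure_itv/= !lte_fin ltr_nM2r ?invr_lt0// ltrD2r.
    case: ifPn => lr; last by rewrite mule0.
    by rewrite -EFinB -EFinM ltr0_norm//; congr EFin; field; rewrite lt_eqF.
rewrite [in RHS](lebesgue_measure_unique H)// /m' /mscale /=.
by rewrite muleA -EFinM mulVf ?mul1e// gt_eqF.
Qed.

Lemma ge0_integral_affine (a b : R) (f : measurableTypeR R -> \bar R) : a != 0%R ->
  measurable_fun setT f -> (forall x, 0 <= f x) ->
  \int[leb]_x f (a * x + b)%R = `|a|^-1%:E * \int[leb]_x f x.
Proof.
move=> a0 mf f0.
pose phi : measurableTypeR R -> measurableTypeR R := fun x => (a * x + b)%R.
have mphi : measurable_fun setT phi.
  by apply: measurable_funD => //; exact: measurable_funM.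
have na0 : (0 <= `|a|^-1)%R by rewrite invr_ge0.
have := @ge0_integral_pushforward _ _ _ _ R phi mphi leb setT f measurableT mf.
rewrite preimage_setT => <-//.
rewrite -[RHS](@ge0_integral_mscale _ _ R leb setT measurableT (NngNum na0) f)//.
apply: eq_measure_integral => A mA _.
exact: lebesgue_measure_affine.
Qed.

End affine_real.

Section lebesgue_rV_theory.
Context {R : realType}.
Local Open Scope ereal_scope.

(* [measurable_rV_cons] for the copy [measurableTypeR R] of [R], which carries
   the Lebesgue measure. *)
Let measurable_rV_consR n : measurable_fun
  [set: measurableTypeR R * 'rV[R]_n] (@rV_cons R n).
Proof. exact: measurable_rV_cons. Qed.

(** Tonelli for the recursive product that defines [lebesgue_rV]; it is the step of every induction
    on the dimension. *)
Lemma ge0_integral_lebesgue_rVS n (f : 'rV[R]_n.+1 -> \bar R) :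
  measurable_fun setT f -> (forall x, 0 <= f x) ->
  \int[lebesgue_rV n.+1]_x f x =
  \int[@lebesgue_measure R]_x \int[lebesgue_rV n]_y f (rV_cons (x, y)).
Proof.
move=> mf f0.
pose leb : {sigma_finite_measure set (measurableTypeR R) -> \bar R} :=
  @lebesgue_measure R.
pose m : {measure set 'rV[R]_n.+1 -> \bar R} :=
  measure_function_pushforward__canonical__measure_function_Measure
    (leb \x lebesgue_rV n)%E (@measurable_rV_consR n).
transitivity (\int[m]_x f x); first exact: eq_measure_integral.
have := @ge0_integral_pushforward _ _ _ _ R _ (@measurable_rV_consR n)
  (leb \x lebesgue_rV n)%E setT f measurableT mf (fun y _ => f0 y).
move=> H; apply: (etrans H); rewrite preimage_setT fubini_tonelli1//=.
by apply: measurableT_comp => //; exact: measurable_rV_consR.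
Qed.

Lemma measurable_rV_affine n (a : R) (b : 'rV[R]_n) :
  measurable_fun setT (fun x : 'rV[R]_n => a *: x + b)%R.
Proof.
apply: measurable_fun_rV => i.
rewrite (_ : _ \o _ = (fun x => a * rV_coord i x + b ord0 i)%R); last first.
  by apply/funext => x; rewrite /rV_coord /= !mxE.
apply: measurable_funD => //; apply: measurable_funM => //.
exact: measurable_rV_coord.
Qed.

(** Each coordinate contributes one factor [|a|^-1], peeled off by Tonelli. *)
Lemma ge0_integral_affine_rV n (a : R) (b : 'rV[R]_n) (f : 'rV[R]_n -> \bar R) :
  a != 0%R -> measurable_fun setT f -> (forall x, 0 <= f x) ->
  \int[lebesgue_rV n]_x f (a *: x + b)%R =
    (`|a| ^- n)%:E * \int[lebesgue_rV n]_x f x.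
Proof.
move=> a0; elim: n b f => [|n IH] b f mf f0.
  rewrite expr0 invr1 mul1e; apply: eq_integral => x _.
  by congr f; apply/rowP => -[].
have mfa : measurable_fun setT (fun x : 'rV[R]_n.+1 => f (a *: x + b)%R).
  exact: measurableT_comp (measurable_rV_affine _ _).
rewrite !ge0_integral_lebesgue_rVS//.
have mfc : measurable_fun [set: measurableTypeR R * 'rV[R]_n]
    (f \o @rV_cons R n).
  by apply: measurableT_comp => //; exact: measurable_rV_consR.
have E x y : f (a *: rV_cons (x, y) + b)%R =
    f (rV_cons (a * x + b ord0 ord0, a *: y + (rV_uncons b).2))%R.
  congr f; apply/rowP => i; rewrite !mxE/=.
  by case: unliftP => [j ->|->]//=; rewrite !mxE.
under eq_integral do under eq_integral do rewrite E.
under eq_integral => x _.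
  rewrite (IH _ (fun y => f (rV_cons (a * x + b ord0 ord0, y)))%R)//; last first.
    exact: (measurableT_comp mfc (measurable_pair1 _)).
  over.
pose F (x : measurableTypeR R) := \int[lebesgue_rV n]_y f (rV_cons (x, y)).
have mF : measurable_fun setT F.
  exact: (@measurable_fun_fubini_tonelli_F _ _ (measurableTypeR R) _ R
    (lebesgue_rV n) (f \o @rV_cons R n) mfc (fun=> f0 _)).
have F0 x : 0 <= F x by exact: integral_ge0.
rewrite ge0_integralZl//; last 2 first.
- apply: (measurableT_comp mF).
  by apply: measurable_funD => //; exact: measurable_funM.
- by move=> x _; exact: integral_ge0.
rewrite (@ge0_integral_affine _ a _ F)// muleA -EFinM.
by congr (_%:E * _); rewrite -invfM -exprSr.
Qed.

Lemma ge0_integral_shift_rV n (b : 'rV[R]_n) (f : 'rV[R]_n -> \bar R) :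
  measurable_fun setT f -> (forall x, 0 <= f x) ->
  \int[lebesgue_rV n]_x f (x + b)%R = \int[lebesgue_rV n]_x f x.
Proof.
move=> mf f0; have := @ge0_integral_affine_rV n 1 b f (oner_neq0 _) mf f0.
rewrite normr1 expr1n invr1 mul1e => <-.
by apply: eq_integral => x _; rewrite scale1r.
Qed.

Lemma ge0_integral_reflect_rV n (b : 'rV[R]_n) (f : 'rV[R]_n -> \bar R) :
  measurable_fun setT f -> (forall x, 0 <= f x) ->
  \int[lebesgue_rV n]_x f (b - x)%R = \int[lebesgue_rV n]_x f x.
Proof.
move=> mf f0; have := @ge0_integral_affine_rV n (-1) b f _ mf f0.
rewrite oppr_eq0 oner_eq0 normrN normr1 expr1n invr1 mul1e => <-//.
by apply: eq_integral => x _; rewrite scaleN1r addrC.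
Qed.

End lebesgue_rV_theory.

(** * Borel sets and the Euclidean norm on R^n *)

Section rV_borel.
Context {R : realType} {n : nat}.

Lemma ball_rV_measurable (x : 'rV[R]_n) (e : R) : measurable (ball x e).
Proof.
case: (ltP 0 e) => e0; last first.
  rewrite (_ : ball x e = set0)//; apply/seteqP; split => // y [] e0' _.
  by rewrite ltNge e0 in e0'.
have -> : ball x e = \bigcap_(i in [set: 'I_n])
    (@rV_coord R n i @^-1` [set r | `|x ord0 i - r| < e]).
  apply/seteqP; split => y /=.
    by move=> [_ h] i _ /=; exact: h.
  move=> h; split => // i j; rewrite ord1; exact: h.
apply: fin_bigcap_measurable => // i _.
rewrite -[X in measurable X]setTI; apply: measurable_rV_coord => //.
rewrite (_ : [set r | _] = ball (x ord0 i) e)//.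
exact: measurable_ball.
Qed.

(** The sigma-algebra is generated by the coordinates, so an open set is exhibited as a countable
    union of sup-norm balls with rational centres and radii [1 / (k + 1)]. *)
Lemma open_measurable_rV (A : set 'rV[R]_n) : open A -> measurable A.
Proof.
move=> oA.
pose q2r (q : 'rV[rat]_n) : 'rV[R]_n := map_mx (@ratr R) q.
pose P := [set qk : 'rV[rat]_n * nat |
  ball (q2r qk.1) (qk.2.+1%:R^-1) `<=` A].
have -> : A = \bigcup_(qk in P) ball (q2r qk.1) (qk.2.+1%:R^-1).
  apply/seteqP; split; last by move=> x [qk]; exact.
  move=> x Ax; have /nbhs_ballP[e /= e0 eA] := open_nbhs_nbhs (conj oA Ax).
  have [k ke] : exists k : nat, k.+1%:R^-1 < e / 2.
    have [|k hk] := @ltr_add_invr R 0 (e / 2); first exact: divr_gt0.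
    by exists k; rewrite add0r in hk.
  have /choice[q hq] : forall i : 'I_n,
      exists q : rat, `|x ord0 i - ratr q| < k.+1%:R^-1.
    move=> i; have /rat_in_itvoo[q] : x ord0 i - k.+1%:R^-1 < x ord0 i + k.+1%:R^-1.
      by rewrite ltrD2l gtrN.
    by rewrite in_itv/= => /andP[h1 h2]; exists q; rewrite distrC ltr_distl h1.
  have xq : ball x (k.+1%:R^-1) (q2r (\row_i q i)).
    by split => // i j; rewrite ord1 /q2r !mxE; exact: hq.
  exists (\row_i q i, k); last exact: ball_sym.
  move=> y /= qy; apply: eA; apply: (@le_ball _ _ _ (k.+1%:R^-1 + k.+1%:R^-1)).
    by rewrite [leRHS]splitr lerD// ltW.
  exact: ball_triangle qy.
rewrite bigcup_mkcond; apply: countable_bigcupT_measurable => // qk.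
by case: ifPn => // _; exact: ball_rV_measurable.
Qed.

End rV_borel.

Section rV_enorm.
Context {R : realType} {n : nat}.

Lemma continuous_measurable_rV (u : 'rV[R]_n -> R) :
  continuous u -> measurable_fun setT u.
Proof.
move=> /continuousP cu; apply: (measurability _ (RGenOpens.measurableE R)).
move=> _ [_ [a [b ->] <-]]; rewrite setTI; apply: open_measurable_rV.
exact/cu/interval_open.
Qed.

Lemma measurable_rV_add d (T : measurableType d) (f g : T -> 'rV[R]_n) :
  measurable_fun setT f -> measurable_fun setT g ->
  measurable_fun setT (fun x => f x + g x)%R.
Proof.
move=> mf mg; apply: measurable_fun_rV => i.
rewrite (_ : _ \o _ = (rV_coord i \o f) \+ (rV_coord i \o g))%R; last first.
  by apply/funext => x; rewrite /rV_coord /= !mxE.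
by apply: measurable_funD; apply: measurableT_comp => //;
  exact: measurable_rV_coord.
Qed.

Lemma measurable_rV_scale d (T : measurableType d) (c : T -> R)
    (f : T -> 'rV[R]_n) :
  measurable_fun setT c -> measurable_fun setT f ->
  measurable_fun setT (fun x => c x *: f x)%R.
Proof.
move=> mc mf; apply: measurable_fun_rV => i.
rewrite (_ : _ \o _ = c \* (rV_coord i \o f))%R; last first.
  by apply/funext => x; rewrite /rV_coord /= !mxE.
by apply: measurable_funM => //; apply: measurableT_comp => //;
  exact: measurable_rV_coord.
Qed.

Lemma measurable_rV_sub d (T : measurableType d) (f g : T -> 'rV[R]_n) :
  measurable_fun setT f -> measurable_fun setT g ->
  measurable_fun setT (fun x => f x - g x)%R.
Proof.
move=> mf mg; apply: measurable_rV_add => //.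
rewrite (_ : (fun x => - g x)%R = (fun x => (-1) *: g x)%R); last first.
  by apply/funext => x; rewrite scaleN1r.
exact: measurable_rV_scale.
Qed.

Lemma enorm_ge0 (x : 'rV[R]_n) : 0 <= enorm x.
Proof. exact: sqrtr_ge0. Qed.

Lemma sqr_enorm (x : 'rV[R]_n) : enorm x ^+ 2 = \sum_(i < n) x ord0 i ^+ 2.
Proof. by rewrite sqr_sqrtr// sumr_ge0// => i _; exact: sqr_ge0. Qed.

Lemma enorm0 : enorm (0 : 'rV[R]_n) = 0.
Proof. by rewrite /enorm big1 ?sqrtr0// => i _; rewrite mxE expr0n. Qed.

Lemma enormZ (a : R) (x : 'rV[R]_n) : enorm (a *: x) = `|a| * enorm x.
Proof.
rewrite /enorm -sqrtr_sqr -sqrtrM ?sqr_ge0//; congr Num.sqrt.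
by rewrite mulr_sumr; apply: eq_bigr => i _; rewrite mxE exprMn.
Qed.

Lemma enormN (x : 'rV[R]_n) : enorm (- x) = enorm x.
Proof. by rewrite -scaleN1r enormZ normrN1 mul1r. Qed.

Lemma enormBC (x y : 'rV[R]_n) : enorm (x - y) = enorm (y - x).
Proof. by rewrite -enormN opprB. Qed.

Lemma coord_le_enorm (x : 'rV[R]_n) i : `|x ord0 i| <= enorm x.
Proof.
rewrite -[leLHS]sqrtr_sqr; rewrite /= sqrtr_sqr -sqrtr_sqr ler_wsqrtr//.
by rewrite (bigD1 i)//= lerDl sumr_ge0// => j _; exact: sqr_ge0.
Qed.

Lemma cauchy_schwarz (x y : 'rV[R]_n) :
  `|\sum_(i < n) x ord0 i * y ord0 i| <= enorm x * enorm y.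
Proof.
set S := \sum_(i < n) _.
have [x0|x0] := eqVneq (enorm x) 0.
  have xi i : x ord0 i = 0.
    by apply/eqP; rewrite -normr_le0 -x0 coord_le_enorm.
  by rewrite /S big1 ?normr0 ?mulr_ge0 ?enorm_ge0// => i _; rewrite xi mul0r.
have x0' : 0 < enorm x by rewrite lt_neqAle eq_sym x0 enorm_ge0.
rewrite -(@ler_pXn2r _ 2) ?nnegrE ?mulr_ge0 ?enorm_ge0//.
rewrite real_normK ?num_real// exprMn.
(* Expanded, this sum is [|x|^2 (|x|^2 |y|^2 - S^2)], and [|x|] is positive here. *)
have : 0 <= \sum_(i < n) (enorm x ^+ 2 * y ord0 i - S * x ord0 i) ^+ 2.
  by rewrite sumr_ge0// => i _; exact: sqr_ge0.
have -> : \sum_(i < n) (enorm x ^+ 2 * y ord0 i - S * x ord0 i) ^+ 2 =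
    enorm x ^+ 2 * (enorm x ^+ 2 * enorm y ^+ 2 - S ^+ 2).
  transitivity (\sum_(i < n) (enorm x ^+ 4 * (y ord0 i ^+ 2) -
    (2 * enorm x ^+ 2 * S) * (x ord0 i * y ord0 i) + S ^+ 2 * x ord0 i ^+ 2)).
    by apply: eq_bigr => i _; ring.
  rewrite big_split/= big_split/= sumrN -!mulr_sumr -/S.
  by rewrite -!sqr_enorm; ring.
by rewrite pmulr_rge0 ?exprn_gt0// subr_ge0.
Qed.

Lemma enormD (x y : 'rV[R]_n) : enorm (x + y) <= enorm x + enorm y.
Proof.
rewrite -(@ler_pXn2r _ 2) ?nnegrE ?addr_ge0 ?enorm_ge0//.
rewrite sqr_enorm.
rewrite (_ : \sum_(i < n) _ = enorm x ^+ 2 + enorm y ^+ 2 +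
    2 * \sum_(i < n) x ord0 i * y ord0 i); last first.
  rewrite !sqr_enorm mulr_sumr -!big_split/=; apply: eq_bigr => i _.
  by rewrite mxE; ring.
have := cauchy_schwarz x y; rewrite ler_norml => /andP[_ h].
lra.
Qed.

Lemma enorm_triangle (z x y : 'rV[R]_n) :
  enorm (x - y) <= enorm (x - z) + enorm (z - y).
Proof. by rewrite (le_trans _ (enormD _ _))// addrA subrK. Qed.

Lemma norm_le_enorm (x : 'rV[R]_n) : `|x| <= enorm x.
Proof.
rewrite -[`|x|]/(mx_norm x) mx_normrE; apply: bigmax_le; first exact: enorm_ge0.
by move=> [i j] _ /=; rewrite ord1 coord_le_enorm.
Qed.

(** Each of the [n] squares is at most the squared sup norm; bounding [n] by [n^2] keeps square
    roots out of the later constants. *)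
Lemma enorm_le_norm (x : 'rV[R]_n) : enorm x <= n%:R * `|x|.
Proof.
have xn i : `|x ord0 i| <= `|x|.
  rewrite -[leRHS]/(mx_norm x) mx_normrE.
  exact: (le_bigmax (0 : R) (fun ij : 'I_1 * 'I_n => `|x ij.1 ij.2|) (ord0, i)).
rewrite -(@ler_pXn2r _ 2) ?nnegrE ?mulr_ge0 ?enorm_ge0// sqr_enorm.
apply: (@le_trans _ _ (\sum_(i < n) `|x| ^+ 2)).
  by apply: ler_sum => i _; rewrite -real_normK ?num_real// lerXn2r ?nnegrE.
rewrite sumr_const card_ord -[leLHS]mulr_natl exprMn ler_wpM2r ?sqr_ge0//.
by rewrite -natrX ler_nat; case: (n) => // k; rewrite expnS leq_pmulr.
Qed.

Lemma enorm_eq0 (x : 'rV[R]_n) : (enorm x == 0) = (x == 0).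
Proof.
apply/eqP/eqP => [x0|->]; last exact: enorm0.
by apply/eqP; rewrite -normr_le0 -x0 norm_le_enorm.
Qed.

Lemma enorm_continuous : continuous (@enorm R n).
Proof.
move=> x; apply/(@cvgrPdist_le _ _ _ (nbhs x)) => e e0.
have e1 : 0 < e / n.+1%:R by rewrite divr_gt0.
near=> y.
have H : `|enorm x - enorm y| <= enorm (x - y).
  rewrite ler_norml; apply/andP; split.
    have := enormD (y - x) x; rewrite subrK enormBC; lra.
  by have := enormD (x - y) y; rewrite subrK; lra.
rewrite (le_trans H)// (le_trans (enorm_le_norm _))//.
have xy : `|x - y| <= e / n.+1%:R.
  near: y; exact: cvgr_dist_le.
rewrite (le_trans (ler_wpM2l _ xy))// mulrCA ler_piMr ?ltW//.
by rewrite ltr_pdivrMr// mul1r ltr_nat.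
Unshelve. all: by end_near. Qed.

Lemma measurable_enorm : measurable_fun setT (@enorm R n).
Proof. exact: (continuous_measurable_rV enorm_continuous). Qed.

Lemma open_eball (x : 'rV[R]_n) (r : R) : open (eball x r).
Proof.
have -> : eball x r = (fun y => enorm (y - x)) @^-1` [set z | z < r] by [].
apply: open_comp; last exact: open_lt.
move=> y _; apply: (@continuous_comp _ _ _ (fun y : 'rV[R]_n => y - x) (@enorm R n)).
  apply: (@cvgB _ _ _ (nbhs y)); first exact: cvg_id.
  exact: (@cvg_cst _ x _ (nbhs y) (nbhs_filter y)).
exact: enorm_continuous.
Qed.

Lemma measurable_eball (x : 'rV[R]_n) (r : R) : measurable (eball x r).
Proof. by apply: open_measurable_rV; exact: open_eball. Qed.

End rV_enorm.

(** * Volume of cubes and balls *)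

Section ball_volume.
Context {R : realType}.
Local Open Scope ereal_scope.

Lemma lebesgue_rV_cube n (r : R) : (0 <= r)%R ->
  lebesgue_rV n [set x : 'rV[R]_n | forall i, `|x ord0 i| <= r]%R =
    ((2 * r) ^+ n)%:E.
Proof.
move=> r0.
pose C m := [set x : 'rV[R]_m | forall i, `|x ord0 i| <= r]%R.
have mC m : measurable (C m).
  rewrite (_ : C m = \bigcap_(i in [set: 'I_m])
    (@rV_coord R m i @^-1` [set z | `|z| <= r]%R)); last first.
    by apply/seteqP; split => x /= h i => [_|]; exact: h.
  apply: fin_bigcap_measurable => // i _.
  rewrite -[X in measurable X]setTI; apply: measurable_rV_coord => //.
  rewrite (_ : mkset _ = `[(- r)%R, r]%classic)//.
  by apply/seteqP; split => z /=; rewrite in_itv/= ler_norml.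
rewrite -/(C n); elim: n => [|n IH].
  by rewrite expr0 /= diracE mem_set// => -[].
rewrite -(setIT (C _)) -integral_indic//; last exact: mC.
rewrite ge0_integral_lebesgue_rVS//; last first.
  by apply/measurable_EFinP; apply: measurable_indic; exact: mC.
transitivity (\int[@lebesgue_measure R]_(x in `[(- r)%R, r]) ((2 * r) ^+ n)%:E).
  rewrite [RHS]integral_mkcond; apply: eq_integral => x _.
  rewrite patchE; case: ifPn => [/set_mem|/negP xr].
    rewrite /= in_itv/= -ler_norml => xr.
    rewrite -IH -[in RHS](setIT (C _)) -integral_indic//; last exact: mC.
    apply: eq_integral => y _; rewrite !indicE; congr ((nat_of_bool _)%:R%:E).
    apply/idP/idP => /set_mem Cy; apply/mem_set => i.
      by have := Cy (lift ord0 i); rewrite mxE liftK.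
    by rewrite mxE; case: unliftP => [j _|_] //=; exact: Cy.
  apply: integral0_eq => y _; rewrite indicE memNset// => Cy.
  by apply: xr; rewrite inE/= in_itv/= -ler_norml; have := Cy ord0; rewrite mxE unlift_none.
rewrite [LHS]integral_cst// [X in _ * X]lebesgue_measure_itv/= lte_fin.
case: ifPn => [_|]; first by rewrite opprK -EFinD -EFinM exprS mulrC -mulr2n mulr_natl.
rewrite -leNgt => rN; have -> : r = 0%R by apply/eqP; rewrite eq_le r0 andbT; lra.
by rewrite mulr0 exprS mul0r mule0.
Qed.

Lemma eball_scale n (x : 'rV[R]_n) (r : R) : (0 < r)%R ->
  lebesgue_rV n (eball x r) = (r ^+ n)%:E * lebesgue_rV n (eball (0 : 'rV[R]_n) 1%R).
Proof.
move=> r0; have rn0 : r != 0%R by rewrite gt_eqF.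
rewrite -(setIT (eball x r)) -(setIT (eball 0%R 1%R)) -!integral_indic//;
  [|exact: measurable_eball..].
have := @ge0_integral_affine_rV R n r x (fun y => (\1_(eball x r) y)%:E) rn0.
rewrite (gtr0_norm r0) => H.
transitivity ((r ^+ n)%:E * ((r ^- n)%:E *
    \int[lebesgue_rV n]_y (\1_(eball x r) y)%:E)).
  by rewrite muleA -EFinM mulfV ?mul1e// expf_neq0.
congr (_ * _); rewrite -H; last 2 first.
- by apply/measurable_EFinP; apply: measurable_indic; exact: measurable_eball.
- by move=> y; rewrite lee_fin.
apply: eq_integral => y _; congr EFin; rewrite !indicE; congr ((nat_of_bool _)%:R).
apply/idP/idP => /set_mem; rewrite /eball/= => h; apply/mem_set => /=.
  by rewrite addrK enormZ gtr0_norm// gtr_pMr// subr0 in h *.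
by move: h; rewrite addrK enormZ gtr0_norm// subr0 => h; rewrite gtr_pMr.
Qed.

(** Comparison of the norms puts the ball between the cubes of half-side [1 / (n + 1)] and [1],
    whose volumes are explicit. *)
Lemma omega_ball_gt0_lty n : 0 < @omega_ball R n < +oo.
Proof.
rewrite /omega_ball.
have n0 : (0 < n.+1%:R^-1 :> R)%R by rewrite invr_gt0.
have mle (A B : set 'rV[R]_n) : measurable A -> measurable B -> A `<=` B ->
  lebesgue_rV n A <= lebesgue_rV n B.
  by move=> mA mB AB; apply: le_measure => //; rewrite inE.
have mC (r : R) : measurable [set x : 'rV[R]_n | forall i, `|x ord0 i| <= r]%R.
  rewrite (_ : mkset _ = \bigcap_(i in [set: 'I_n])
    (@rV_coord R n i @^-1` [set z | `|z| <= r]%R)); last first.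
    by apply/seteqP; split => x /= h i => [_|]; exact: h.
  apply: fin_bigcap_measurable => // i _.
  rewrite -[X in measurable X]setTI; apply: measurable_rV_coord => //.
  rewrite (_ : mkset _ = `[(- r)%R, r]%classic)//.
  by apply/seteqP; split => z /=; rewrite in_itv/= ler_norml.
apply/andP; split.
  apply: (@lt_le_trans _ _ ((2 * n.+1%:R^-1) ^+ n)%:E).
    by rewrite lte_fin exprn_gt0// mulr_gt0.
  rewrite -lebesgue_rV_cube ?invr_ge0//.
  apply: mle => //; first exact: measurable_eball.
  move=> x /= xn; rewrite /eball/= subr0 (le_lt_trans (enorm_le_norm _))//.
  apply: (@le_lt_trans _ _ (n%:R * n.+1%:R^-1)%R).
    rewrite ler_wpM2l// -[leLHS]/(mx_norm x) mx_normrE; apply: bigmax_le; first exact: ltW.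
    by move=> [i j] _; rewrite ord1 xn.
  by rewrite ltr_pdivrMr// mul1r ltr_nat.
apply: (@le_lt_trans _ _ ((2 * 1) ^+ n)%:E); last by rewrite ltry.
rewrite -lebesgue_rV_cube//.
apply: mle => //; first exact: measurable_eball.
move=> x /=; rewrite /eball/= subr0 => x1 i.
by rewrite (le_trans (coord_le_enorm _ _))// ltW.
Qed.

End ball_volume.

(** * Integrals of powers on the half-line and of radial functions *)

Section power_integrals.
Context {R : realType}.
Local Notation leb := (@lebesgue_measure R).

Lemma powR_cvgy0 (c : R) : 0 < c -> x `^ (- c) @[x --> +oo] --> (0 : R).
Proof.
move=> c0; apply/cvgrPdist_le => e e0; near=> x.
have xe : e `^ (- c^-1) <= x by near: x; exact: nbhs_pinfty_ge.
have e1 : 0 < e `^ (- c^-1) by exact: powR_gt0.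
rewrite sub0r normrN ger0_norm ?powR_ge0// powRN.
rewrite invf_ple ?posrE ?powR_gt0// ?(lt_le_trans e1)//.
have -> : e^-1 = (e `^ (- c^-1)) `^ c.
  by rewrite -powRrM mulNr mulVf ?gt_eqF// powR_inv1// ltW.
by rewrite ge0_ler_powR ?nnegrE ?ltW// (lt_le_trans e1).
Unshelve. all: by end_near. Qed.

Lemma continuous_powR (z c : R) : 0 < z -> {for z, continuous (@powR R ^~ c)}.
Proof.
move=> z0; have : derivable (@powR R ^~ c) z 1.
  by apply: derivable_powR; rewrite in_itv/= andbT.
by move/derivable1_diffP/differentiable_continuous.
Qed.

Lemma integral_powR_tail (tau c : R) : 0 < tau -> 0 < c ->
  (\int[leb]_(x in `[tau, +oo[) (x `^ (- c - 1))%:E = (tau `^ (- c) / c)%:E)%E.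
Proof.
move=> t0 c0.
rewrite (@ge0_continuous_FTC2y R _ (fun x => - c^-1 * x `^ (- c)) tau 0).
- by rewrite sub0e -EFinN mulNr opprK mulrC.
- by move=> x _; exact: powR_ge0.
- apply: derivable_within_continuous => x; rewrite in_itv/= andbT => tx.
  by apply: derivable_powR; rewrite in_itv/= andbT (lt_le_trans t0).
- rewrite -[X in _ --> X](mulr0 (- c^-1)).
  by apply: cvgMr; exact: powR_cvgy0.
- move=> x tx; apply: derivableM => //.
  by apply: derivable_powR; rewrite in_itv/= andbT (lt_trans t0).
- apply: cvg_at_right_filter; apply: cvgMr; exact: continuous_powR.
- move=> x; rewrite in_itv/= andbT => tx.
  have x0 : 0 < x by exact: lt_trans tx.
  rewrite derive1E deriveM//; last first.
    by apply: derivable_powR; rewrite in_itv/= andbT.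
  rewrite derive_cst scaler0 addr0.
  have [_ ->] := is_derive1_powR (- c) x0.
  by rewrite /GRing.scale/= mulrA mulrNN mulVf ?gt_eqF// mul1r.
Qed.

Lemma integral_powR_segment (a b c : R) : 0 < a -> a < b -> 0 < c ->
  (\int[leb]_(x in `[a, b]) (x `^ (c - 1))%:E = ((b `^ c - a `^ c) / c)%:E)%E.
Proof.
move=> a0 ab c0; have b0 := lt_trans a0 ab.
rewrite (@continuous_FTC2 R _ (fun x => c^-1 * x `^ c) a b)//.
- by rewrite -EFinB -mulrBr mulrC.
- apply: derivable_within_continuous => x; rewrite in_itv/= => /andP[ax _].
  by apply: derivable_powR; rewrite in_itv/= andbT (lt_le_trans a0).
- have H z : 0 < z -> {for z, continuous (fun x => c^-1 * x `^ c)}.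
    by move=> z0; apply: cvgMr; exact: continuous_powR.
  split.
  + move=> x; rewrite in_itv/= => /andP[ax _]; apply: derivableM => //.
    by apply: derivable_powR; rewrite in_itv/= andbT (lt_trans a0).
  + by apply: cvg_at_right_filter; exact: H.
  + by apply: cvg_at_left_filter; exact: H.
- move=> x; rewrite in_itv/= => /andP[ax _].
  have x0 : 0 < x by exact: lt_trans ax.
  rewrite derive1E deriveM//; last first.
    by apply: derivable_powR; rewrite in_itv/= andbT.
  rewrite derive_cst scaler0 addr0.
  have [_ ->] := is_derive1_powR c x0.
  by rewrite /GRing.scale/= mulrA mulVf ?gt_eqF// mul1r.
Qed.

Lemma measurable_powR_fun d (T : measurableType d) (f : T -> R) (D : set T) (c : R) :
  measurable_fun D f -> measurable_fun D (fun x => f x `^ c).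
Proof.
by move=> mf; apply: (@measurableT_comp _ _ _ _ _ _ (@powR R ^~ c)) => //;
  exact: measurable_powR.
Qed.

(** The integrand is singular at [0] when [c < 1], so the interval is exhausted by the segments from
    [rho / (k + 2)] to [rho]; the [2] makes each of them nondegenerate. *)
Lemma integral_powR_head (rho c : R) : 0 < rho -> 0 < c ->
  (\int[leb]_(x in `]0%R, rho]) (x `^ (c - 1))%:E = (rho `^ c / c)%:E)%E.
Proof.
move=> r0 c0.
pose F (k : nat) := `[rho / k.+2%:R, rho]%classic.
have FU : \bigcup_k F k = `]0%R, rho]%classic.
  apply/seteqP; split => x /=.
    move=> [k _]; rewrite /F/= !in_itv/= => /andP[kx ->].
    by rewrite (lt_le_trans _ kx)// divr_gt0.
  rewrite in_itv/= => /andP[x0 xr].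
  have [|k hk] := @ltr_add_invr R 0 (x / rho); first exact: divr_gt0.
  exists k => //; rewrite /F/= in_itv/= xr andbT.
  rewrite mulrC -ler_pdivlMr// ltW// (le_lt_trans _ hk)// add0r.
  by rewrite lef_pV2 ?posrE// ler_nat.
have ndF : nondecreasing_seq F.
  move=> i j ij; rewrite subsetEset => x; rewrite /F/= !in_itv/= => /andP[ix ->].
  rewrite andbT (le_trans _ ix)// ler_wpM2l//; first exact: ltW.
  by rewrite lef_pV2 ?posrE// ler_nat !ltnS.
have := @ge0_nondecreasing_set_cvg_integral _ (measurableTypeR R) R F
  (fun x => (x `^ (c - 1))%:E) leb ndF.
rewrite FU => H.
apply: (@cvg_unique _ _ _ _ _ _ (H _ _ _)) => //.
- by move=> i; rewrite /F; exact: measurable_itv.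
- by move=> i; apply: measurable_funTS; apply/measurable_EFinP; exact: measurable_powR.
- by move=> i x _; rewrite lee_fin powR_ge0.
rewrite (_ : (fun i => _) =
   fun i : nat => ((rho `^ c - (rho / i.+2%:R) `^ c) / c)%:E); last first.
  apply/funext => i; rewrite /F integral_powR_segment//; first exact: divr_gt0.
  by rewrite ltr_pdivrMr// ltr_pMr// ltr1n.
apply: cvg_EFin; first exact: nearW.
apply: cvgMl; rewrite -[X in _ --> X]subr0; apply: cvgB; first exact: cvg_cst.
apply/cvgrPdist_le => e e0; near=> k.
have e1 : 0 < e `^ c^-1 by exact: powR_gt0.
have ke : rho / e `^ c^-1 <= k%:R by near: k; exact: nbhs_infty_ger.
rewrite sub0r normrN ger0_norm ?powR_ge0//.
rewrite (_ : e = (e `^ c^-1) `^ c); last first.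
  by rewrite -powRrM mulVf ?gt_eqF// powRr1// ltW.
rewrite ge0_ler_powR ?nnegrE ?ltW// ?divr_gt0//.
rewrite ltr_pdivrMr// mulrC -ltr_pdivrMr// (le_lt_trans ke)// ltr_nat.
by rewrite ltnS leqnSn.
Unshelve. all: by end_near. Qed.

End power_integrals.

Section radial.
Context {R : realType}.
Variable n : nat.
Local Notation leb := (@lebesgue_measure R).
Local Notation mu := (@lebesgue_rV R n).
Local Open Scope ereal_scope.

Lemma tonelli_rV_real (f : 'rV[R]_n * measurableTypeR R -> \bar R) :
  measurable_fun setT f -> (forall x, 0 <= f x) ->
  \int[mu]_x \int[leb]_t f (x, t) = \int[leb]_t \int[mu]_x f (x, t).
Proof. move=> mf f0. exact: (@fubini_tonelli _ _ _ _ _ mu leb f). Qed.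

Lemma measurable_indic_le d (T : measurableType d) (f g : T -> R) :
  measurable_fun setT f -> measurable_fun setT g ->
  measurable_fun setT (fun x => ((f x <= g x)%R%:R : R)).
Proof.
move=> mf mg.
rewrite (_ : (fun x => _) = (fun b : bool => b%:R : R) \o (fun x => f x <= g x)%R)//.
by apply: measurableT_comp => //; exact: measurable_fun_ler.
Qed.

Lemma measurable_indic_lt d (T : measurableType d) (f g : T -> R) :
  measurable_fun setT f -> measurable_fun setT g ->
  measurable_fun setT (fun x => ((f x < g x)%R%:R : R)).
Proof.
move=> mf mg.
rewrite (_ : (fun x => _) = (fun b : bool => b%:R : R) \o (fun x => f x < g x)%R)//.
by apply: measurableT_comp => //; exact: measurable_fun_ltr.
Qed.

Lemma eball_volume (t : R) : (0 < t)%R ->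
  \int[mu]_x ((enorm x < t)%R%:R)%:E = (t ^+ n)%:E * @omega_ball R n.
Proof.
move=> t0; rewrite /omega_ball -(eball_scale 0 t0).
rewrite -(setIT (eball _ _)) -integral_indic//; last exact: measurable_eball.
apply: eq_integral => x _; rewrite indicE /eball; congr ((nat_of_bool _)%:R%:E).
by apply/idP/idP; rewrite inE/= subr0.
Qed.

(** Layer-cake formula: [m^(-a)] is the integral of [a t^(-a-1)] over [t > m]. After Tonelli, the
    set where [max(|x|, tau) < t] is a ball of radius [t], or empty when [t <= tau]. *)
Lemma integral_truncated_power (tau sigma : R) : (0 < tau)%R -> (0 < sigma)%R ->
  \int[mu]_x ((Num.max (enorm x) tau) `^ (- (n%:R + sigma)))%:E =
  ((n%:R + sigma) / sigma * tau `^ (- sigma))%:E * @omega_ball R n.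
Proof.
move=> t0 s0; set a := (n%:R + sigma)%R.
have a0 : (0 < a)%R by rewrite ltr_wpDl.
pose f (z : 'rV[R]_n * measurableTypeR R) : \bar R :=
  ((Num.max (enorm z.1) tau < z.2)%R%:R * (a * z.2 `^ (- a - 1)))%:E.
have mmax : measurable_fun setT (fun z : 'rV[R]_n * measurableTypeR R =>
    Num.max (enorm z.1) tau).
  apply: measurable_maxr => //.
  exact: (measurableT_comp (@measurable_enorm R n)).
have mf : measurable_fun setT f.
  apply/measurable_EFinP; apply: measurable_funM.
    exact: measurable_indic_lt.
  by apply: measurable_funM => //; exact: measurable_powR_fun.
have f0 z : 0 <= f z.
  by rewrite lee_fin !mulr_ge0 ?ler0n ?powR_ge0 ?ltW.
transitivity (\int[mu]_x \int[leb]_t f (x, t)).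
  apply: eq_integral => x _.
  have m0 : (0 < Num.max (enorm x) tau)%R by rewrite lt_max t0 orbT.
  rewrite /f/=; set m := Num.max _ _.
  transitivity (\int[leb]_(t in `]m, +oo[) (a%:E * (t `^ (- a - 1))%:E)).
    rewrite ge0_integralZl//; last 3 first.
    - by apply: measurable_funTS; apply/measurable_EFinP; exact: measurable_powR.
    - by move=> t _; rewrite lee_fin powR_ge0.
    - by rewrite lee_fin ltW.
    rewrite integral_itv_obnd_cbnd; last first.
      by apply: measurable_funTS; apply/measurable_EFinP; exact: measurable_powR.
    by rewrite integral_powR_tail// -EFinM mulrCA divff ?mulr1// gt_eqF.
  rewrite [LHS]integral_mkcond; apply: eq_integral => t _.
  rewrite patchE mem_setE in_itv/= andbT; case: ifPn => mt.
    by rewrite mul1r EFinM.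
  by rewrite mul0r.
rewrite tonelli_rV_real//.
transitivity (\int[leb]_(t in `]tau, +oo[)
    ((a%:E * @omega_ball R n) * (t `^ (- sigma - 1))%:E)); last first.
  have /andP[w0 woo] := @omega_ball_gt0_lty R n.
  rewrite ge0_integralZl//; last 3 first.
  - by apply: measurable_funTS; apply/measurable_EFinP; exact: measurable_powR.
  - by move=> t _; rewrite lee_fin powR_ge0.
  - by rewrite mule_ge0// ?ltW// lte_fin.
  rewrite integral_itv_obnd_cbnd; last first.
    by apply: measurable_funTS; apply/measurable_EFinP; exact: measurable_powR.
  rewrite integral_powR_tail// muleAC -EFinM; congr (_%:E * _).
  by rewrite mulrA mulrAC.
rewrite [RHS]integral_mkcond; apply: eq_integral => t _; rewrite /f/=.
rewrite patchE mem_setE in_itv/= andbT; case: ifPn => mt; last first.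
  apply: integral0_eq => x _; rewrite gt_max.
  by rewrite (negbTE mt) andbF mul0r.
have tt : (0 < t)%R by exact: lt_trans mt.
under eq_integral do rewrite gt_max mt andbT mulrC EFinM.
rewrite ge0_integralZl//; last 2 first.
- apply/measurable_EFinP; apply: measurable_indic_lt => //; exact: measurable_enorm.
- by rewrite lee_fin mulr_ge0 ?powR_ge0 ?ltW.
rewrite eball_volume// muleA -EFinM muleAC -EFinM; congr (_%:E * _).
rewrite -mulrA; congr (_ * _)%R.
rewrite -powR_mulrn ?ltW// -powRD; last by rewrite (gt_eqF tt) implybT.
by congr (_ `^ _)%R; rewrite /a; ring.
Qed.

(** Inside the ball of radius [tau] the truncated power is the constant [tau^(-a)]; its contribution
    is finite and is subtracted from the previous integral. *)
Lemma integral_power_outside_ball (tau sigma : R) : (0 < tau)%R -> (0 < sigma)%R ->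
  \int[mu]_x ((tau <= enorm x)%R%:R * (enorm x) `^ (- (n%:R + sigma)))%:E =
  (n%:R / sigma * tau `^ (- sigma))%:E * @omega_ball R n.
Proof.
move=> t0 s0; set a := (n%:R + sigma)%R.
have /andP[w0 woo] := @omega_ball_gt0_lty R n.
have me := @measurable_enorm R n.
have H : \int[mu]_x ((Num.max (enorm x) tau) `^ (- a))%:E =
   \int[mu]_x ((tau <= enorm x)%R%:R * (enorm x) `^ (- a))%:E +
   (tau `^ (- a))%:E * ((tau ^+ n)%:E * @omega_ball R n).
  rewrite -eball_volume// -ge0_integralZl//; last 2 first.
  - by apply/measurable_EFinP; apply: measurable_indic_lt.
  - by rewrite lee_fin powR_ge0.
  rewrite -ge0_integralD//; last 4 first.
  - by move=> x _; rewrite lee_fin mulr_ge0// powR_ge0.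
  - apply/measurable_EFinP; apply: measurable_funM.
      by apply: measurable_indic_le.
    exact: measurable_powR_fun.
  - by move=> x _; rewrite -EFinM lee_fin mulr_ge0// powR_ge0.
  - apply/measurable_EFinP; apply: measurable_funM => //.
    by apply: measurable_indic_lt.
  apply: eq_integral => x _; rewrite -EFinM -EFinD; congr EFin.
  by case: (leP tau (enorm x)) => h; rewrite ?(mul1r, mulr1, mul0r, mulr0, addr0, add0r).
rewrite integral_truncated_power// in H.
have fw : @omega_ball R n \is a fin_num by rewrite ge0_fin_numE ?ltW.
rewrite -(fineK fw) in H *.
set w := fine _ in H *.
have HJ : \int[mu]_x ((tau <= enorm x)%R%:R * (enorm x) `^ (- a))%:E =
  (a / sigma * tau `^ (- sigma) * w - tau `^ (- a) * (tau ^+ n * w))%:E.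
  rewrite EFinB -EFinM in H *.
  by rewrite [in RHS]/a H -EFinM addeK.
rewrite HJ -EFinM; congr EFin.
have -> : (tau `^ (- a) * (tau ^+ n * w) = tau `^ (- sigma) * w)%R.
  rewrite mulrA; congr (_ * _)%R; rewrite -powR_mulrn ?ltW// -powRD; last first.
    by rewrite (gt_eqF t0) implybT.
  by congr (_ `^ _)%R; rewrite /a; ring.
by rewrite /a; field; rewrite gt_eqF.
Qed.

(** The [p]-th power of the minimum is the integral of [G^p p t^(p-1)] for [t] up to
    [min(rho, |x|)], where [rho = 2 / G] is the radius at which the two branches meet. Tonelli
    leaves the power outside a ball of radius [t]. With [sigma = s p] the last factor becomes
    [1 / (p s (1 - s))]. *)
Lemma integral_min_power (G p sigma : R) : (0 < G)%R -> (0 < sigma < p)%R ->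
  \int[mu]_x ((Num.min (G * enorm x) 2) `^ p * (enorm x) `^ (- (n%:R + sigma)))%:E =
  (n%:R * (2 `^ (p - sigma) * G `^ sigma) * (p / (sigma * (p - sigma))))%:E *
    @omega_ball R n.
Proof.
move=> G0 /andP[s0 sp]; set a := (n%:R + sigma)%R.
have p0 := lt_trans s0 sp.
have me := @measurable_enorm R n.
have /andP[w0 woo] := @omega_ball_gt0_lty R n.
pose rho := (2 / G)%R.
have rho0 : (0 < rho)%R by rewrite divr_gt0.
pose f (z : 'rV[R]_n * measurableTypeR R) : \bar R :=
  ((0 < z.2)%R%:R * (z.2 <= rho)%R%:R * (z.2 <= enorm z.1)%R%:R *
    (G `^ p * p * z.2 `^ (p - 1) * enorm z.1 `^ (- a)))%:E.
have mf : measurable_fun setT f.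
  apply/measurable_EFinP; apply: measurable_funM.
    apply: measurable_funM; first apply: measurable_funM.
    - exact: measurable_indic_lt.
    - exact: measurable_indic_le.
    - apply: measurable_indic_le => //; exact: measurableT_comp.
  apply: measurable_funM.
    by apply: measurable_funM => //; exact: measurable_powR_fun.
  by apply: measurable_powR_fun; exact: measurableT_comp.
have f0 z : 0 <= f z.
  by rewrite lee_fin !mulr_ge0 ?ler0n ?powR_ge0 ?ltW.
transitivity (\int[mu]_x \int[leb]_t f (x, t)).
  apply: eq_integral => x _; rewrite /f/=.
  have [x0|x0] := eqVneq (enorm x) 0%R.
    rewrite x0 mulr0 (min_idPl _)// [(0 `^ p)%R]powR0 ?gt_eqF// mul0r//.
    apply/esym/integral0_eq => t _; case: (ltP 0%R t) => t0.
      by rewrite mulr0 mul0r.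
    by rewrite !mul0r.
  have {}x0 : (0 < enorm x)%R by rewrite lt_neqAle eq_sym x0 enorm_ge0.
  set m := Num.min rho (enorm x).
  have m0 : (0 < m)%R by rewrite lt_min rho0.
  transitivity (\int[leb]_(t in `]0%R, m])
     ((G `^ p * p * enorm x `^ (- a))%:E * (t `^ (p - 1))%:E)).
    rewrite ge0_integralZl//; last 3 first.
    - by apply: measurable_funTS; apply/measurable_EFinP; exact: measurable_powR.
    - by move=> t _; rewrite lee_fin powR_ge0.
    - by rewrite lee_fin !mulr_ge0 ?ler0n ?powR_ge0 ?ltW.
    rewrite integral_powR_head// -EFinM; congr EFin.
    rewrite mulrAC; congr (_ * _)%R.
    rewrite -mulrA (mulrC p) divfK ?gt_eqF// -powRM ?ltW//.
    congr (_ `^ _)%R; rewrite /m /rho minC minr_pMr ?ltW//.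
    by rewrite mulrCA divff ?gt_eqF// mulr1.
  rewrite [LHS]integral_mkcond; apply: eq_integral => t _.
  rewrite patchE mem_setE in_itv/= /m le_min; case: ifPn.
    by move=> /and3P[-> -> ->]; rewrite !mul1r -EFinM; congr EFin; ring.
  by rewrite !negb_and => /or3P[] /negbTE ->; rewrite ?(mul0r, mulr0).
rewrite tonelli_rV_real//.
transitivity (\int[leb]_(t in `]0%R, rho])
    (((G `^ p * p * n%:R / sigma)%:E * @omega_ball R n) * (t `^ (p - sigma - 1))%:E)); last first.
  rewrite ge0_integralZl//; last 3 first.
  - by apply: measurable_funTS; apply/measurable_EFinP; exact: measurable_powR.
  - by move=> t _; rewrite lee_fin powR_ge0.
  - apply: mule_ge0; last exact: ltW.
    by rewrite lee_fin !mulr_ge0 ?invr_ge0 ?powR_ge0 ?ler0n// ltW.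
  rewrite integral_powR_head ?subr_gt0// muleAC -EFinM; congr (_%:E * _).
  have -> : (rho `^ (p - sigma) = 2 `^ (p - sigma) * (G `^ sigma / G `^ p))%R.
    have GE : (G^-1 = G `^ (- 1))%R by rewrite powR_inv1// ltW.
    rewrite /rho powRM ?invr_ge0 ?ltW// GE -powRrM mulN1r opprB.
    by congr (_ * _)%R; rewrite powRB// (gt_eqF G0) implybT.
  have Gp : (0 < G `^ p)%R by exact: powR_gt0.
  have ps : (0 < p - sigma)%R by rewrite subr_gt0.
  by field; rewrite !gt_eqF.
rewrite [RHS]integral_mkcond; apply: eq_integral => t _; rewrite /f/=.
rewrite patchE mem_setE in_itv/=; case: ifPn => tr; last first.
  apply: integral0_eq => x _; move: tr.
  by rewrite negb_and => /orP[] /negbTE ->; rewrite ?(mul0r, mulr0).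
have /andP[tt trho] := tr; rewrite tt trho.
under eq_integral do rewrite !mul1r mulrCA EFinM.
rewrite ge0_integralZl//; last 3 first.
- apply/measurable_EFinP; apply: measurable_funM.
    exact: measurable_indic_le.
  exact: measurable_powR_fun.
- by move=> x _; rewrite lee_fin mulr_ge0// powR_ge0.
- by rewrite lee_fin !mulr_ge0 ?ler0n ?powR_ge0 ?ltW.
rewrite integral_power_outside_ball// muleA -EFinM muleAC -EFinM; congr (_%:E * _).
have -> : (t `^ (p - sigma - 1) = t `^ (p - 1) * t `^ (- sigma))%R.
  by rewrite -powRD ?(gt_eqF tt) ?implybT//; congr (_ `^ _)%R; ring.
by field; rewrite gt_eqF.
Qed.

End radial.

(** * Differences and gradients *)

Section power_inequalities.
Context {R : realType}.

(** Hölder for two terms against the vector [(1, 1)]. *)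
Lemma powRD_le (p a b : R) : 1 < p -> 0 <= a -> 0 <= b ->
  (a + b) `^ p <= 2 `^ (p - 1) * (a `^ p + b `^ p).
Proof.
move=> p1 a0 b0; have p0 : 0 < p by exact: lt_trans p1.
have pp : 0 < p - 1 by rewrite subr_gt0.
pose q := p / (p - 1).
have q0 : 0 < q by rewrite divr_gt0.
have pq : p^-1 + q^-1 = 1 by rewrite /q; field; rewrite !gt_eqF.
have := hoelder2 a0 b0 (@ler01 R) (@ler01 R) p0 q0 pq.
rewrite !mulr1 !powR1 => H.
have S0 : 0 <= a `^ p + b `^ p by rewrite addr_ge0// powR_ge0.
apply: (@le_trans _ _ (((a `^ p + b `^ p) `^ p^-1 * 2 `^ q^-1) `^ p)).
  by rewrite ge0_ler_powR ?nnegrE ?addr_ge0 ?mulr_ge0 ?powR_ge0// ltW.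
rewrite powRM ?powR_ge0// -!powRrM mulVf ?gt_eqF// powRr1//.
rewrite mulrC (_ : q^-1 * p = p - 1)//.
by rewrite /q; field; rewrite !gt_eqF.
Qed.

End power_inequalities.

Section jensen.
Context d (T : measurableType d) (R : realType).
Variable mu : {measure set T -> \bar R}.
Local Open Scope ereal_scope.

(** Hölder between [f] restricted to [D] and the indicator of [D], with [q = p / (p - 1)]: the
    [p]-th power of the [q]-norm of the indicator is [mu D] to the power [p / q = p - 1]. *)
Lemma jensen_power (p : R) (D : set T) (f : T -> R) : (1 < p)%R ->
  measurable D -> measurable_fun setT f -> (forall x, 0 <= f x)%R ->
  (\int[mu]_(x in D) (f x)%:E) `^ p <=
  mu D `^ (p - 1) * \int[mu]_(x in D) (f x `^ p)%:E.
Proof.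
move=> p1 mD mf f0; have p0 : (0 < p)%R by exact: lt_trans p1.
have pp : (0 < p - 1)%R by rewrite subr_gt0.
pose q := (p / (p - 1))%R.
have q0 : (0 < q)%R by rewrite divr_gt0.
have pq : (p^-1 + q^-1 = 1)%R by rewrite /q; field; rewrite !gt_eqF.
have mfD : measurable_fun setT (f \* \1_D)%R by exact: measurable_funM.
have m1D : measurable_fun setT (\1_D : T -> R) by exact: measurable_indic.
have := hoelder mu mfD m1D p0 q0 pq.
rewrite Lnorm1.
have -> : \int[mu]_x `|(EFin \o (f \* \1_D \* \1_D)%R) x| =
    \int[mu]_(x in D) (f x)%:E.
  rewrite [RHS]integral_mkcond; apply: eq_integral => x _.
  rewrite patchE /= indicE; case: ifPn => _; rewrite ?mulr1 ?mulr0 ?normr0//.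
  by rewrite ger0_norm.
move=> H.
have I0 : 0 <= \int[mu]_(x in D) (f x)%:E.
  by apply: integral_ge0 => x _; rewrite lee_fin.
apply: (@le_trans _ _ (('N[mu]_p%:E[EFin \o (f \* \1_D)%R] *
    'N[mu]_q%:E[EFin \o \1_D]) `^ p)).
  apply: gt0_ler_poweR => //; first exact: ltW.
    by rewrite in_itv/= leey I0.
  by rewrite in_itv/= leey mule_ge0// Lnorm_ge0.
rewrite poweRM ?Lnorm_ge0// poweR_Lnorm ?gt_eqF// muleC.
rewrite -[X in _ `^ X * _](_ : q * (p - 1) = p)%R; last first.
  by rewrite /q; field; rewrite gt_eqF.
rewrite [X in X * _]poweRrM poweR_Lnorm ?gt_eqF//.
rewrite le_eqVlt; apply/orP; left; apply/eqP; congr (_ `^ _ * _).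
  rewrite -(setIT D) -integral_indic//; apply: eq_integral => x _ /=.
  rewrite setIT indicE; congr EFin.
  by case: (x \in D); rewrite ?normr1 ?powR1// normr0 powR0// gt_eqF.
rewrite [RHS]integral_mkcond; apply: eq_integral => x _.
rewrite patchE /= indicE; case: ifPn => _; rewrite ?mulr1 ?mulr0 ?normr0//.
  by rewrite ger0_norm.
by rewrite powR0// gt_eqF.
Qed.

End jensen.

Section directional_derivatives.
Context {R : realType} {n : nat}.
Implicit Types (u : 'rV[R]_n -> R) (x v w : 'rV[R]_n).

Lemma is_derive_line u x v (t : R) :
  derivable u (x + t *: v) v ->
  is_derive t 1 (fun t => u (x + t *: v)) ('D_v u (x + t *: v)).
Proof.
move=> du.
have E : (fun h : R => h^-1 *: (((fun t => u (x + t *: v)) \o shift t) (h *: 1) -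
    u (x + t *: v))) =
  (fun h : R => h^-1 *: ((u \o shift (x + t *: v)) (h *: v) - u (x + t *: v))).
  apply/funext => h /=; congr (_ *: (u _ - _)).
  by rewrite [h *: 1]mulr1 scalerDl addrCA.
by split; rewrite /derivable /derive E.
Qed.

Lemma MVT_line u x v (h : R) :
  (forall t, derivable u (x + t *: v) v) ->
  exists2 c, `|c| <= `|h| & u (x + h *: v) - u x = 'D_v u (x + c *: v) * h.
Proof.
move=> du.
have D (t : R) : is_derive t 1 (fun t => u (x + t *: v)) ('D_v u (x + t *: v)).
  exact: is_derive_line.
have C : continuous (fun t : R => u (x + t *: v)).
  move=> t; apply: differentiable_continuous; apply/derivable1_diffP.
  exact: (@ex_derive _ _ _ _ _ _ _ (D t)).
have [h0|h0] := leP 0 h.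
  have [|c] := MVT_segment h0 (fun t _ => D t); first exact: continuous_subspaceT.
  rewrite in_itv/= subr0 scale0r addr0 => /andP[c0 ch] E; exists c => //.
  by rewrite !ger0_norm.
have [|c] := MVT_segment (ltW h0) (fun t _ => D t); first exact: continuous_subspaceT.
rewrite in_itv/= scale0r addr0 sub0r mulrN => /andP[hc c0] E; exists c.
  by rewrite !ler0_norm ?lerN2// ltW.
by rewrite -opprB E opprK.
Qed.

(** The increment along [h (v + w)] is split at [x + h w]. The mean value theorem and continuity of
    the derivative along [v] handle the first half; the second needs only derivability at [x]. This
    asymmetry lets directions be added one by one, without Fréchet differentiability. *)
Lemma is_deriveDdir u v w x :
  (forall y, derivable u y v) -> {for x, continuous ('D_v u)} ->
  derivable u x w ->
  is_derive x (v + w) u ('D_v u x + 'D_w u x).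
Proof.
move=> dv cv dw.
have H : (fun h : R => h^-1 *: ((u \o shift x) (h *: (v + w)) - u x)) @ 0^' -->
    'D_v u x + 'D_w u x.
  have -> : (fun h : R => h^-1 *: ((u \o shift x) (h *: (v + w)) - u x)) =
     (fun h : R => h^-1 *: (u (h *: w + x + h *: v) - u (h *: w + x))) \+
     (fun h : R => h^-1 *: ((u \o shift x) (h *: w) - u x)).
    apply/funext => h /=; rewrite -scalerDr; congr (_ *: _).
    rewrite addrA subrK scalerDr; congr (u _ - _).
    by rewrite [RHS]addrC addrA.
  apply: cvgD; last exact: dw.
  apply/cvgrPdist_le => e e0.
  have /cvgrPdist_le/(_ e e0)/nbhs_ballP[d /= d0 dP] := cv.
  pose K := `|v| + `|w| + 1.
  have K0 : 0 < K by rewrite ltr_wpDl// addr_ge0.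
  near=> h.
  have h0 : h != 0 by near: h; exact: nbhs_dnbhs_neq.
  have hd : `|h| < d / K.
    near: h; apply: dnbhs0_lt; exact: divr_gt0.
  have [c ch ->] := @MVT_line u (h *: w + x) v h (fun t => dv _).
  rewrite [_ *: _]mulrC mulfK//.
  apply: dP; rewrite -ball_normE /=.
  rewrite opprD opprD addrA addrCA subrr addr0 -opprD normrN.
  rewrite (le_lt_trans (ler_normD _ _))// !normrZ.
  apply: (@le_lt_trans _ _ (`|h| * (`|w| + `|v|))).
    by rewrite mulrDr lerD2l ler_wpM2r.
  rewrite (@le_lt_trans _ _ (`|h| * K))//; last by rewrite -ltr_pdivlMr.
  by rewrite ler_wpM2l// /K [`|w| + _]addrC lerDl.
split; first by apply/cvg_ex; exists ('D_v u x + 'D_w u x).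
exact/cvg_lim.
Unshelve. all: by end_near. Qed.

Lemma is_deriveZdir u v (a : R) x :
  derivable u x v -> is_derive x (a *: v) u (a * 'D_v u x).
Proof.
move=> dv; have [->|a0] := eqVneq a 0.
  rewrite scale0r mul0r; split; first exact: derivable0.
  exact: derive0.
have := @is_derive_line u x v 0; rewrite scale0r addr0 => /(_ dv) D0.
have D1 : is_derive (0 : R) 1 (fun t : R => a * t) a.
  apply: is_derive_eq; by rewrite [_ *: _]mulr1.
have D2 : is_derive (0 : R) 1 ((fun t => u (x + t *: v)) \o (fun t : R => a * t)) ('D_v u x * a).
  by apply: is_derive1_comp; rewrite mulr0.
have E : (fun h : R => h^-1 *: ((u \o shift x) (h *: (a *: v)) - u x)) =
  (fun h : R => h^-1 *: ((((fun t => u (x + t *: v)) \o (fun t : R => a * t)) \o shift 0) (h *: 1) -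
    ((fun t => u (x + t *: v)) \o (fun t : R => a * t)) 0)).
  apply/funext => h /=; rewrite mulr0 scale0r !addr0; congr (_ *: (u _ - _)).
  by rewrite [h *: 1]mulr1 addrC scalerA mulrC.
case: D2 => D2 D3.
split; first by rewrite /derivable E.
by rewrite /derive E mulrC -D3.
Qed.

(** Recovers every directional derivative from the partial ones. The induction runs over a list of
    coordinates so that partial sums of [v] are themselves directions; the coordinate added has a
    continuous derivative, as [is_deriveDdir] requires. *)
Lemma Ck1_is_derive u v : Ck 1 u ->
  (forall x, is_derive x v u (\sum_(i < n) v ord0 i * partial i u x)) /\
  continuous (fun x => \sum_(i < n) v ord0 i * partial i u x).
Proof.
move=> [cu du].
have H (r : seq 'I_n) :
  (forall x, is_derive x (\sum_(i <- r) v ord0 i *: delta_mx ord0 i) u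
      (\sum_(i <- r) v ord0 i * partial i u x)) /\
  continuous (fun x => \sum_(i <- r) v ord0 i * partial i u x).
  elim: r => [|i r [IH1 IH2]].
    split.
      move=> x; rewrite !big_nil; split; first exact: derivable0.
      exact: derive0.
    rewrite (_ : (fun _ => _) = cst 0); last by apply/funext => x; rewrite big_nil.
    exact: cst_continuous.
  have [di [ci _]] := du i.
  have E y : is_derive y (v ord0 i *: delta_mx ord0 i) u (v ord0 i * partial i u y).
    exact: is_deriveZdir.
  have EE : 'D_(v ord0 i *: delta_mx ord0 i) u = (fun y => v ord0 i * partial i u y).
    by apply/funext => y; exact: (@derive_val _ _ _ _ _ _ _ (E y)).
  have C : continuous (fun y => v ord0 i * partial i u y).
    move=> y; apply: (@cvgMr _ _ (nbhs y)); exact: ci.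
  split.
    move=> x; rewrite !big_cons.
    rewrite -(@derive_val _ _ _ _ _ _ _ (IH1 x)).
    rewrite -(@derive_val _ _ _ _ _ _ _ (E x)).
    apply: is_deriveDdir.
    - by move=> y; exact: (@ex_derive _ _ _ _ _ _ _ (E y)).
    - by rewrite EE; exact: C.
    - exact: (@ex_derive _ _ _ _ _ _ _ (IH1 x)).
  rewrite (_ : (fun _ => _) = (fun y => v ord0 i * partial i u y) \+
    (fun x => \sum_(j <- r) v ord0 j * partial j u x)); last first.
    by apply/funext => x; rewrite big_cons.
  by move=> x; apply: (@cvgD _ _ _ (nbhs x)); [exact: C|exact: IH2].
have := H (index_enum 'I_n).
by rewrite -(row_sum_delta v).
Qed.

Lemma continuous_grad u : Ck 1 u -> continuous (grad u).
Proof.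
move=> [_ du] x A /nbhs_ballP[e /= e0 eA].
have H i : \forall y \near x, `|partial i u x - partial i u y| < e.
  by have [_ [ci _]] := du i; have /cvgrPdist_lt := ci x; exact.
have : \forall y \near x, forall i, `|partial i u x - partial i u y| < e.
  exact: (@filter_forall _ _ _ (nbhs x) (nbhs_filter x) H).
apply: filterS => y Hy; apply: eA; split => // i j.
by rewrite ord1 !mxE; exact: Hy.
Qed.

Lemma continuous_enorm_grad u : Ck 1 u -> continuous (fun x => enorm (grad u x)).
Proof.
move=> cu x; apply: (@continuous_comp _ _ _ (grad u) (@enorm R n)).
  exact: continuous_grad.
exact: enorm_continuous.
Qed.

End directional_derivatives.

(** * Translation estimates *)

Section translation_bounds.
Context {R : realType} {n : nat}.
Implicit Types (u : 'rV[R]_n -> R) (x h : 'rV[R]_n).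
Local Notation leb := (@lebesgue_measure R).
Local Notation mu := (@lebesgue_rV R n).
Local Open Scope ereal_scope.

Lemma continuous_line x h : continuous (fun t : R => x + t *: h)%R.
Proof.
move=> t; apply: cvgD; first exact: cvg_cst.
by apply: cvgZl; exact: cvg_id.
Qed.

Lemma continuous_along u x h : continuous u ->
  continuous (fun t : R => u (x + t *: h)%R).
Proof. by move=> cu t; exact: (continuous_comp (@continuous_line x h t) (cu _)). Qed.

Lemma norm_difference_le_integral u x h : Ck 1 u ->
  (`|u (x + h)%R - u x|%R)%:E <=
  \int[leb]_(t in `[0%R, 1%R]) (enorm h * enorm (grad u (x + t *: h)))%:E.
Proof.
move=> cu; have [cu0 _] := cu.
have [D C] := Ck1_is_derive h cu.
pose f t := (\sum_(i < n) h ord0 i * partial i u (x + t *: h))%R.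
pose F t := u (x + t *: h)%R.
have dF (t : R) : is_derive t 1%R F (f t).
  rewrite /f -(@derive_val _ _ _ _ _ _ _ (D (x + t *: h)%R)).
  by apply: is_derive_line; exact: (@ex_derive _ _ _ _ _ _ _ (D _)).
have cf : continuous f.
  exact: (continuous_along C).
have cF : continuous F.
  move=> t; apply: differentiable_continuous; apply/derivable1_diffP.
  exact: (@ex_derive _ _ _ _ _ _ _ (dF t)).
have := @continuous_FTC2 R f F 0%R 1%R ltr01.
rewrite /F scale1r scale0r addr0 => FTC.
have mf : measurable_fun setT f by exact: continuous_measurable_fun.
have mg : measurable_fun setT (fun t : R => enorm (grad u (x + t *: h)))%R.
  apply: continuous_measurable_fun.
  exact: (continuous_along (continuous_enorm_grad cu)).
rewrite -[X in X <= _]/(`|(u (x + h) - u x)%:E|) EFinB -FTC; last 3 first.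
- exact: continuous_subspaceT.
- split.
  + by move=> t _; exact: (@ex_derive _ _ _ _ _ _ _ (dF t)).
  + by apply: cvg_at_right_filter; exact: cF.
  + by apply: cvg_at_left_filter; exact: cF.
- by move=> t _; rewrite derive1E; exact: (@derive_val _ _ _ _ _ _ _ (dF t)).
apply: (le_trans (le_abse_integral _ _ _)) => //.
  by apply: measurable_funTS; exact/measurable_EFinP.
apply: ge0_le_integral_nomeas => t _ //.
rewrite lee_fin (le_trans _ (cauchy_schwarz _ _))// /f.
by rewrite le_eqVlt; apply/orP; left; apply/eqP; congr (`|_|)%R; apply: eq_bigr => i _; rewrite mxE.
Qed.

(** The difference is an integral of the gradient along the segment. Jensen on [[0, 1]], which has
    measure [1], costs no constant, and after Tonelli each [t] gives the same integral by
    translation invariance. *)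
Lemma integral_difference_grad u h (p : R) : (1 < p)%R -> Ck 1 u ->
  \int[mu]_x ((`|u (x + h) - u x| `^ p)%R)%:E <=
  (enorm h `^ p)%:E * \int[mu]_x (enorm (grad u x) `^ p)%:E.
Proof.
move=> p1 cu; have p0 : (0 < p)%R by exact: lt_trans p1.
have [cu0 _] := cu.
have cg := continuous_enorm_grad cu.
have mg : measurable_fun setT (fun x => enorm (grad u x)) by exact: continuous_measurable_rV.
pose f (z : 'rV[R]_n * measurableTypeR R) : \bar R :=
  (((0 <= z.2)%R%:R * (z.2 <= 1)%R%:R) *
    (enorm h `^ p * enorm (grad u (z.1 + z.2 *: h)) `^ p))%:E.
have mf : measurable_fun setT f.
  apply/measurable_EFinP; apply: measurable_funM.
    by apply: measurable_funM; exact: measurable_indic_le.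
  apply: measurable_funM => //; apply: measurable_powR_fun.
  apply: (measurableT_comp mg); apply: measurable_rV_add => //.
  exact: measurable_rV_scale.
have f0 z : 0 <= f z by rewrite lee_fin !mulr_ge0 ?ler0n ?powR_ge0.
apply: (@le_trans _ _ (\int[mu]_x \int[leb]_t f (x, t))).
  apply: ge0_le_integral_nomeas => x _; first by rewrite lee_fin powR_ge0.
  have mgx : measurable_fun setT (fun t : R => enorm h * enorm (grad u (x + t *: h)))%R.
    apply: measurable_funM => //; apply: continuous_measurable_fun.
    exact: (continuous_along cg).
  have g0 (t : R) : (0 <= enorm h * enorm (grad u (x + t *: h)))%R.
    by rewrite mulr_ge0// enorm_ge0.
  have m01 : measurable (`[0%R, 1%R]%classic : set (measurableTypeR R)).
    exact: measurable_itv.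
  have := @jensen_power _ (measurableTypeR R) R leb p `[0%R, 1%R]%classic
    (fun t : R => enorm h * enorm (grad u (x + t *: h)))%R p1 m01 mgx g0.
  have L01 : leb `[0%R, 1%R]%classic = 1.
    by rewrite lebesgue_measure_itv/= lte_fin ltr01 oppr0 adde0.
  rewrite [X in X `^ _ * _]L01 poweR1r mul1e => J.
  rewrite -poweR_EFin; apply: (@le_trans _ _ _ _ _ (le_trans _ J)).
    apply: gt0_ler_poweR; first exact: ltW.
    - by rewrite in_itv/= leey lee_fin normr_ge0.
    - by rewrite in_itv/= leey andbT; apply: integral_ge0 => t _; rewrite lee_fin.
    exact: norm_difference_le_integral.
  rewrite [leLHS]integral_mkcond; apply: ge0_le_integral_nomeas => t _.
    by apply: erestrict_ge0 => z _; rewrite lee_fin powR_ge0.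
  rewrite patchE mem_setE in_itv/= /f/=; case: ifPn => [/andP[-> ->]|_].
    by rewrite !mul1r powRM// enorm_ge0.
  by rewrite lee_fin !mulr_ge0 ?ler0n ?powR_ge0.
rewrite tonelli_rV_real//.
set I := \int[mu]_x _.
have I0 : 0 <= I by apply: integral_ge0 => x _; rewrite lee_fin powR_ge0.
apply: (@le_trans _ _ (\int[leb]_(t in `[0%R, 1%R]) ((enorm h `^ p)%:E * I))); last first.
  rewrite integral_cst ?measurable_itv// [X in _ * X]lebesgue_measure_itv/= lte_fin ltr01.
  by rewrite oppr0 adde0 mule1.
rewrite [leRHS]integral_mkcond; apply: ge0_le_integral_nomeas => t _.
  by apply: integral_ge0 => x _.
rewrite patchE mem_setE in_itv/= /f/=; case: ifPn => [/andP[-> ->]|].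
  under eq_integral do rewrite !mul1r EFinM.
  have mgt : measurable_fun setT (fun x => (enorm (grad u (x + t *: h)%R) `^ p)%:E).
    apply/measurable_EFinP; apply: measurable_powR_fun.
    apply: (measurableT_comp mg); exact: measurable_rV_add.
  have gt0 (x : 'rV[R]_n) : setT x -> 0 <= (enorm (grad u (x + t *: h)%R) `^ p)%:E.
    by rewrite lee_fin powR_ge0.
  have c0 : 0 <= (enorm h `^ p)%:E by rewrite lee_fin powR_ge0.
  have -> := ge0_integralZl mu measurableT mgt gt0 c0.
  have mg' : measurable_fun setT (fun x => (enorm (grad u x) `^ p)%:E).
    by apply/measurable_EFinP; exact: measurable_powR_fun.
  have g0 (x : 'rV[R]_n) : 0 <= (enorm (grad u x) `^ p)%:E by rewrite lee_fin powR_ge0.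
  have -> := ge0_integral_shift_rV (t *: h) mg' g0.
  exact: lexx.
rewrite negb_and => /orP[] /negbTE ->; rewrite ?(mul0r, mulr0) integral0_eq//;
  by move=> x _; rewrite ?(mul0r, mulr0).
Qed.

Lemma integral_difference_le u h (p : R) : (1 < p)%R -> measurable_fun setT u ->
  \int[mu]_x ((`|u (x + h) - u x| `^ p)%R)%:E <=
  (2 `^ p)%:E * \int[mu]_x ((`|u x| `^ p)%R)%:E.
Proof.
move=> p1 mu'; have p0 : (0 < p)%R by exact: lt_trans p1.
have mup : measurable_fun setT (fun x => (`|u x| `^ p)%:E).
  apply/measurable_EFinP; apply: measurable_powR_fun.
  exact: measurableT_comp.
have muh : measurable_fun setT (fun x => (`|u (x + h)%R| `^ p)%:E).
  exact: (measurableT_comp mup (measurable_rV_add _ _)).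
apply: (@le_trans _ _ (\int[mu]_x ((2 `^ (p - 1))%:E * ((`|u (x + h)%R| `^ p)%:E + (`|u x| `^ p)%:E)))).
  apply: ge0_le_integral_nomeas => x _; first by rewrite lee_fin powR_ge0.
  rewrite -EFinD -EFinM lee_fin (le_trans _ (powRD_le p1 _ _))//.
  by rewrite ge0_ler_powR ?nnegrE ?addr_ge0// ?ler_normB// ltW.
rewrite ge0_integralZl//; last 2 first.
- exact: emeasurable_funD.
- by move=> x _; rewrite -EFinD lee_fin addr_ge0// powR_ge0.
rewrite ge0_integralD//.
rewrite (@ge0_integral_shift_rV R n h (fun x => (`|u x| `^ p)%:E))//.
set I := \int[mu]_x _.
have I0 : 0 <= I by apply: integral_ge0 => x _; rewrite lee_fin powR_ge0.
have -> : I + I = 2%:E * I by rewrite -mule2n mule_natl.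
rewrite muleA -EFinM (_ : 2 `^ (p - 1) * 2 = 2 `^ p)%R//.
by rewrite mulrC mulr_powRB1.
Qed.

End translation_bounds.

Section gagliardo_translation.
Context {R : realType} {n : nat}.
Local Notation mu := (@lebesgue_rV R n).
Local Open Scope ereal_scope.

(** Substitution [y = x + h] and Tonelli. In this form a bound on the differences for fixed [h]
    becomes a bound on the seminorm by a radial integral. *)
Lemma gagliardo_powerE (u : 'rV[R]_n -> R) (s p : R) : (0 < p)%R ->
  measurable_fun setT u ->
  gagliardo s p u `^ p =
  \int[mu]_h ((enorm h `^ (- (n%:R + s * p)))%:E *
     \int[mu]_x ((`|u (x + h) - u x| `^ p)%R)%:E).
Proof.
move=> p0 mu'; rewrite /gagliardo -poweRrM mulVf ?gt_eqF// poweRe1; last first.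
  by apply: integral_ge0 => z _; rewrite lee_fin mulr_ge0// ?invr_ge0 powR_ge0.
pose f (z : 'rV[R]_n * 'rV[R]_n) : \bar R :=
  ((`|u z.1 - u z.2| `^ p / enorm (z.1 - z.2) `^ (n%:R + s * p))%R)%:E.
have m1 : measurable_fun setT (fun z : 'rV[R]_n * 'rV[R]_n => u z.1).
  exact: measurableT_comp.
have m2 : measurable_fun setT (fun z : 'rV[R]_n * 'rV[R]_n => u z.2).
  exact: measurableT_comp.
have mf : measurable_fun setT f.
  apply/measurable_EFinP; apply: measurable_funM.
    apply: measurable_powR_fun; apply: measurableT_comp => //.
    exact: measurable_funB.
  rewrite (_ : (fun _ => _) = (fun z : 'rV[R]_n * 'rV[R]_n =>
      enorm (z.1 - z.2) `^ (- (n%:R + s * p))))%R; last first.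
    by apply/funext => z; rewrite powRN.
  apply: measurable_powR_fun; apply: (measurableT_comp (@measurable_enorm R n)).
  exact: measurable_rV_sub.
have f0 z : 0 <= f z by rewrite lee_fin mulr_ge0 ?invr_ge0 ?powR_ge0.
rewrite fubini_tonelli1// /fubini_F.
pose g (z : 'rV[R]_n * 'rV[R]_n) := f (z.1, z.2 + z.1)%R.
have mg : measurable_fun setT g.
  apply: (measurableT_comp mf); apply: measurable_fun_pair => //.
  exact: measurable_rV_add.
transitivity (\int[mu]_x \int[mu]_h g (x, h)).
  apply: eq_integral => x _; apply: esym.
  apply: (@ge0_integral_shift_rV R n x (fun y => f (x, y))) => [|y]; last exact: f0.
  exact: (measurableT_comp mf (measurable_pair1 _)).
have g0 z : 0 <= g z by exact: f0.
apply: (etrans (@fubini_tonelli _ _ _ _ _ mu mu g mg g0)).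
apply: eq_integral => h _; rewrite /fubini_G /g /f/=.
rewrite -ge0_integralZl//; last 2 first.
- apply/measurable_EFinP; apply: measurable_powR_fun; apply: measurableT_comp => //.
  apply: measurable_funB => //.
  exact: (measurableT_comp mu' (measurable_rV_add _ _)).
- by rewrite lee_fin powR_ge0.
apply: eq_integral => x _; rewrite -EFinM powRN mulrC; congr EFin.
have -> : (x - (h + x) = - h)%R by rewrite opprD addrCA subrr addr0.
by rewrite enormN distrC (addrC h).
Qed.

End gagliardo_translation.

(** * Upper bound for arbitrary open sets *)

Section test_function_theory.
Context {R : realType} {n : nat}.
Implicit Types (u : 'rV[R]_n -> R) (x : 'rV[R]_n) (Omega : set 'rV[R]_n).
Local Notation mu := (@lebesgue_rV R n).

Lemma tsupport_eq0 u x : ~ tsupport u x -> u x = 0.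
Proof.
move=> nx; apply/eqP; apply: contra_notT nx => ux.
exact: subset_closure.
Qed.

Lemma tsupport_near0 u x : ~ tsupport u x -> \forall y \near x, u y = 0.
Proof.
move=> nx.
have : open_nbhs x (~` tsupport u).
  by split => //; apply: closed_openC; exact: closed_closure.
move=> /open_nbhs_nbhs; apply: filterS => y; exact: tsupport_eq0.
Qed.

Lemma tsupport_partial0 u x i : ~ tsupport u x -> partial i u x = 0.
Proof.
move=> nx; rewrite /partial.
rewrite (@near_eq_derive _ _ _ _ (cst 0)); first by rewrite derive_cst.
exact: tsupport_near0.
Qed.

Lemma tsupport_grad0 u x : ~ tsupport u x -> grad u x = 0.
Proof. by move=> nx; apply/rowP => i; rewrite !mxE tsupport_partial0. Qed.

Lemma smooth_Ck1 u : smooth u -> Ck 1 u. Proof. exact. Qed.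

Lemma smooth_continuous u : smooth u -> continuous u.
Proof. by move=> /(_ 0) []. Qed.

Lemma test_fun_measurable Omega u : test_fun Omega u -> measurable_fun setT u.
Proof. by move=> [su _ _]; apply: continuous_measurable_rV; exact: smooth_continuous. Qed.

Lemma test_fun_grad_measurable Omega u : test_fun Omega u ->
  measurable_fun setT (fun x => enorm (grad u x)).
Proof.
move=> [su _ _]; apply: continuous_measurable_rV.
by apply: continuous_enorm_grad; exact: smooth_Ck1.
Qed.

Local Open Scope ereal_scope.

Lemma Lp_norm_powerE Omega (p : R) (f : 'rV[R]_n -> R) : p != 0%R ->
  (forall x, ~ Omega x -> f x = 0%R) ->
  Lp_norm Omega p f `^ p = \int[mu]_x (`|f x| `^ p)%:E.
Proof.
move=> p0 f0; rewrite /Lp_norm poweR_Lnorm//; apply: eq_integral => x _.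
rewrite patchE; case: ifPn => // /negP xO /=.
rewrite f0; last by move=> Ox; apply: xO; rewrite inE.
by rewrite normr0.
Qed.

Lemma test_fun_out Omega u x : test_fun Omega u -> ~ Omega x -> ~ tsupport u x.
Proof. by move=> [_ _ sO] nx /sO. Qed.

Lemma Lp_norm_test Omega (p : R) u : p != 0%R -> test_fun Omega u ->
  Lp_norm Omega p u `^ p = \int[mu]_x (`|u x| `^ p)%:E.
Proof.
move=> p0 tu; apply: Lp_norm_powerE => // x nx.
exact/tsupport_eq0/(test_fun_out tu).
Qed.

Lemma Lp_grad_test Omega (p : R) u : p != 0%R -> test_fun Omega u ->
  Lp_grad Omega p u `^ p = \int[mu]_x (enorm (grad u x) `^ p)%:E.
Proof.
move=> p0 tu; have g0 x : ~ Omega x -> enorm (grad u x) = 0%R.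
  by move=> nx; rewrite tsupport_grad0 ?enorm0//; exact: (test_fun_out tu).
apply: (etrans (Lp_norm_powerE p0 g0)).
by apply: eq_integral => x _; rewrite ger0_norm// enorm_ge0.
Qed.

Lemma Lp_norm_ge0 Omega (p : R) (f : 'rV[R]_n -> R) : 0 <= Lp_norm Omega p f.
Proof. exact: Lnorm_ge0. Qed.

Lemma lambda1_ge0 Omega (p : R) : 0 <= lambda1 p Omega.
Proof. by apply: le_ereal_inf_tmp => _ [u _ <-]; exact: poweR_ge0. Qed.

End test_function_theory.

Section upper_bound.
Context {R : realType} {n : nat}.
Local Notation mu := (@lebesgue_rV R n).
Local Open Scope ereal_scope.

Lemma le_poweR (p : R) (x y : \bar R) : (0 <= p)%R -> 0 <= x -> x <= y ->
  x `^ p <= y `^ p.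
Proof.
move=> p0 x0 xy; apply: gt0_ler_poweR => //; rewrite in_itv/= leey andbT//.
exact: le_trans xy.
Qed.

(* [||u(. + h) - u||_p <= min (2 ||u||_p) (|h| ||grad u||_p)], integrated
   against [|h|^(-N-sp)]. *)
Lemma gagliardo_le_interpolation Omega (s p G : R) (u : 'rV[R]_n -> R) :
  (1 < p)%R -> (0 < s < 1)%R -> (0 < G)%R -> test_fun Omega u ->
  \int[mu]_x (`|u x| `^ p)%:E <= 1 ->
  \int[mu]_x (enorm (grad u x) `^ p)%:E <= (G `^ p)%:E ->
  gagliardo s p u `^ p <=
    (n%:R * (2 `^ (p - s * p) * G `^ (s * p)) * (p / (s * p * (p - s * p))))%:E *
    @omega_ball R n.
Proof.
move=> p1 /andP[s0 s1] G0 tu u1 gG; have p0 : (0 < p)%R by exact: lt_trans p1.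
have [su _ _] := tu.
have mu' := test_fun_measurable tu.
rewrite gagliardo_powerE// -integral_min_power//; last first.
  by rewrite mulr_gt0//= gtr_pMl.
apply: ge0_le_integral_nomeas => h _.
  by rewrite mule_ge0 ?lee_fin ?powR_ge0//; apply: integral_ge0 => x _; rewrite lee_fin powR_ge0.
rewrite [in leRHS]mulrC EFinM; apply: lee_wpmul2l; first by rewrite lee_fin powR_ge0.
have Gh0 : (0 <= G * enorm h)%R by rewrite mulr_ge0 ?enorm_ge0// ltW.
have [H|H] := leP (G * enorm h)%R 2%R.
  apply: (le_trans (integral_difference_grad h p1 (smooth_Ck1 su))).
  rewrite mulrC powRM ?enorm_ge0 ?(ltW G0)// EFinM.
  by apply: lee_wpmul2l => //; rewrite lee_fin powR_ge0.
apply: (le_trans (integral_difference_le h p1 mu')).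
by rewrite -[leRHS]mule1; apply: lee_wpmul2l.
Qed.

End upper_bound.

Section upper_bound_eigenvalue.
Context {R : realType}.
Local Open Scope ereal_scope.

Lemma lambda_frac_le n (s p : R) (Omega : set 'rV[R]_n.+1) : (1 < p)%R -> (0 < s < 1)%R ->
  (s * (1 - s))%R%:E * lambda_frac s p Omega <=
    (2 `^ (p * (1 - s)) * n.+1%:R)%R%:E * @omega_ball R n.+1 * lambda1 p Omega `^ s.
Proof.
move=> p1 s01; have /andP[s0 s1] := s01.
have p0 : (0 < p)%R by exact: lt_trans p1.
have s1' : (0 < 1 - s)%R by rewrite subr_gt0.
have /andP[w0 woo] := @omega_ball_gt0_lty R n.+1.
have fw : @omega_ball R n.+1 \is a fin_num by rewrite ge0_fin_numE ?ltW.
set w := fine (@omega_ball R n.+1).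
have wE : @omega_ball R n.+1 = w%:E by rewrite fineK.
have w0' : (0 <= w)%R by rewrite -lee_fin -wE ltW.
set A := (2 `^ (p * (1 - s)) * n.+1%:R * w)%R.
have A0 : (0 <= A)%R by rewrite !mulr_ge0 ?powR_ge0.
have ss0 : (0 < s * (1 - s))%R by rewrite mulr_gt0.
rewrite wE -EFinM -/A.
set lhs := _ * lambda_frac _ _ _.
(* Working with [g] above the infimum provides a competitor and keeps [G] positive even if [lambda1]
   is [0]. *)
have key (g : R) : (0 < g)%R -> lambda1 p Omega < g%:E -> lhs <= (A * g `^ s)%:E.
  move=> g0 /ereal_inf_lt[_ [u [tu u1] <-]] ug.
  pose G := (g `^ p^-1)%R.
  have GE : (G `^ p = g)%R by rewrite -powRrM mulVf ?gt_eqF// powRr1// ltW.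
  have G0 : (0 < G)%R by exact: powR_gt0.
  have := @gagliardo_le_interpolation R n.+1 Omega s p G u p1 s01 G0 tu.
  rewrite -(Lp_norm_test _ tu) ?gt_eqF// u1 poweR1r => /(_ (lexx _)).
  rewrite -(Lp_grad_test _ tu) ?gt_eqF// GE => /(_ (ltW ug)) H.
  apply: (@le_trans _ _ ((s * (1 - s))%:E * gagliardo s p u `^ p)).
    rewrite /lhs; apply: lee_wpmul2l; first by rewrite lee_fin ltW.
    by apply: ereal_inf_lbound; exists u.
  apply: (le_trans (lee_wpmul2l _ H)); first by rewrite lee_fin ltW.
  rewrite wE -!EFinM lee_fin.
  have -> : (G `^ (s * p) = g `^ s)%R by rewrite mulrC powRrM GE.
  have -> : (p - s * p = p * (1 - s))%R by ring.
  (* The factor [s (1 - s)] cancels exactly; the remaining [1 / p] is below [1] and is dropped. *)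
  have -> : (s * (1 - s) * (n.+1%:R * (2 `^ (p * (1 - s)) * g `^ s) *
      (p / (s * p * (p * (1 - s)))) * w) = A * g `^ s / p)%R.
    by rewrite /A; field; rewrite !gt_eqF.
  by rewrite ler_pdivrMr// ler_peMr ?mulr_ge0 ?powR_ge0// ltW.
have l0 := lambda1_ge0 Omega p.
move: key l0; case: (lambda1 p Omega) => [l key l0|key _|//].
- rewrite lee_fin in l0; rewrite poweR_EFin -EFinM.
  apply/lee_addgt0Pr => e e0.
  have [l0'|l0'] := eqVneq l 0%R.
    rewrite l0' powR0 ?gt_eqF// mulr0 add0e.
    (* Chosen so that [A g^s <= e]; the [1] covers [A = 0]. *)
    pose g := ((e / (A + 1)) `^ s^-1)%R.
    have A1 : (0 < A + 1)%R by rewrite ltr_wpDl.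
    have g0 : (0 < g)%R by rewrite powR_gt0// divr_gt0.
    apply: (le_trans (key g g0 _)); first by rewrite lte_fin l0'.
    have q0 : (0 <= e / (A + 1))%R by rewrite divr_ge0// ltW.
    rewrite /g -powRrM mulVf ?gt_eqF// powRr1// lee_fin mulrCA.
    apply: ler_piMr; first exact: ltW.
    by rewrite ler_pdivrMr// mul1r lerDl.
  have {}l0 : (0 < l)%R by rewrite lt_neqAle eq_sym l0'.
  (* Since [(1 + d)^s <= 1 + d], taking [g = l (1 + d)] adds at most [A l^s d <= e]. *)
  pose d := (e / (A * l `^ s + 1))%R.
  have B0 : (0 <= A * l `^ s)%R by rewrite mulr_ge0 ?powR_ge0.
  have B1 : (0 < A * l `^ s + 1)%R by rewrite ltr_wpDl.
  have d0 : (0 < d)%R by rewrite divr_gt0.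
  have d1 : (0 < 1 + d)%R by rewrite addr_gt0.
  apply: (le_trans (key (l * (1 + d))%R _ _)).
  + by rewrite mulr_gt0.
  + by rewrite lte_fin ltr_pMr// ltrDl.
  rewrite -EFinD lee_fin powRM; [|exact: ltW|exact: ltW].
  apply: (@le_trans _ _ (A * (l `^ s * (1 + d)))%R).
    apply: ler_wpM2l => //; apply: ler_wpM2l; first exact: powR_ge0.
    by apply: ler1_powR; [rewrite lerDl ltW|exact: ltW].
  rewrite mulrA mulrDr mulr1 lerD2l /d mulrCA.
  apply: ler_piMr; first exact: ltW.
  by rewrite ler_pdivrMr// mul1r lerDl.
- rewrite poweRyr ?gt_eqF//.
  have A00 : (0 < A)%R by rewrite !mulr_gt0 ?powR_gt0// -lte_fin -wE.
  by rewrite gt0_muley ?leey// lte_fin.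
Qed.

End upper_bound_eigenvalue.

(** * Convex sets *)

Section affine_test_functions.
Context {R : realType} {n : nat}.
Implicit Types (u v : 'rV[R]_n -> R) (x : 'rV[R]_n) (Omega : set 'rV[R]_n).
Local Notation mu := (@lebesgue_rV R n).

Lemma test_funI Omega u (A : set 'rV[R]_n) : smooth u -> compact A ->
  A `<=` Omega -> (forall x, ~ A x -> u x = 0) -> test_fun Omega u.
Proof.
move=> su cA AO uA.
have cA' : closed A by apply: compact_closed => //; exact: norm_hausdorff.
have sA : tsupport u `<=` A.
  move: cA' => /closure_id ->; apply: closure_subset => x /= ux.
  by apply: contrapT => /uA u0; rewrite u0 eqxx in ux.
split => //; last exact: subset_trans AO.
by apply: (subclosed_compact _ cA) => //; exact: closed_closure.
Qed.

Lemma is_derive_affine u (c a : R) (b x v : 'rV[R]_n) :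
  derivable u (a *: x + b) v ->
  is_derive x v (fun y => c * u (a *: y + b)) (c * (a * 'D_v u (a *: x + b))).
Proof.
move=> du.
have [D1 D2] := is_deriveZdir a du.
have E : (fun h : R => h^-1 *: (((fun y => c * u (a *: y + b)) \o shift x) (h *: v) -
    c * u (a *: x + b))) =
  (fun h : R => c * (h^-1 *: ((u \o shift (a *: x + b)) (h *: (a *: v)) - u (a *: x + b)))).
  apply/funext => h /=; rewrite -mulrBr [LHS]mulrCA; congr (_ * (_ * (u _ - _))).
  by rewrite scalerDr addrA !scalerA mulrC.
have L : (fun h : R => c * (h^-1 *: ((u \o shift (a *: x + b)) (h *: (a *: v)) -
    u (a *: x + b)))) @ 0^' --> c * (a * 'D_v u (a *: x + b)).
  by apply: cvgMr; rewrite -D2; exact: D1.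
split; rewrite /derivable /derive E; last exact/cvg_lim.
by apply/cvg_ex; exists (c * (a * 'D_v u (a *: x + b))).
Qed.

Lemma continuous_affine u (c a : R) (b : 'rV[R]_n) : continuous u ->
  continuous (fun y : 'rV[R]_n => c * u (a *: y + b)).
Proof.
move=> cu x; apply: (@cvgMr _ _ (nbhs x)).
have ca : {for x, continuous (fun y : 'rV[R]_n => a *: y + b)}.
  apply: (@cvgD _ _ _ (nbhs x)); first by apply: cvgZr; exact: cvg_id.
  exact: (@cvg_cst _ b _ (nbhs x) (nbhs_filter x)).
exact: (continuous_comp ca (cu _)).
Qed.

(** The factor [c] belongs to the statement because each derivative multiplies it by [a]; the
    induction varies it. *)
Lemma Ck_affine k u (c a : R) (b : 'rV[R]_n) : Ck k u ->
  Ck k (fun y => c * u (a *: y + b)).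
Proof.
elim: k u c => [|k IH] u c [cu du]; (split; first exact: continuous_affine) => //.
move=> i; have [di ci] := du i.
have D x : is_derive x (delta_mx ord0 i) (fun y => c * u (a *: y + b))
    (c * (a * partial i u (a *: x + b))).
  exact: is_derive_affine.
split; first by move=> x; exact: (@ex_derive _ _ _ _ _ _ _ (D x)).
rewrite (_ : partial i _ = (fun x => (c * a) * partial i u (a *: x + b))).
  exact: IH.
by apply/funext => x; rewrite -mulrA; exact: (@derive_val _ _ _ _ _ _ _ (D x)).
Qed.

Lemma partial_affine u (c a : R) (b : 'rV[R]_n) i x : Ck 1 u ->
  partial i (fun y => c * u (a *: y + b)) x = c * (a * partial i u (a *: x + b)).
Proof.
move=> [_ /(_ i)[di _]].
by apply: (@derive_val _ _ _ _ _ _ _ (is_derive_affine _ (di _))).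
Qed.

Lemma test_fun_affine Omega u (c d : R) x : 0 < d ->
  test_fun (eball (0 : 'rV[R]_n) 1) u -> eball x d `<=` Omega ->
  test_fun Omega (fun y => c * u (d^-1 *: y - d^-1 *: x)).
Proof.
move=> d0 [su cu sO] dO.
apply: (@test_funI _ _ ((fun z => x + d *: z) @` tsupport u)).
- by move=> k; exact: Ck_affine.
- apply: continuous_compact => //; apply: continuous_subspaceT => z.
  apply: (@cvgD _ _ _ (nbhs z)); last by apply: cvgZr; exact: cvg_id.
  exact: (@cvg_cst _ x _ (nbhs z) (nbhs_filter z)).
- move=> _ [z /sO zO <-]; apply: dO.
  rewrite /eball/= addrAC subrr add0r enormZ gtr0_norm// gtr_pMr//.
  by move: zO; rewrite /eball/= subr0.
- move=> y ny; rewrite (tsupport_eq0 (u := u)) ?mulr0// => h; apply: ny.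
  exists (d^-1 *: y - d^-1 *: x) => //.
  by rewrite scalerBr !scalerA mulfV ?gt_eqF// !scale1r addrC subrK.
Qed.

Local Open Scope ereal_scope.

Lemma ge0_integral_rescale (F : 'rV[R]_n -> R) (k d : R) x :
  measurable_fun setT F -> (forall y, 0 <= F y)%R -> (0 <= k)%R -> (0 < d)%R ->
  \int[mu]_y (k * F (d^-1 *: y - d^-1 *: x))%:E = (k * d ^+ n)%:E * \int[mu]_y (F y)%:E.
Proof.
move=> mF F0 k0 d0.
have dV : d^-1%R != 0%R by rewrite invr_eq0 gt_eqF.
have mE : measurable_fun setT (EFin \o F) by exact/measurable_EFinP.
have E0 y : 0 <= (EFin \o F) y by rewrite lee_fin.
have mG : measurable_fun setT (fun y : 'rV[R]_n => (F (d^-1 *: y - d^-1 *: x)%R)%:E).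
  exact: (measurableT_comp mE (measurable_rV_affine _ _)).
have G0 (y : 'rV[R]_n) : setT y -> 0 <= (F (d^-1 *: y - d^-1 *: x)%R)%:E.
  by rewrite lee_fin.
have k0' : 0 <= k%:E by rewrite lee_fin.
have := @ge0_integral_affine_rV R n d^-1 (- (d^-1 *: x))%R _ dV mE E0.
rewrite gtr0_norm ?invr_gt0// exprVn invrK => H.
transitivity (\int[mu]_y (k%:E * (F (d^-1 *: y - d^-1 *: x)%R)%:E)).
  by apply: eq_integral => y _; rewrite EFinM.
have -> := ge0_integralZl mu measurableT mG G0 k0'.
by rewrite EFinM -muleA; congr (_ * _); exact: H.
Qed.

(** A competitor [v] of the unit ball, moved to the ball of radius [d] and renormalised, is a
    competitor for [Omega]; its gradient energy is [d^(-p)] times that of [v]. *)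
Lemma lambda1_ball_le Omega (p d : R) x : (0 < p)%R -> (0 < d)%R ->
  eball x d `<=` Omega ->
  (d `^ p)%:E * lambda1 p Omega <= lambda1 p (eball (0 : 'rV[R]_n) 1%R).
Proof.
move=> p0 d0 dO; apply: le_ereal_inf_tmp => _ [v [tv v1] <-].
have pn0 : p != 0%R by rewrite gt_eqF.
have dn : (0 < d ^+ n)%R by exact: exprn_gt0.
(* [c = d^(-n/p)] compensates the Jacobian [d^n] in the [L^p] norm. *)
pose c := ((d ^+ n)^-1 `^ p^-1)%R.
have c0 : (0 < c)%R by rewrite powR_gt0// invr_gt0.
have cp : (c `^ p = (d ^+ n)^-1)%R.
  by rewrite -powRrM mulVf// powRr1// invr_ge0 ltW.
pose u := (fun y => c * v (d^-1 *: y - d^-1 *: x))%R.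
have tu : test_fun Omega u by exact: test_fun_affine.
have mv := test_fun_measurable tv.
have mgv := test_fun_grad_measurable tv.
have u1 : Lp_norm Omega p u = 1.
  have : Lp_norm Omega p u `^ p = 1.
    rewrite (Lp_norm_test pn0 tu).
    transitivity (\int[mu]_y (c `^ p * `|v (d^-1 *: y - d^-1 *: x)%R| `^ p)%:E).
      apply: eq_integral => y _; congr EFin.
      by rewrite /u normrM (gtr0_norm c0) powRM// ltW.
    have mvp : measurable_fun setT (fun y => `|v y| `^ p)%R.
      by apply: measurable_powR_fun; exact: measurableT_comp.
    have vp0 y : (0 <= `|v y| `^ p)%R by exact: powR_ge0.
    have -> := @ge0_integral_rescale _ (c `^ p)%R d x mvp vp0 (powR_ge0 _ _) d0.
    by rewrite -(Lp_norm_test pn0 tv) v1 poweR1r mule1 cp mulVf ?gt_eqF.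
  move=> /(congr1 (fun z => z `^ p^-1)); rewrite poweR1r -poweRrM mulfV// poweRe1//.
  exact: Lp_norm_ge0.
have gu y : grad u y = ((c * d^-1) *: grad v (d^-1 *: y - d^-1 *: x))%R.
  apply/rowP => i; rewrite !mxE -mulrA.
  by apply: partial_affine; have [sv _ _] := tv; exact: smooth_Ck1.
have uE : Lp_grad Omega p u `^ p = (d `^ (- p))%:E * Lp_grad (eball (0 : 'rV[R]_n) 1%R) p v `^ p.
  rewrite (Lp_grad_test pn0 tu) (Lp_grad_test pn0 tv).
  transitivity (\int[mu]_y ((c / d) `^ p * enorm (grad v (d^-1 *: y - d^-1 *: x)%R) `^ p)%:E).
    apply: eq_integral => y _; congr EFin.
    have cd0 : (0 < c / d)%R by rewrite divr_gt0.
    by rewrite gu enormZ (gtr0_norm cd0) [LHS]powRM//; [exact: ltW|exact: enorm_ge0].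
  have mvp : measurable_fun setT (fun y => enorm (grad v y) `^ p)%R.
    exact: measurable_powR_fun.
  have vp0 y : (0 <= enorm (grad v y) `^ p)%R by exact: powR_ge0.
  have -> := @ge0_integral_rescale _ ((c / d) `^ p)%R d x mvp vp0 (powR_ge0 _ _) d0.
  congr (_%:E * _).
  have dE : (d^-1 = d `^ (- 1))%R by rewrite powR_inv1// ltW.
  rewrite powRM ?invr_ge0 ?(ltW c0) ?(ltW d0)// cp dE -powRrM mulN1r.
  by rewrite mulrAC mulVf ?mul1r// gt_eqF.
have H : lambda1 p Omega <= Lp_grad Omega p u `^ p.
  by apply: ereal_inf_lbound; exists u.
apply: (le_trans (lee_wpmul2l _ H)); first by rewrite lee_fin powR_ge0.
have dp0 : (d `^ p != 0)%R by rewrite gt_eqF// powR_gt0.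
by rewrite uE muleA -EFinM powRN (mulfV dp0) mul1e.
Qed.

End affine_test_functions.

(** * Segments crossing the boundary *)

Section boundary_distance.
Context {R : realType} {n : nat}.
Implicit Types (K : set 'rV[R]_n) (x y : 'rV[R]_n).

(** The point is taken at the first exit time, the infimum [t0] of the parameters outside [K]: it is
    outside because [K] is open, and it is a limit of earlier points, which are inside. *)
Lemma boundary_on_segment K x y : open K -> K x -> ~ K y ->
  exists2 t : R, 0 <= t <= 1 & boundary K (x + t *: (y - x)).
Proof.
move=> oK Kx Ky.
pose g (t : R) : 'rV[R]_n := x + t *: (y - x).
pose T := [set t : R | 0 <= t /\ ~ K (g t)].
have T1 : T 1 by split => //; rewrite /g scale1r addrC subrK.
have hT : has_inf T by split; [exists 1|exists 0 => t []].
pose t0 := inf T.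
have t00 : 0 <= t0 by apply: lb_le_inf => [|t []//]; exists 1.
have t01 : t0 <= 1 by apply: ge_inf => //; exact: hT.2.
have cg : continuous g by exact: continuous_line.
have below t : 0 <= t -> t < t0 -> K (g t).
  move=> tt tt0; apply: contrapT => nK.
  by have := ge_inf hT.2 (conj tt nK : T t); rewrite leNgt tt0.
have nK0 : ~ K (g t0).
  move=> Kt0; have : nbhs t0 (g @^-1` K).
    by apply: cg; exact: open_nbhs_nbhs.
  move=> /nbhs_ballP[e /= e0 eK].
  have [t [tt nK] te] := inf_adherent e0 hT.
  have h : t0 <= t by apply: ge_inf; [exact: hT.2|split].
  apply: nK; apply: eK; rewrite /ball/=.
  by rewrite distrC ger0_norm ?subr_ge0// ltrBlDl.
exists t0; first by rewrite t00.
split; last by move=> /interior_subset.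
have t0p : 0 < t0.
  rewrite lt_neqAle t00 andbT; apply/eqP => t0E; apply: nK0.
  by rewrite -t0E /g scale0r addr0.
move=> B Bt0; have : nbhs t0 (g @^-1` B) by exact: cg.
move=> /nbhs_ballP[e /= e0 eB].
pose t := Num.max 0 (t0 - e / 2).
have t_lt : t < t0 by rewrite gt_max t0p/= ltrBlDr ltrDl divr_gt0.
exists (g t); split; first by apply: below => //; rewrite le_max lexx.
apply: eB; rewrite /ball/= gtr0_norm ?subr_gt0//.
rewrite ltrBlDl -ltrBlDr; apply: (@lt_le_trans _ _ (t0 - e / 2)); last by rewrite le_max lexx orbT.
by rewrite ltrD2l ltrN2 ltr_pdivrMr// ltr_pMr// ltr1n.
Qed.

Lemma boundary_open_out K x : open K -> boundary K x -> ~ K x.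
Proof. by move=> oK [_ nI] Kx; apply: nI; exact: open_nbhs_nbhs. Qed.

(** A point outside [K] yields a boundary point, so the infimum is over a nonempty set; over the
    empty set it would be [0]. *)
Lemma edistance_boundary_gt0 K x : open K -> K != setT -> K x ->
  0 < edistance x (boundary K).
Proof.
move=> oK KT Kx; have : exists y, ~ K y.
  apply: contrapT => nK; move/eqP: KT; apply; rewrite -subTset => y _.
  by apply: contrapT => Ky; apply: nK; exists y.
move=> [y Ky]; have [t _ bt] := boundary_on_segment oK Kx Ky.
have /nbhs_ballP[e /= e0 eK] := open_nbhs_nbhs (conj oK Kx).
apply: (lt_le_trans e0); apply: lb_le_inf; first by exists (enorm (x - (x + t *: (y - x)))), (x + t *: (y - x)).
move=> _ [z bz <-]; rewrite leNgt; apply/negP => ze.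
apply: (boundary_open_out oK bz); apply: eK; rewrite -ball_normE/=.
exact: le_lt_trans (norm_le_enorm _) ze.
Qed.

Lemma eball_edistance_sub K x : open K -> K x ->
  eball x (edistance x (boundary K)) `<=` K.
Proof.
move=> oK Kx y; rewrite /eball/= => xy; apply: contrapT => Ky.
have [t /andP[t0 t1] bt] := boundary_on_segment oK Kx Ky.
have : edistance x (boundary K) <= enorm (x - (x + t *: (y - x))).
  by apply: ge_inf; [exists 0 => _ [z _ <-]; exact: enorm_ge0|exists (x + t *: (y - x))].
rewrite opprD addrA subrr add0r enormN enormZ ger0_norm// leNgt => /negP; apply.
by apply: le_lt_trans xy; rewrite ler_piMl// enorm_ge0.
Qed.

End boundary_distance.

Section convex_lower_bound.
Context {R : realType} {n : nat}.
Local Notation mu := (@lebesgue_rV R n).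
Local Open Scope ereal_scope.

(** Dividing by [c > 0] moves the claim inside the infimum, so both lower bounds reduce to a single
    normalised test function. *)
Lemma lambda_frac_ge (s p : R) (Omega : set 'rV[R]_n) (c : R) (X : \bar R) : (0 < c)%R ->
  (forall u, test_fun Omega u -> Lp_norm Omega p u = 1 -> X <= c%:E * gagliardo s p u `^ p) ->
  X <= c%:E * lambda_frac s p Omega.
Proof.
move=> c0 H; rewrite -lee_pdivrMl//; apply: le_ereal_inf_tmp => _ [u [tu u1] <-].
by rewrite lee_pdivrMl//; exact: H.
Qed.

(** The whole space contains balls of every radius, so [d^p lambda1] stays bounded as [d] grows.
    This settles the convex set excluded from the Hardy inequality. *)
Lemma lambda1_setT (p : R) : (0 < p)%R ->
  lambda1 p (eball (0 : 'rV[R]_n) 1%R) < +oo -> lambda1 p [set: 'rV[R]_n] = 0.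
Proof.
move=> p0.
have H (d : R) : (0 < d)%R -> (d `^ p)%:E * lambda1 p [set: 'rV[R]_n] <=
    lambda1 p (eball (0 : 'rV[R]_n) 1%R).
  by move=> d0; exact: (@lambda1_ball_le _ _ _ _ _ 0%R).
have := lambda1_ge0 (n := n) [set: 'rV[R]_n] p.
move: H; case: (lambda1 p (eball 0%R 1%R)) => [l|//|]; last first.
  move=> H l0 _; have := H 1%R ltr01; rewrite powR1 mul1e leeNy_eq => /eqP.
  by move=> E; rewrite E in l0.
case: (lambda1 p [set: 'rV[R]_n]) => [m|H _ _|//]; last first.
  by have := H 1%R ltr01; rewrite powR1 mul1e.
move=> H m0 _; rewrite lee_fin in m0; apply/eqP; rewrite eqe eq_le m0 andbT leNgt; apply/negP => m0'.
have l0 : (0 <= l)%R.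
  by have := H 1%R ltr01; rewrite powR1 mul1e lee_fin; exact: le_trans.
have d0 : (0 < (l / m + 1) `^ p^-1)%R by rewrite powR_gt0// ltr_wpDl// divr_ge0// ltW.
have := H _ d0; rewrite -powRrM mulVf ?gt_eqF// powRr1; last first.
  by rewrite addr_ge0// divr_ge0// ltW.
by rewrite -EFinM lee_fin mulrDl divfK ?gt_eqF// mul1r leNgt ltrDl m0'.
Qed.

Lemma convex_lambda_frac_ge (s p C : R) (K : set 'rV[R]_n) : (0 < p)%R ->
  @hardy_constant R n p C -> (0 < s < 1)%R -> open K -> convex_set K ->
  (lambda1 p (@eball R n 0%R 1%R) `^ s / C%:E)^-1 * lambda1 p K `^ s <=
    (s * (1 - s))%R%:E * lambda_frac s p K.
Proof.
move=> p0 [C0 hardy] s01 oK cK; have /andP[s0 s1] := s01.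
have s1' : (0 < 1 - s)%R by rewrite subr_gt0.
have ss0 : (0 < s * (1 - s))%R by rewrite mulr_gt0.
have sn : s != 0%R by rewrite gt_eqF.
have pn : p != 0%R by rewrite gt_eqF.
apply: lambda_frac_ge => // u tu u1.
have rhs0 : 0 <= (s * (1 - s))%:E * gagliardo s p u `^ p.
  by rewrite mule_ge0 ?poweR_ge0// lee_fin ltW.
have [m0|m0] := eqVneq (lambda1 p K) 0; first by rewrite m0 poweR0r// mule0.
have := lambda1_ge0 (n := n) (eball (0 : 'rV[R]_n) 1%R) p.
have lT := lambda1_setT p0.
have lK (d : R) x := @lambda1_ball_le R n K p d x p0.
(* If [lambda1] of the ball is infinite, the prefactor is the inverse of [+oo], that is [0], and the
   claim is trivial. *)
move: lT lK; case: (lambda1 p (eball 0%R 1%R)) => [l|_ _ _|//]; last first.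
  by rewrite poweRyr// inver gt_eqF// gt0_mulye ?lte_fin ?invr_gt0// invey mul0e.
move=> /(_ (ltry _)) lT lK l0; rewrite lee_fin in l0.
have KT : K != setT by apply/eqP => KT; rewrite KT lT eqxx in m0.
have [x0 Kx0] : exists x, K x.
  apply: contrapT => nK.
  have u0 x : u x = 0%R.
    by apply/tsupport_eq0/(test_fun_out tu) => Kx; apply: nK; exists x.
  have := Lp_norm_test pn tu; rewrite u1 poweR1r integral0_eq => [/eqP|x _].
    by rewrite onee_eq0.
  by rewrite u0 normr0 powR0.
have dx0 := edistance_boundary_gt0 oK KT Kx0.
have lK0 := lK _ _ dx0 (eball_edistance_sub oK Kx0).
(* One inscribed ball already makes [lambda1 p K] finite. *)
have [m mE m0'] : exists2 m, lambda1 p K = m%:E & (0 < m)%R.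
  have := lambda1_ge0 K p; move: m0 lK0.
  case: (lambda1 p K) => [m m0 _ m1|_|//].
    by exists m => //; rewrite lt_neqAle eq_sym; apply/andP.
  by rewrite gt0_muley ?lte_fin ?powR_gt0// leye_eq.
rewrite mE in lK lK0 *.
have l0' : (0 < l)%R.
  move: lK0; rewrite -EFinM lee_fin.
  by apply: lt_le_trans; rewrite mulr_gt0// powR_gt0.
have ls : (0 < l `^ s)%R by exact: powR_gt0.
rewrite !poweR_EFin inver gt_eqF// -EFinM inver gt_eqF ?mulr_gt0 ?invr_gt0//.
rewrite -EFinM invfM invrK.
have := hardy s K u s01 oK cK KT tu.
move=> /(lee_wpmul2l _) -/(_ (s * (1 - s))%:E); rewrite lee_fin (ltW ss0) => /(_ isT).
apply: le_trans; rewrite muleA -EFinM mulrCA divff ?gt_eqF// mulr1.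
have -> : ((l `^ s)^-1 * C * m `^ s)%R = (C * (m `^ s / l `^ s))%R by ring.
rewrite EFinM; apply: lee_wpmul2l; first by rewrite lee_fin ltW.
have c0 : (0 <= m `^ s / l `^ s)%R by rewrite divr_ge0 ?powR_ge0.
rewrite -[leLHS]mule1 -{1}(poweR1r p) -u1 (Lp_norm_test pn tu).
have mu' := test_fun_measurable tu.
rewrite -ge0_integralZl//; last first.
  apply/measurable_EFinP; apply: measurable_powR_fun; exact: measurableT_comp.
rewrite [leRHS]integral_mkcond; apply: ge0_le_integral_nomeas => x _.
  by rewrite -EFinM lee_fin mulr_ge0 ?powR_ge0.
rewrite patchE; case: ifPn => [/set_mem Kx|/negP Kx]; last first.
  rewrite (tsupport_eq0 (u := u)) ?normr0 ?powR0 ?mule0//.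
  by apply: (test_fun_out tu) => Kx'; apply: Kx; rewrite inE.
rewrite -EFinM lee_fin mulrC ler_wpM2l ?powR_ge0//.
have dx := edistance_boundary_gt0 oK KT Kx.
set d := edistance _ _ in dx *.
(* The ball comparison is used at every point [x]: [d^p m <= l] gives [d^(-sp) >= (m / l)^s]. *)
have := lK _ _ dx (eball_edistance_sub oK Kx); rewrite -/d -EFinM lee_fin => dml.
rewrite ler_pdivrMr// ler_pdivlMl ?powR_gt0//.
rewrite [(s * p)%R]mulrC powRrM -powRM; [|exact: powR_ge0|exact: ltW].
apply: ge0_ler_powR => //; rewrite ?nnegrE//; first exact: ltW.
by rewrite mulr_ge0 ?powR_ge0// ltW.
Qed.

End convex_lower_bound.

(** * Mollification *)

Section smooth_real.
Context {R : realType}.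
Implicit Types f g : R -> R.

(** One-variable analogue of [Ck]. The derivative is an existential witness, so closure under sums
    and products is shown by exhibiting it. *)
Fixpoint D1 (k : nat) f : Prop :=
  continuous f /\
  match k with
  | 0 => True
  | k.+1 => exists g, (forall x : R, is_derive x 1 f (g x)) /\ D1 k g
  end.

Lemma D1_continuous k f : D1 k f -> continuous f.
Proof. by case: k => [|k] []. Qed.

Lemma D1W k f : D1 k.+1 f -> D1 k f.
Proof.
elim: k f => [|k IH] f [cf [g [fg Dg]]]; split => //.
by exists g; split => //; exact: IH.
Qed.

Lemma D1D k f g : D1 k f -> D1 k g -> D1 k (f \+ g).
Proof.
elim: k f g => [|k IH] f g [cf Hf] [cg Hg].
  by split => // x; apply: cvgD; [exact: cf|exact: cg].
split; first by move=> x; apply: cvgD; [exact: cf|exact: cg].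
have [f' [ff' Df']] := Hf; have [g' [gg' Dg']] := Hg.
exists (f' \+ g'); split; last exact: IH.
by move=> x; exact: is_deriveD.
Qed.

Lemma D1M k f g : D1 k f -> D1 k g -> D1 k (f \* g).
Proof.
elim: k f g => [|k IH] f g Hf Hg.
  have [cf _] := Hf; have [cg _] := Hg.
  by split => // x; apply: cvgM; [exact: cf|exact: cg].
have Wf := D1W Hf; have Wg := D1W Hg.
have [cf [f' [ff' Df']]] := Hf; have [cg [g' [gg' Dg']]] := Hg.
split; first by move=> x; apply: cvgM; [exact: cf|exact: cg].
exists ((f \* g') \+ (g \* f')); split.
  by move=> x; exact: is_deriveM.
by apply: D1D; exact: IH.
Qed.

Lemma D1_cst k (c : R) : D1 k (cst c).
Proof.
elim: k c => [|k IH] c; split => //; try exact: cst_continuous.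
by exists (cst 0); split => // x; exact: is_derive_cst.
Qed.

Lemma D1_affine k f (a b : R) : D1 k f -> D1 k (fun x => f (a * x + b)).
Proof.
have da (x : R) : is_derive x 1 (fun x => a * x + b) a.
  by apply: is_derive_eq; rewrite addr0 [_ *: _]mulr1.
have ca : continuous (fun x : R => a * x + b).
  move=> x; apply: differentiable_continuous; apply/derivable1_diffP.
  exact: (@ex_derive _ _ _ _ _ _ _ (da x)).
have cc g : continuous g -> continuous (fun x => g (a * x + b)).
  by move=> cg x; exact: (continuous_comp (ca x) (cg _)).
elim: k f => [|k IH] f [cf Hf]; (split; first exact: cc) => //.
have [f' [ff' Df']] := Hf.
exists ((fun x => f' (a * x + b)) \* cst a); split.
  by move=> x; exact: (@is_derive1_comp _ f (fun x => a * x + b)).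
by apply: D1M; [exact: IH|exact: D1_cst].
Qed.

(** The classical [exp(-1/x)], enlarged to the family [x^(-m) exp(-1/x)] because the span of this
    family is stable under differentiation. *)
Definition flat (m : nat) (x : R) : R :=
  if 0 < x then x^-1 ^+ m * expR (- x^-1) else 0.

(** From the term of order [m + 2] in the exponential series at [1 / x]. The quadratic decay is what
    makes the derivative at [0] exist and vanish. *)
Lemma flat_le (m : nat) (x : R) : 0 < x -> flat m x <= (m.+2)`!%:R * x ^+ 2.
Proof.
move=> x0; rewrite /flat x0.
set y := x^-1; have y0 : 0 < y by rewrite invr_gt0.
have f0 : 0 < (m.+2)`!%:R :> R by rewrite ltr0n fact_gt0.
have E : y ^+ m.+2 / (m.+2)`!%:R <= expR y.
  by rewrite (le_trans _ (expR_ge1Dxn m.+1 (ltW y0)))// lerDr.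
rewrite expRN ler_pdivrMr ?expR_gt0//.
apply: le_trans (ler_wpM2l _ E); last by rewrite mulr_ge0 ?ltW// exprn_gt0.
have xy : x * y = 1 by rewrite mulfV// gt_eqF.
rewrite le_eqVlt; apply/orP; left; apply/eqP.
transitivity (y ^+ m * (x * y) ^+ 2); first by rewrite xy expr1n mulr1.
rewrite !exprSr expr0 mul1r.
move: f0; move: ((m.+2)`!%:R : R) (y ^+ m) => F z f0.
by field; rewrite gt_eqF.
Qed.

Lemma is_derive_flat (m : nat) (x : R) :
  is_derive x 1 (flat m) (flat m.+2 x - m%:R * flat m.+1 x).
Proof.
have [x0|x0|x0] := ltgtP x 0.
- have E : \forall y \near x, cst 0 y = flat m y.
    near=> y; rewrite /flat ifF//; apply/negbTE; rewrite -leNgt ltW//.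
    near: y; exact: lt_nbhsl.
  rewrite /flat !ltNge (ltW x0)/= mulr0 subr0.
  split.
    by apply: (near_eq_derivable E); exact: derivable_cst.
  by rewrite -(near_eq_derive _ E) derive_cst.
- pose F (y : R) := y^-1 ^+ m * expR (- y^-1).
  have E : \forall y \near x, F y = flat m y.
    near=> y; rewrite /flat ifT//.
    near: y; exact: lt_nbhsr.
  have dF : is_derive x 1 F (flat m.+2 x - m%:R * flat m.+1 x).
    rewrite /F /flat x0.
    have xn : x != 0 by rewrite gt_eqF.
    have dV : is_derive x 1 (fun y : R => y^-1) (- x^-1 ^+ 2).
      have := @is_deriveV _ id x 1 1 xn (is_derive_id _ _).
      by rewrite exprVn [_ *: _]mulr1.
    have dN : is_derive x 1 (fun y : R => - y^-1) (x^-1 ^+ 2).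
      by have := is_deriveN dV; rewrite opprK.
    have dE : is_derive x 1 (fun y : R => expR (- y^-1)) (expR (- x^-1) * x^-1 ^+ 2).
      exact: (@is_derive1_comp _ expR (fun y : R => - y^-1)).
    have dX : is_derive x 1 (fun y : R => y^-1 ^+ m) (m%:R * x^-1 ^+ m.-1 * - x^-1 ^+ 2).
      have := @is_deriveX _ _ (fun y : R => y^-1) m x 1 _ dV.
      by rewrite exprfctE.
    apply: (is_derive_eq (is_deriveM dX dE)).
    rewrite /GRing.scale/=; case: (m) => [|j] /=; first by rewrite !expr0; ring.
    by rewrite !exprSr; ring.
  split.
    by apply: (near_eq_derivable E); exact: (@ex_derive _ _ _ _ _ _ _ dF).
  by rewrite -(near_eq_derive _ E); exact: (@derive_val _ _ _ _ _ _ _ dF).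
- rewrite x0 /flat ltxx mulr0 subr0.
  set f := fun y => _.
  have H : (fun h : R => h^-1 *: ((f \o shift 0) (h *: 1) - f 0)) @ 0^' --> 0.
    apply/cvgrPdist_le => e e0; near=> h.
    have h0 : h != 0 by near: h; exact: nbhs_dnbhs_neq.
    have f0 : 0 < (m.+2)`!%:R :> R by rewrite ltr0n fact_gt0.
    have he : `|h| <= e / (m.+2)`!%:R.
      near: h; apply: dnbhs0_le; exact: divr_gt0.
    rewrite /= sub0r normrN [h *: 1]mulr1 addr0 {2}/f ltxx subr0.
    rewrite /f; case: ifPn => hp; last by rewrite scaler0 normr0 ltW.
    have := flat_le m hp; rewrite /flat hp => H.
    rewrite normrZ normfV gtr0_norm// [`|_ * _|]ger0_norm; last first.
      by rewrite mulr_ge0 ?expR_ge0// exprn_ge0// invr_ge0 ltW.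
    rewrite ler_pdivrMl// (le_trans H)// expr2 mulrCA ler_wpM2l//; first exact: ltW.
    by move: he; rewrite gtr0_norm// ler_pdivlMr// mulrC.
  split; first by apply/cvg_ex; exists 0.
  exact/cvg_lim.
Unshelve. all: by end_near. Qed.

Lemma D1_flat k m : D1 k (flat m).
Proof.
have cf j : continuous (flat j).
  move=> x; apply: differentiable_continuous; apply/derivable1_diffP.
  exact: (@ex_derive _ _ _ _ _ _ _ (is_derive_flat j x)).
elim: k m => [|k IH] m; split => //.
exists (flat m.+2 \+ (cst (- m%:R) \* flat m.+1)); split.
  by move=> x /=; rewrite mulNr; exact: is_derive_flat.
by apply: D1D => //; apply: D1M => //; exact: D1_cst.
Qed.

(** The arguments are kept in the shape [a t + b] expected by [D1_affine]; the two factors cut off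
    at [-1] and at [1]. *)
Definition bump1 (t : R) : R := flat 0 (1 * t + 1) * flat 0 ((-1) * t + 1).

Lemma D1_bump1 k : D1 k bump1.
Proof. by apply: D1M; apply: D1_affine; exact: D1_flat. Qed.

Lemma flat_ge0 m x : 0 <= flat m x.
Proof.
by rewrite /flat; case: ifPn => // x0; rewrite mulr_ge0 ?expR_ge0// exprn_ge0// invr_ge0 ltW.
Qed.

Lemma bump1_ge0 t : 0 <= bump1 t.
Proof. by rewrite mulr_ge0// flat_ge0. Qed.

Lemma bump1_out t : 1 <= `|t| -> bump1 t = 0.
Proof.
rewrite ler_normr => /orP[h|h]; rewrite /bump1 /flat.
  by rewrite [X in _ * X]ifF ?mulr0//; apply/negbTE; rewrite -leNgt; lra.
by rewrite ifF ?mul0r//; apply/negbTE; rewrite -leNgt; lra.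
Qed.

Lemma bump1_ge t : `|t| <= 2^-1 -> expR (-4) <= bump1 t.
Proof.
rewrite ler_norml => /andP[h1 h2].
have H y : 2^-1 <= y -> expR (-2) <= flat 0 y.
  move=> hy; have y0 : 0 < y by rewrite (lt_le_trans _ hy).
  rewrite /flat y0 expr0 mul1r ler_expR lerN2 -[leRHS]invrK lef_pV2 ?posrE//.
have -> : expR (-4) = expR (-2) * expR (-2) :> R by rewrite -expRD; congr expR; lra.
by rewrite ler_pM ?expR_ge0// H//; lra.
Qed.

End smooth_real.

(** * Products of one-variable functions and the mollifier *)

Section bump.
Context {R : realType}.

Lemma continuous_prod_coord n (b : 'I_n -> R -> R) : (forall i, continuous (b i)) ->
  continuous (fun x : 'rV[R]_n => \prod_i b i (x ord0 i)).
Proof.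
move=> cb x; elim: (index_enum _) => [|i r IH].
  under eq_fun do rewrite big_nil.
  exact: (@cvg_cst _ (1 : R) _ (nbhs x) (nbhs_filter x)).
under eq_fun do rewrite big_cons.
apply: (@cvgM _ _ (nbhs x) (nbhs_filter x)); last exact: IH.
apply: (@continuous_comp _ _ _ (fun x : 'rV[R]_n => x ord0 i) (b i)); last exact: cb.
exact: coord_continuous.
Qed.

(** The derivative is again a product of one-variable functions, with one factor replaced; this
    shape is what the induction for [Ck_prod_coord] needs, and why the factors may depend on the
    index. *)
Lemma is_derive_prod_coord n (b : 'I_n -> R -> R) (i : 'I_n) (g : R -> R) (x : 'rV[R]_n) :
  is_derive (x ord0 i) 1 (b i) (g (x ord0 i)) ->
  is_derive x (delta_mx ord0 i) (fun y : 'rV[R]_n => \prod_j b j (y ord0 j))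
    (\prod_j (if j == i then g else b j) (x ord0 j)).
Proof.
move=> bg.
set P := \prod_(j | j != i) b j (x ord0 j).
have Pg : \prod_j (if j == i then g else b j) (x ord0 j) = P * g (x ord0 i).
  rewrite (bigD1 i)//= eqxx mulrC; congr (_ * _).
  by apply: eq_bigr => j /negPf ->.
have Ph (h : R) : \prod_j b j ((h *: delta_mx ord0 i + x) ord0 j) = P * b i (h + x ord0 i).
  rewrite (bigD1 i)//= mulrC; congr (_ * b i _); last by rewrite !mxE !eqxx mulr1.
  by apply: eq_bigr => j /negPf ji; rewrite !mxE ji andbF mulr0 add0r.
have E : (fun h : R => h^-1 *: (((fun y : 'rV[R]_n => \prod_j b j (y ord0 j)) \o shift x)
    (h *: delta_mx ord0 i) - \prod_j b j (x ord0 j))) =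
  (fun h : R => P * (h^-1 *: ((b i \o shift (x ord0 i)) (h *: 1) - b i (x ord0 i)))).
  apply/funext => h /=; rewrite Ph [h *: 1]mulr1.
  have := Ph 0; rewrite scale0r !add0r => ->.
  by rewrite -mulrBr [LHS]mulrCA.
have L : (fun h : R => P * (h^-1 *: ((b i \o shift (x ord0 i)) (h *: 1) -
    b i (x ord0 i)))) @ 0^' --> P * g (x ord0 i).
  apply: cvgMr; rewrite -(@derive_val _ _ _ _ _ _ _ bg).
  exact: (@ex_derive _ _ _ _ _ _ _ bg).
rewrite Pg; split; rewrite /derivable /derive E; last exact/cvg_lim.
by apply/cvg_ex; exists (P * g (x ord0 i)).
Qed.

Lemma Ck_prod_coord n k (b : 'I_n -> R -> R) : (forall i, D1 k (b i)) ->
  Ck k (fun x : 'rV[R]_n => \prod_i b i (x ord0 i)).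
Proof.
elim: k b => [|k IH] b Db.
  by split => //; apply: continuous_prod_coord => i; exact: (D1_continuous (Db i)).
split; first by apply: continuous_prod_coord => i; exact: (D1_continuous (Db i)).
move=> i; have [_ [g [bg Dg]]] := Db i.
have D (x : 'rV[R]_n) := is_derive_prod_coord (bg (x ord0 i)).
split; first by move=> x; exact: (@ex_derive _ _ _ _ _ _ _ (D x)).
rewrite (_ : partial i _ =
  fun x : 'rV[R]_n => \prod_j (if j == i then g else b j) (x ord0 j)); last first.
  by apply/funext => x; exact: (@derive_val _ _ _ _ _ _ _ (D x)).
apply: (IH (fun j => if j == i then g else b j)) => j.
by case: ifP => // _; exact: D1W.
Qed.

Lemma continuous_compact_bounded n (u : 'rV[R]_n -> R) (A : set 'rV[R]_n) :
  continuous u -> compact A -> exists2 B : R, 0 <= B & forall x, A x -> `|u x| <= B.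
Proof.
move=> cu cA.
have : compact (u @` A).
  by apply: continuous_compact => //; exact: continuous_subspaceT.
move=> /(@compact_bounded R R) [M [_ HM]].
exists (Num.max 0 (M + 1)); first by rewrite le_max lexx.
move=> x Ax; rewrite le_max; apply/orP; right.
by apply: HM; [rewrite ltrDl|exists x].
Qed.

Lemma test_fun_bounded n Omega (u : 'rV[R]_n -> R) : test_fun Omega u ->
  exists2 B : R, 0 <= B & forall x, `|u x| <= B.
Proof.
move=> [su cu _].
have [B B0 HB] := continuous_compact_bounded (smooth_continuous su) cu.
exists B => // x; have [/HB//|/tsupport_eq0 ->] := pselect (tsupport u x).
by rewrite normr0.
Qed.

Lemma test_fun_partial n Omega (u : 'rV[R]_n -> R) i : test_fun Omega u ->
  test_fun Omega (partial i u).
Proof.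
move=> [su cu uO]; apply: (test_funI (A := tsupport u)) => //.
  by move=> k; have [_ /(_ i)[]] := su k.+1.
by move=> x; exact: tsupport_partial0.
Qed.

Lemma test_fun_subset n (Omega Omega' : set 'rV[R]_n) u : Omega `<=` Omega' ->
  test_fun Omega u -> test_fun Omega' u.
Proof. by move=> OO [? ? uO]; split => //; exact: subset_trans OO. Qed.

Lemma test_fun_lipschitz n Omega (u : 'rV[R]_n -> R) : test_fun Omega u ->
  exists2 L : R, 0 <= L & forall x y, `|u x - u y| <= L * enorm (x - y).
Proof.
move=> tu; have [su cu _] := tu.
have cg : continuous (fun x => enorm (grad u x)).
  by apply: continuous_enorm_grad; exact: smooth_Ck1.
have [L L0 HL] := continuous_compact_bounded cg cu.
have HL' x : enorm (grad u x) <= L.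
  have [/HL|/tsupport_grad0 ->] := pselect (tsupport u x); last by rewrite enorm0.
  by rewrite ger0_norm// enorm_ge0.
exists L => // y x.
have [D _] := Ck1_is_derive (y - x) (smooth_Ck1 su).
have := @MVT_line _ _ u x (y - x) 1.
case=> [t|c _]; first exact: (@ex_derive _ _ _ _ _ _ _ (D _)).
rewrite scale1r [x + _]addrC subrK mulr1 => ->.
rewrite (@derive_val _ _ _ _ _ _ _ (D _)).
have -> : \sum_(i < n) (y - x) ord0 i * partial i u (x + c *: (y - x)) =
    \sum_(i < n) (y - x) ord0 i * grad u (x + c *: (y - x)) ord0 i.
  by apply: eq_bigr => i _; rewrite [grad _ _ _ _]mxE.
apply: le_trans (cauchy_schwarz _ _) _.
by rewrite mulrC ler_wpM2r ?enorm_ge0.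
Qed.

Lemma mollifier_exists n : exists phi : 'rV[R]_n.+1 -> R,
  [/\ test_fun (eball (0 : 'rV[R]_n.+1) 1) phi, forall x, 0 <= phi x &
      (\int[@lebesgue_rV R n.+1]_x (phi x)%:E = 1)%E].
Proof.
pose N := n.+1; pose k : R := N.+1%:R.
(* With [k = N + 1] the support lies in the cube of half-side [1 / k], whose points have Euclidean
   norm at most [N / (N + 1) < 1]. *)
have k0 : 0 < k by rewrite ltr0n.
pose f (x : 'rV[R]_N) := 1 * (\prod_(i < N) bump1 ((k *: x + 0) ord0 i)).
have f0 x : 0 <= f x.
  by rewrite /f mul1r; apply: prodr_ge0 => i _; exact: bump1_ge0.
pose A := [set x : 'rV[R]_N | forall i, `[- k^-1, k^-1]%classic (x ord0 i)].
have cA : compact A 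
  by apply: (rV_compact (A := fun=> `[- k^-1, k^-1]%classic)) => i; exact: segment_compact.
have AB : A `<=` eball 0 1.
  move=> x Ax; rewrite /eball/= subr0.
  apply: le_lt_trans (enorm_le_norm x) _.
  have xk : `|x| <= k^-1.
    rewrite /Num.norm/= mx_normrE; apply: bigmax_le; first by rewrite invr_ge0 ltW.
    move=> [i j] _ /=; rewrite (ord1 i).
    by have := Ax j; rewrite /= in_itv/= -ler_norml.
  apply: (@le_lt_trans _ _ (N%:R * k^-1)); first by rewrite ler_wpM2l.
  by rewrite ltr_pdivrMr// mul1r ltr_nat.
have Af x : ~ A x -> f x = 0.
  rewrite /A/= -existsNP => -[i /negP]; rewrite in_itv/= -ler_norml -ltNge => xi.
  rewrite /f (bigD1 i)//= bump1_out ?mul0r ?mulr0// !mxE addr0 normrM gtr0_norm//.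
  by rewrite mulrC -ler_pdivrMr// div1r ltW.
have sf : smooth f.
  by move=> j; apply: (@Ck_affine _ _ j (fun x : 'rV[R]_N => \prod_i bump1 (x ord0 i)));
     apply: (@Ck_prod_coord _ j (fun=> bump1)) => i; exact: D1_bump1.
have tf : test_fun (eball 0 1) f by apply: test_funI cA AB Af.
have mf := test_fun_measurable tf.
have mE : measurable_fun setT (fun x => (f x)%:E) by apply/measurable_EFinP.
have [B B0 HB] := test_fun_bounded tf.
set mu := @lebesgue_rV R N.
have If0 : (0 <= \int[mu]_x (f x)%:E)%E by apply: integral_ge0 => x _; rewrite lee_fin.
have Ifoo : (\int[mu]_x (f x)%:E < +oo)%E.
  have H : (\int[mu]_x (f x)%:E <= \int[mu]_(x in eball 0%R 1%R) (cst B%:E x))%E.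
    rewrite [leRHS]integral_mkcond; apply: ge0_le_integral_nomeas => x _.
      by rewrite lee_fin.
    rewrite patchE; case: ifPn => [_|].
      by rewrite lee_fin (le_trans (ler_norm _)).
    rewrite notin_setE => xB; rewrite Af//; exact: (contra_not (@AB x)).
  apply: le_lt_trans H _; rewrite integral_cst//=; last exact: measurable_eball.
  have /andP[w0 w1] := @omega_ball_gt0_lty R N.
  by rewrite lte_mul_pinfty// lee_fin.
have Ifgt : (0 < \int[mu]_x (f x)%:E)%E.
  (* On the ball of radius [d] every rescaled coordinate is at most [1/2] in absolute value, so each
     factor is at least [exp(-4)] and the integral is positive. *)
  pose e := expR (-4) ^+ N : R; pose d := (2 * k)^-1.
  have d0 : 0 < d by rewrite invr_gt0 mulr_gt0.
  have H : (\int[mu]_(x in eball 0%R d) (cst e%:E x) <= \int[mu]_x (f x)%:E)%E.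
    rewrite integral_mkcond; apply: ge0_le_integral_nomeas => x _; rewrite patchE.
      by case: ifPn => // _; rewrite lee_fin exprn_ge0 ?expR_ge0.
    case: ifPn => [|_]; last by rewrite lee_fin.
    rewrite inE /eball/= subr0 => xd.
    rewrite lee_fin /e /f mul1r -[N in X in X <= _]card_ord -prodr_const.
    apply: ler_prod => i _; rewrite expR_ge0/= bump1_ge// !mxE addr0 normrM gtr0_norm//.
    rewrite mulrC -ler_pdivlMr// -invfM.
    exact: le_trans (coord_le_enorm _ _) (ltW xd).
  apply: lt_le_trans H; rewrite integral_cst//=; last exact: measurable_eball.
  have /andP[w0 w1] := @omega_ball_gt0_lty R N.
  rewrite eball_scale// mule_gt0 ?lte_fin ?exprn_gt0 ?expR_gt0//.
  by rewrite mule_gt0 ?lte_fin ?exprn_gt0.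
have [I IE] : exists I : R, (\int[mu]_x (f x)%:E = I%:E)%E.
  by exists (fine (\int[mu]_x (f x)%:E)); rewrite fineK// ge0_fin_numE.
have I0 : 0 < I by rewrite -lte_fin -IE.
exists (fun x => I^-1 * f (1 *: x + 0)); split.
- have -> : (fun x => I^-1 * f (1 *: x + 0)) = fun y => I^-1 * f (1^-1 *: y - 1^-1 *: 0).
    by apply/funext => y; rewrite scaler0 invr1 subr0 addr0.
  exact: test_fun_affine.
- by move=> x; rewrite mulr_ge0// invr_ge0 ltW.
- have -> : (\int[mu]_x (I^-1 * f (1 *: x + 0))%:E = \int[mu]_x (I^-1%:E * (f x)%:E))%E.
    by apply: eq_integral => x _; rewrite scale1r addr0 EFinM.
  have -> := ge0_integralZl mu measurableT mE (fun x _ => f0 x : (0 <= (f x)%:E)%E)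
    (ltW (_ : 0 < I^-1%:E)%E).
    by rewrite IE -EFinM mulVf ?gt_eqF.
  by rewrite lte_fin invr_gt0.
Qed.

End bump.

(** * Convolution with a test function *)

Section convolution.
Context {R : realType} {n : nat}.
Implicit Types (w k rho : 'rV[R]_n -> R) (x z : 'rV[R]_n).
Local Notation mu := (@lebesgue_rV R n).

Definition conv w rho x : R := \int[mu]_z (w z * rho (x - z)).

Lemma measurable_reflect k x : measurable_fun setT k ->
  measurable_fun setT (fun z => k (x - z)).
Proof.
move=> mk; apply: (measurableT_comp mk).
by apply: measurable_rV_sub; [exact: measurable_cst|exact: measurable_id].
Qed.

Lemma integrable_mul_bounded w k (B : R) : mu.-integrable setT (EFin \o w) ->
  measurable_fun setT k -> (forall z, `|k z| <= B) ->
  mu.-integrable setT (EFin \o (fun z => w z * k z)).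
Proof.
move=> wI mk kB; have /integrableP[/measurable_EFinP mw _] := wI.
apply: (@le_integrable _ _ _ _ _ _ _ (fun z => B%:E * (EFin \o w) z)%E) => //.
- by apply/measurable_EFinP; exact: measurable_funM.
- move=> z _ /=; rewrite lee_fin !normrM [leRHS]mulrC ler_wpM2l//.
  exact: le_trans (kB z) (ler_norm _).
- exact: integrableZl.
Qed.

Lemma le_norm_mul_bounded w k (B : R) : mu.-integrable setT (EFin \o w) ->
  measurable_fun setT k -> (forall z, `|k z| <= B) ->
  `|\int[mu]_z (w z * k z)| <= B * \int[mu]_z `|w z|.
Proof.
move=> wI mk kB; have I := integrable_mul_bounded wI mk kB.
have nwI : mu.-integrable setT (EFin \o (fun z => `|w z|)) by exact: integrable_norm.
apply: le_trans (le_normr_Rintegral measurableT I) _.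
have <- := @RintegralZl _ _ _ mu _ _ B measurableT nwI.
apply: le_Rintegral => //.
- exact: integrable_norm.
- exact: (integrableZl measurableT B nwI).
- by move=> z _; rewrite normrM mulrC ler_wpM2r.
Qed.

Lemma integrable_conv w rho x : mu.-integrable setT (EFin \o w) ->
  test_fun setT rho -> mu.-integrable setT (EFin \o (fun z => w z * rho (x - z))).
Proof.
move=> wI trho; have [B _ HB] := test_fun_bounded trho.
apply: (@integrable_mul_bounded _ (fun z => rho (x - z)) B) => //.
exact: measurable_reflect (test_fun_measurable trho).
Qed.

Lemma conv_sub_le w rho x y (L : R) : mu.-integrable setT (EFin \o w) ->
  test_fun setT rho -> (forall a b, `|rho a - rho b| <= L * enorm (a - b)) ->
  `|conv w rho x - conv w rho y| <= L * enorm (x - y) * \int[mu]_z `|w z|.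
Proof.
move=> wI trho HL; have mrho := test_fun_measurable trho.
rewrite /conv -RintegralB//; [|exact: integrable_conv..].
under eq_Rintegral do rewrite -mulrBr.
apply: (@le_norm_mul_bounded w (fun z => rho (x - z) - rho (y - z))) => //.
  by apply: measurable_funB; exact: measurable_reflect.
by move=> z; apply: le_trans (HL _ _) _; rewrite opprB addrA subrK.
Qed.

Lemma near_eball x (r : R) : 0 < r -> \forall y \near x, enorm (y - x) < r.
Proof.
move=> r0; have := open_nbhs_nbhs (conj (@open_eball _ _ x r) _).
by apply; rewrite /eball/= subrr enorm0.
Qed.

Lemma continuous_conv w rho : mu.-integrable setT (EFin \o w) ->
  test_fun setT rho -> continuous (conv w rho).
Proof.
move=> wI trho x; have [L L0 HL] := test_fun_lipschitz trho.
set W := \int[mu]_z `|w z|.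
have W0 : 0 <= W by apply: Rintegral_ge0.
apply/(@cvgrPdist_le _ _ _ (nbhs x) (nbhs_filter x)) => e e0.
have LW : 0 < e / (L * W + 1) by rewrite divr_gt0// ltr_wpDl// mulr_ge0.
have : \forall y \near x, enorm (x - y) < e / (L * W + 1).
  by apply: filterS (near_eball x LW) => y; rewrite enormBC.
apply: filterS => y xy.
apply: le_trans (conv_sub_le x y wI trho HL) _; rewrite -/W.
rewrite mulrAC; apply: (@le_trans _ _ ((L * W + 1) * enorm (x - y))).
  by rewrite ler_wpM2r ?enorm_ge0// lerDl.
by move: xy; rewrite ltr_pdivlMr ?ltr_wpDl ?mulr_ge0// mulrC => /ltW.
Qed.

(** By the mean value theorem and the Lipschitz bound on [partial i rho], the difference quotient of
    [rho] is within [L |h|] of its limit, uniformly in [z]. The derivative falls on [rho], so [w]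
    may be discontinuous. *)
Lemma is_derive_conv w rho i x : mu.-integrable setT (EFin \o w) ->
  test_fun setT rho ->
  is_derive x (delta_mx ord0 i) (conv w rho) (conv w (partial i rho) x).
Proof.
move=> wI trho; have tp := test_fun_partial i trho.
have [L L0 HL] := test_fun_lipschitz tp.
have mrho := test_fun_measurable trho.
have mp := test_fun_measurable tp.
set W := \int[mu]_z `|w z|.
have W0 : 0 <= W by apply: Rintegral_ge0.
have dr y : derivable rho y (delta_mx ord0 i) by have [/(_ 1%N)[_ /(_ i)[]]] := trho.
have H (h : R) : h != 0 -> `|h^-1 * (conv w rho (h *: delta_mx ord0 i + x) - conv w rho x) -
    conv w (partial i rho) x| <= L * `|h| * W.
  move=> h0; rewrite /conv -RintegralB//; [|exact: integrable_conv..].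
  rewrite -RintegralZl//; last exact: integrableB (integrable_conv _ wI trho)
    (integrable_conv _ wI trho).
  rewrite -RintegralB//; last exact: integrable_conv.
    2: exact: integrableZl (integrableB _ (integrable_conv _ wI trho)
    (integrable_conv _ wI trho)).
  under eq_Rintegral do rewrite -mulrBr mulrCA -mulrBr.
  apply: (@le_norm_mul_bounded w (fun z => h^-1 * (rho (h *: delta_mx ord0 i + x - z) -
    rho (x - z)) - partial i rho (x - z))) => //.
    apply: measurable_funB; last exact: measurable_reflect.
    apply: measurable_funM => //.
    by apply: measurable_funB; exact: measurable_reflect.
  move=> z; have [t|c ch E] := @MVT_line _ _ rho (x - z) (delta_mx ord0 i) h.
    exact: dr.
  have -> : h *: delta_mx ord0 i + x - z = x - z + h *: delta_mx ord0 i.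
    by rewrite -addrA addrC.
  rewrite E mulrC mulfK// -/(partial i rho _).
  apply: le_trans (HL _ _) _; rewrite addrAC subrr add0r enormZ ler_wpM2l//.
  have -> : enorm (delta_mx ord0 i : 'rV[R]_n) = 1.
    rewrite /enorm (bigD1 i)//= big1 ?addr0.
      by rewrite mxE !eqxx expr1n sqrtr1.
    by move=> j /negPf ji; rewrite mxE ji andbF expr0n.
  by rewrite mulr1.
have L' : (fun h : R => h^-1 *: ((conv w rho \o shift x) (h *: delta_mx ord0 i) -
    conv w rho x)) @ 0^' --> conv w (partial i rho) x.
  apply/cvgrPdist_le => e e0; near=> h.
  have h0 : h != 0 by near: h; exact: nbhs_dnbhs_neq.
  have LW : 0 < e / (L * W + 1) by rewrite divr_gt0// ltr_wpDl// mulr_ge0.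
  have he : `|h| <= e / (L * W + 1).
    near: h; apply: dnbhs0_le; by rewrite divr_gt0// ltr_wpDl// mulr_ge0.
  rewrite distrC; apply: le_trans (H _ h0) _.
  rewrite mulrAC; apply: (@le_trans _ _ ((L * W + 1) * `|h|)).
    by rewrite ler_wpM2r// lerDl.
  by move: he; rewrite ler_pdivlMr ?ltr_wpDl ?mulr_ge0// mulrC.
split; last exact/cvg_lim.
by apply/cvg_ex; exists (conv w (partial i rho) x).
Unshelve. all: by end_near. Qed.

Lemma partial_conv w rho i x : mu.-integrable setT (EFin \o w) ->
  test_fun setT rho -> partial i (conv w rho) x = conv w (partial i rho) x.
Proof.
by move=> wI trho; exact: (@derive_val _ _ _ _ _ _ _ (is_derive_conv i x wI trho)).
Qed.

Lemma smooth_conv w rho : mu.-integrable setT (EFin \o w) ->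
  test_fun setT rho -> smooth (conv w rho).
Proof.
move=> wI trho k; elim: k rho trho => [|k IH] rho trho.
  by split => //; exact: continuous_conv.
split; first exact: continuous_conv.
move=> i; split.
  by move=> x; exact: (@ex_derive _ _ _ _ _ _ _ (is_derive_conv i x wI trho)).
rewrite (_ : partial i _ = conv w (partial i rho)); last first.
  by apply/funext => x; exact: partial_conv.
by apply: IH; exact: test_fun_partial.
Qed.

Lemma convB w w' rho x : mu.-integrable setT (EFin \o w) ->
  mu.-integrable setT (EFin \o w') -> test_fun setT rho ->
  conv (w \- w') rho x = conv w rho x - conv w' rho x.
Proof.
move=> wI wI' trho; rewrite /conv -RintegralB//; [|exact: integrable_conv..].
by apply: eq_Rintegral => z _; rewrite mulrBl.
Qed.

Lemma convZ (a : R) w rho x : mu.-integrable setT (EFin \o w) ->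
  test_fun setT rho -> conv (fun z => a * w z) rho x = a * conv w rho x.
Proof.
move=> wI trho; rewrite /conv -RintegralZl//; last exact: integrable_conv.
by apply: eq_Rintegral => z _; rewrite mulrA.
Qed.

Lemma integrable_eball x (r : R) : 0 < r ->
  mu.-integrable setT (EFin \o (\1_(eball x r) : 'rV[R]_n -> R)).
Proof.
move=> r0; apply/integrableP; split.
  by apply/measurable_EFinP; apply: measurable_indic; exact: measurable_eball.
under eq_integral do rewrite /= ger0_norm//.
rewrite integral_indic//; last exact: measurable_eball.
rewrite setIT [X in (X < _)%E](eball_scale x r0).
have /andP[_ w1] := @omega_ball_gt0_lty R n.
by rewrite lte_mul_pinfty// lee_fin exprn_ge0// ltW.
Qed.

Lemma eball_far x y z (tau : R) : enorm (y - x) < tau -> ~ eball x (2 * tau) z ->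
  ~ eball (0 : 'rV[R]_n) tau (y - z).
Proof.
move=> yx; rewrite /eball/= subr0 => /negP; rewrite -leNgt => zx /(ltrD yx).
rewrite ltNge => /negP; apply.
rewrite -mulr2n -mulr_natl (le_trans zx)//.
by rewrite (le_trans (enorm_triangle y _ _))// addrC lerD// enormBC.
Qed.

(** An integrable substitute for the constant [1]: from within [tau] of [x] the kernel reaches only
    points of the ball of radius [2 tau], where the indicator is [1]. *)
Lemma conv_eball rho x y (tau : R) : 0 < tau -> test_fun (eball (0 : 'rV[R]_n) tau) rho ->
  (forall z, 0 <= rho z) -> (\int[mu]_z (rho z)%:E = 1)%E ->
  enorm (y - x) < tau -> conv \1_(eball x (2 * tau)) rho y = 1.
Proof.
move=> tau0 trho rho0 rho1 yx; rewrite /conv /Rintegral.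
have -> : (\int[mu]_z (\1_(eball x (2 * tau)) z * rho (y - z))%:E =
    \int[mu]_z (EFin \o rho) (y - z)%R)%E.
  apply: eq_integral => z _ /=; rewrite indicE; have [_|] := boolP (z \in _).
    by rewrite mul1r.
  rewrite notin_setE => /(eball_far yx) nz; rewrite mul0r.
  by rewrite (tsupport_eq0 (test_fun_out trho nz)).
rewrite ge0_integral_reflect_rV//=; first by rewrite rho1.
by apply/measurable_EFinP; exact: test_fun_measurable trho.
Qed.

(* The convolution of the indicator is constant near [x]. *)
Lemma conv_eball_partial rho x i (tau : R) : 0 < tau ->
  test_fun (eball (0 : 'rV[R]_n) tau) rho ->
  (forall z, 0 <= rho z) -> (\int[mu]_z (rho z)%:E = 1)%E ->
  conv \1_(eball x (2 * tau)) (partial i rho) x = 0.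
Proof.
move=> tau0 trho rho0 rho1.
have tau2 : 0 < 2 * tau by rewrite mulr_gt0.
rewrite -partial_conv; [|exact: integrable_eball|exact: test_fun_subset trho].
rewrite /partial (@near_eq_derive _ _ _ _ (cst (1 : R))); first by rewrite derive_cst.
by apply: filterS (near_eball x tau0) => y yx; exact: (conv_eball tau0).
Qed.

Lemma conv_local_le w rho x (a B tau : R) : (0 <= B)%R -> mu.-integrable setT (EFin \o w) ->
  test_fun (eball (0 : 'rV[R]_n) tau) rho -> (0 < tau)%R -> (forall z, `|rho z| <= B)%R ->
  ((`|conv (fun z => w z - a * \1_(eball x (2 * tau)) z) rho x|)%:E <=
  B%:E * \int[mu]_(z in eball x tau) (`|a - w z|)%:E)%E.
Proof.
move=> B0 wI trho tau0 rhoB; have tau2 : 0 < 2 * tau by rewrite mulr_gt0.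
have trho' : test_fun setT rho by exact: test_fun_subset trho.
have /integrableP[/measurable_EFinP mw _] := wI.
have w'I : mu.-integrable setT (EFin \o (fun z => w z - a * \1_(eball x (2 * tau)) z)).
  have := integrableB measurableT wI (integrableZl measurableT a (integrable_eball x tau2)).
  by congr (_.-integrable _ _); apply/funext.
have I := integrable_conv x w'I trho'.
have /integrableP[mI _] := I.
have fI := integrable_fin_num measurableT I.
rewrite /conv /Rintegral.
move: fI; set K := (\int[mu]_z _)%E => fI.
have -> : (`|fine K|)%:E = `|K|%E by rewrite -[in RHS](fineK fI).
apply: le_trans (le_abse_integral mu measurableT mI) _.
have mf : measurable_fun (eball x tau) (fun z => (`|a - w z|)%:E).
  apply/measurable_EFinP; apply: measurable_funTS; apply: measurableT_comp => //.
  exact: measurable_funB.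
have <- := ge0_integralZl mu (measurable_eball x tau) mf
  (fun z _ => normr_ge0 _ : (0 <= (`|a - w z|)%:E)%E) (B0 : (0 <= B%:E)%E).
rewrite [leRHS]integral_mkcond; apply: ge0_le_integral_nomeas => z _.
  exact: abse_ge0.
rewrite patchE; case: ifPn => [|]; last first.
  rewrite notin_setE => nz; have nz' : ~ eball (0 : 'rV[R]_n) tau (x - z).
    by move: nz; rewrite /eball/= subr0 enormBC.
  by rewrite /= (tsupport_eq0 (test_fun_out trho nz')) mulr0 normr0.
rewrite inE /= lee_fin => xz; have -> : \1_(eball x (2 * tau)) z = 1 :> R.
  rewrite indicE mem_set// /eball/=; apply: (lt_le_trans xz).
  by rewrite ler_peMl ?ltW// ltr1n.
by rewrite mulr1 normrM mulrC distrC ler_wpM2r.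
Qed.

(** Convolution reproduces constants and its gradient kills them, so [w] may be replaced by [w - a]
    in both quantities. The constant [a] is not integrable, hence it is cut off to the ball of
    radius [2 tau]. *)
Lemma conv_bounds w rho x (a B B' tau : R) : (0 <= B)%R -> (0 <= B')%R ->
  mu.-integrable setT (EFin \o w) ->
  test_fun (eball (0 : 'rV[R]_n) tau) rho -> (0 < tau)%R -> (forall z, 0 <= rho z <= B)%R ->
  (\int[mu]_z (rho z)%:E = 1)%E -> (forall i z, `|partial i rho z| <= B')%R ->
  ((`|a - conv w rho x|)%:E <= B%:E * \int[mu]_(z in eball x tau) (`|a - w z|)%:E)%E /\
  ((enorm (grad (conv w rho) x))%:E <=
    (n%:R * B')%:E * \int[mu]_(z in eball x tau) (`|a - w z|)%:E)%E.
Proof.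
move=> B0 B'0 wI trho tau0 rhoB rho1 rhoB'.
have tau2 : 0 < 2 * tau by rewrite mulr_gt0.
have trho' : test_fun setT rho by exact: test_fun_subset trho.
have rho0 z : 0 <= rho z by have /andP[] := rhoB z.
have eI := integrable_eball x tau2.
have aI : mu.-integrable setT (EFin \o (fun z => a * \1_(eball x (2 * tau)) z)).
  have := integrableZl measurableT a eI.
  by congr (_.-integrable _ _); apply/funext.
have CE k : test_fun setT k -> conv (fun z => w z - a * \1_(eball x (2 * tau)) z) k x =
    conv w k x - a * conv \1_(eball x (2 * tau)) k x.
  move=> tk; rewrite -(convZ _ _ eI tk).
  exact: (@convB w (fun z => a * \1_(eball x (2 * tau)) z)).
split.
  have := @conv_local_le w rho x a B tau B0 wI trho tau0.
  rewrite CE// (conv_eball tau0)//; last by rewrite subrr enorm0.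
  rewrite mulr1 distrC; apply => z; rewrite ger0_norm//.
  by have /andP[] := rhoB z.
set J := (\int[mu]_(z in eball x tau) _)%E.
have J0 : (0 <= J)%E by apply: integral_ge0 => z _; rewrite lee_fin.
have P i : ((`|grad (conv w rho) x ord0 i|)%:E <= B'%:E * J)%E.
  have := @conv_local_le w (partial i rho) x a B' tau B'0 wI (test_fun_partial i trho) tau0.
  rewrite CE; last exact: test_fun_partial.
  rewrite (conv_eball_partial _ _ tau0)// mulr0 subr0 mxE partial_conv//.
  by apply => z; exact: rhoB'.
apply: (@le_trans _ _ (n%:R%:E * (`|grad (conv w rho) x|)%:E)%E).
  by rewrite -EFinM lee_fin enorm_le_norm.
rewrite EFinM -muleA lee_wpmul2l ?lee_fin//.
have Y0 : (0 <= B'%:E * J)%E by rewrite mule_ge0 ?lee_fin.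
(* The maximum over the coordinates is bounded in the reals, so an infinite right-hand side is
   treated apart. *)
case: (_ * _)%E Y0 P => [y|_ _|//]; last by rewrite leey.
rewrite lee_fin => y0 P; rewrite lee_fin /Num.norm/= mx_normrE.
by apply: bigmax_le => // -[k i] _ /=; have := P i; rewrite lee_fin (ord1 k).
Qed.

End convolution.

Section mollification.
Context {R : realType}.
Local Open Scope ereal_scope.

Lemma scaled_mollifier n : exists2 B : R, (0 < B)%R & forall tau : R, (0 < tau)%R ->
  exists rho : 'rV[R]_n.+1 -> R,
  [/\ test_fun (eball (0 : 'rV[R]_n.+1) tau) rho,
      forall z, (0 <= rho z <= B / tau ^+ n.+1)%R,
      \int[lebesgue_rV n.+1]_z (rho z)%:E = 1 &
      forall i z, (`|partial i rho z| <= B / tau ^+ n.+1 / tau)%R].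
Proof.
have [phi [tphi phi0 phi1]] := @mollifier_exists R n.
have [B B0 HB] := test_fun_bounded tphi.
have /cid[Bd HBd] : exists Bd : 'I_n.+1 -> R, forall i x, (`|partial i phi x| <= Bd i)%R.
  have /choice[Bd H] : forall i : 'I_n.+1, exists b : R, forall x, (`|partial i phi x| <= b)%R.
    by move=> i; have [b _ Hb] := test_fun_bounded (test_fun_partial i tphi); exists b.
  by exists Bd.
have Bd0 i : (0 <= Bd i)%R by exact: le_trans (HBd i 0%R).
(* A single constant dominating [phi] and all its partial derivatives; the [1] makes it positive. *)
pose M := (1 + B + \sum_i Bd i)%R.
have S0 : (0 <= \sum_i Bd i)%R by exact: sumr_ge0.
exists M; first by rewrite ltr_wpDr// ltr_wpDr.
move=> tau tau0; have tn0 : (0 < tau ^+ n.+1)%R by exact: exprn_gt0.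
have tn0' : (0 <= (tau ^+ n.+1)^-1)%R by rewrite invr_ge0 ltW.
exists (fun y => (tau ^+ n.+1)^-1 * phi (tau^-1 *: y - tau^-1 *: 0))%R; split.
- exact: test_fun_affine.
- move=> z; rewrite mulr_ge0//= mulrC ler_wpM2r//.
  rewrite (le_trans (ler_norm _))// (le_trans (HB _))//.
  by rewrite /M -addrA addrCA lerDl addr_ge0.
- rewrite (ge0_integral_rescale _ (test_fun_measurable tphi))// mulVf ?gt_eqF//.
  by rewrite phi1 mul1e.
- move=> i z; have [sphi _ _] := tphi.
  rewrite (partial_affine _ _ _ _ _ (smooth_Ck1 sphi)) !normrM.
  rewrite (ger0_norm tn0') gtr0_norm ?invr_gt0//.
  rewrite mulrCA [leRHS]mulrC ler_wpM2l ?invr_ge0 ?(ltW tau0)// mulrC ler_wpM2r//.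
  rewrite (le_trans (HBd _ _))// /M (bigD1 i)//= addrCA lerDl.
  by rewrite !addr_ge0// sumr_ge0.
Qed.

Lemma powRV (x r : R) : (0 < x)%R -> (x^-1 `^ r = (x `^ r)^-1)%R.
Proof. by move=> x0; rewrite -powR_inv1 ?ltW// -powRrM mulN1r powRN. Qed.

(** The value [a] is quantified after [v] and at each [x], so [v], built from a translate [w], can
    be compared both with the original [u] (taking [a = u x]) and with [0]. *)
Lemma mollification n (p : R) : (1 < p)%R -> exists2 C : R, (0 < C)%R &
  forall tau : R, (0 < tau)%R -> forall w : 'rV[R]_n.+1 -> R,
  (lebesgue_rV n.+1).-integrable setT (EFin \o w) ->
  exists v, smooth v /\ forall x a,
  (`|a - v x| `^ p + tau `^ p * enorm (grad v x) `^ p)%R%:E <=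
  (C / tau ^+ n.+1)%R%:E *
    \int[lebesgue_rV n.+1]_(z in eball x tau) (`|a - w z| `^ p)%:E.
Proof.
move=> p1; have p0 : (0 < p)%R by exact: lt_trans p1.
have [B B0 HB] := @scaled_mollifier n.
have /andP[w0 w1] := @omega_ball_gt0_lty R n.+1.
have [W W0 WE] : exists2 W : R, (0 < W)%R & @omega_ball R n.+1 = W%:E.
  have E : @omega_ball R n.+1 = (fine (@omega_ball R n.+1))%:E.
    by rewrite fineK// ge0_fin_numE// ltW.
  by exists (fine (@omega_ball R n.+1)) => //; rewrite -lte_fin -E.
pose N : R := n.+1%:R.
have N0 : (0 <= N)%R by [].
(* The [1] pays for the distance term and [N^p] for the gradient, where the Euclidean norm is
   bounded by [N] times the sup norm. *)
pose C := ((1 + N `^ p) * (B `^ p * W `^ (p - 1)))%R.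
have C0 : (0 < C)%R.
  by rewrite mulr_gt0 ?mulr_gt0 ?powR_gt0// ltr_pwDl// powR_ge0.
exists C => // tau tau0 w wI.
have tn0 : (0 < tau ^+ n.+1)%R by exact: exprn_gt0.
have [rho [trho rhoB rho1 rhoB']] := HB _ tau0.
have trho' : test_fun setT rho by exact: test_fun_subset trho.
exists (conv w rho); split; first exact: smooth_conv.
move=> x a.
set b := (B / tau ^+ n.+1)%R in rhoB rhoB'.
have b0 : (0 < b)%R by rewrite divr_gt0.
have b'0 : (0 < b / tau)%R by rewrite divr_gt0.
have [H1 H2] := conv_bounds x a (ltW b0) (ltW b'0) wI trho tau0 rhoB rho1 rhoB'.
set J := \int[_]_(z in eball x tau) _ in H1 H2.
have J0 : 0 <= J by apply: integral_ge0 => z _; rewrite lee_fin.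
set Jp := \int[_]_(z in eball x tau) _.
have Jp0 : 0 <= Jp by apply: integral_ge0 => z _; rewrite lee_fin powR_ge0.
have mE : measurable (eball x tau) := measurable_eball x tau.
have /integrableP[/measurable_EFinP mw _] := wI.
have JJ : J `^ p <= ((tau ^+ n.+1 * W) `^ (p - 1))%:E * Jp.
  have := @jensen_power _ _ R (lebesgue_rV n.+1) p (eball x tau) (fun z => `|a - w z|%R) p1 mE.
  rewrite [X in X `^ (p - 1)](eball_scale x tau0) -/(@omega_ball R n.+1) WE -EFinM poweR_EFin.
  apply => // .
  by apply: measurableT_comp => //; exact: measurable_funB.
have P (y c : R) : (0 <= y)%R -> (0 <= c)%R -> y%:E <= c%:E * J ->
    (y `^ p)%:E <= (c `^ p * (tau ^+ n.+1 * W) `^ (p - 1))%:E * Jp.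
  move=> y0 c0 yc; have := le_poweR (ltW p0) (y0 : 0 <= y%:E) yc.
  rewrite poweR_EFin poweRM ?lee_fin// poweR_EFin => /le_trans; apply.
  by rewrite EFinM -muleA lee_wpmul2l// lee_fin powR_ge0.
have K1 := P _ _ (normr_ge0 _) (ltW b0) H1.
have K2 := P _ _ (enorm_ge0 _) (mulr_ge0 N0 (ltW b'0)) H2.
rewrite EFinD EFinM.
apply: le_trans (leeD K1 (lee_wpmul2l _ K2)) _; first by rewrite lee_fin powR_ge0.
rewrite muleA -EFinM -ge0_muleDl ?lee_fin ?mulr_ge0 ?powR_ge0//.
rewrite lee_wpmul2r// -EFinD lee_fin le_eqVlt; apply/orP; left; apply/eqP.
(* The kernel height [tau^(-N)] to the power [p], against the ball volume to the power [p - 1] from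
   Jensen, leaves one factor [tau^(-N)]. *)
have bE : (b `^ p * (tau ^+ n.+1 * W) `^ (p - 1) = B `^ p * W `^ (p - 1) / tau ^+ n.+1)%R.
  rewrite /b powRM ?(ltW B0) ?invr_ge0 ?(ltW tn0)// powRM ?(ltW tn0) ?(ltW W0)//.
  rewrite powRV// (powRB (x := tau ^+ n.+1)) ?(gt_eqF tn0) ?implybT// powRr1 ?(ltW tn0)//.
  have tp0 : (0 < (tau ^+ n.+1) `^ p)%R by rewrite powR_gt0.
  by field; rewrite !gt_eqF.
have -> : ((N * (b / tau)) `^ p = N `^ p * b `^ p * (tau `^ p)^-1)%R.
  have t'0 : (0 <= tau^-1)%R by rewrite invr_ge0 ltW.
  rewrite (powRM _ N0 (mulr_ge0 (ltW b0) t'0)) (powRM _ (ltW b0) t'0).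
  by rewrite (powRV p tau0) mulrA.
have tp0 : (tau `^ p != 0)%R by rewrite gt_eqF// powR_gt0.
have -> : (tau `^ p * (N `^ p * b `^ p * (tau `^ p)^-1 * (tau ^+ n.+1 * W) `^ (p - 1)) =
   N `^ p * (b `^ p * (tau ^+ n.+1 * W) `^ (p - 1)))%R by field.
by rewrite bE /C; field; rewrite gt_eqF.
Qed.

End mollification.

(** * Interior cone property of Lipschitz domains *)

Section lipschitz_geometry.
Context {R : realType}.

Lemma enorm_orthogonal n (Q : 'M[R]_n) (x : 'rV[R]_n) : Q *m Q^T = 1%:M ->
  enorm (x *m Q) = enorm x.
Proof.
have E (y : 'rV[R]_n) : enorm y = Num.sqrt ((y *m y^T) ord0 ord0).
  by rewrite /enorm mxE; congr Num.sqrt; apply: eq_bigr => i _; rewrite mxE expr2.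
by move=> QQ; rewrite !E trmx_mul mulmxA -(mulmxA x) QQ mulmx1.
Qed.

Lemma enorm_col' n (y : 'rV[R]_n.+1) (i : 'I_n.+1) : enorm (col' i y) <= enorm y.
Proof.
rewrite /enorm ler_sqrt; last by apply: sumr_ge0 => j _; exact: sqr_ge0.
rewrite (bigD1_ord i)//= addrC -subr_ge0.
have -> : \sum_(j < n) col' i y ord0 j ^+ 2 = \sum_(j < n) y ord0 (lift i j) ^+ 2.
  by apply: eq_bigr => j _; rewrite mxE.
by rewrite addrAC subrr add0r sqr_ge0.
Qed.

(** [e] is the vertical axis of the chart, pulled back by the rotation. From [z - t e] to [x] the
    height grows by at least [t - |x - z|] and the graph by at most [M |x - z|], so
    [(1 + M) |x - z| <= t] keeps [x] above the graph. *)
Lemma lipschitz_chart_cone n (M : R) (Omega U : set 'rV[R]_n.+1) : 0 < M ->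
  lipschitz_chart M Omega U ->
  exists2 e : 'rV[R]_n.+1, enorm e = 1 & forall x z (t : R),
    U (z - t *: e) -> U x -> Omega (z - t *: e) -> enorm (x - z) <= t / (1 + M) ->
    Omega x.
Proof.
move=> M0 [Q [b [phi [QQ phiM OU]]]].
have M1 : 0 < 1 + M by rewrite addr_gt0.
have OE y : U y -> Omega y <->
    phi (col' ord_max (y *m Q + b)) < (y *m Q + b) ord0 ord_max.
  move=> Uy; have := congr1 (fun A => A y) OU; rewrite /setI/= => E.
  by split=> [Oy|H]; [have : Omega y /\ U y by []; rewrite E => -[]|
    have : U y /\ _ := conj Uy H; rewrite -E => -[]].
exists (delta_mx ord0 ord_max *m Q^T).
  rewrite enorm_orthogonal; last by rewrite trmxK; exact: mulmx1C.
  rewrite /enorm (bigD1 ord_max)//= big1 ?addr0; last first.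
    by move=> j /negPf ji; rewrite mxE ji andbF expr0n.
  by rewrite mxE !eqxx expr1n sqrtr1.
move=> x z t; set z' := z - _ => Uz' Ux /(OE _ Uz') Oz' xz; apply/(OE _ Ux).
set d := (x - z) *m Q.
have dE : enorm d = enorm (x - z) by exact: enorm_orthogonal.
have E : x *m Q + b = z' *m Q + b + (d + t *: delta_mx ord0 ord_max).
  have -> : t *: delta_mx ord0 ord_max =
      (t *: (delta_mx ord0 ord_max *m Q^T)) *m Q :> 'rV[R]_n.+1.
    by rewrite -scalemxAl -mulmxA (mulmx1C QQ) mulmx1.
  rewrite /d -mulmxDl addrAC -mulmxDl; congr (_ *m Q + b).
  by rewrite /z' [x - z + _]addrC addrA subrK addrC subrK.
have Emax : (x *m Q + b) ord0 ord_max = (z' *m Q + b) ord0 ord_max + (d ord0 ord_max + t).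
  have G (P d' : 'rV[R]_n.+1) : (P + (d' + t *: delta_mx ord0 ord_max)) ord0 ord_max =
      P ord0 ord_max + (d' ord0 ord_max + t) by rewrite !mxE !eqxx mulr1.
  by rewrite E G.
have Ecol : col' ord_max (x *m Q + b) - col' ord_max (z' *m Q + b) = col' ord_max d.
  have G (P d' : 'rV[R]_n.+1) : col' ord_max (P + (d' + t *: delta_mx ord0 ord_max)) -
      col' ord_max P = col' ord_max d'.
    apply/rowP => j; rewrite !mxE [lift _ _ == _]eq_sym (negPf (neq_lift _ _)) andbF.
    by rewrite mulr0 addr0 addrAC subrr add0r.
  by rewrite E G.
have H1 : phi (col' ord_max (x *m Q + b)) <= phi (col' ord_max (z' *m Q + b)) + M * enorm (x - z).
  rewrite -lerBlDl (le_trans (ler_norm _))// (le_trans (phiM _ _))//.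
  by rewrite Ecol ler_pM2l// -dE enorm_col'.
have H2 : - enorm (x - z) <= d ord0 ord_max.
  by rewrite lerNl (le_trans (ler_norm _))// normrN -dE coord_le_enorm.
apply: le_lt_trans H1 _; rewrite Emax ltr_leD//.
move: xz; rewrite ler_pdivlMr//; lra.
Qed.

(* Cells of a grid of step [l], encoded by the half-spaces containing them; [L] does
   not depend on [x0]. *)
Lemma finite_cells n (D delta : R) : 0 < D -> 0 < delta -> exists L : nat,
  forall x0 : 'rV[R]_n, exists kappa : 'rV[R]_n -> {ffun 'I_n * 'I_L -> bool},
  (forall k, measurable (kappa @^-1` [set k])) /\
  forall y z, enorm (y - x0) <= D -> enorm (z - x0) <= D -> kappa y = kappa z ->
    enorm (y - z) <= delta.
Proof.
move=> D0 delta0.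
(* Coordinates differing by at most [l] give Euclidean distance at most [n l <= delta]. *)
pose l : R := delta / n.+1%:R.
have l0 : 0 < l by rewrite divr_gt0.
(* Enough levels to cover the range [[0, 2 D]] of the shifted coordinates in steps of [l]. *)
pose L := (Num.truncn ((D + D) / l)).+1.
exists L => x0.
exists (fun z => [ffun q : 'I_n * 'I_L => (q.2%:R * l <= z ord0 q.1 - x0 ord0 q.1 + D)]).
split=> [k|y z yD zD kE].
  set A := (X in measurable X).
  have -> : A = \bigcap_(q in [set: 'I_n * 'I_L])
      [set z | (q.2%:R * l <= z ord0 q.1 - x0 ord0 q.1 + D) = k q].
    apply/seteqP; split=> [z /= <- q _|z Hz /=]; first by rewrite /= ffunE.
    by apply/ffunP => q; rewrite ffunE; exact: Hz.
  apply: fin_bigcap_measurable => // q _.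
  have m1 : measurable [set z : 'rV[R]_n | q.2%:R * l <= z ord0 q.1 - x0 ord0 q.1 + D].
    rewrite (_ : [set _ | _] = setT `&` rV_coord q.1 @^-1`
        `[q.2%:R * l - D + x0 ord0 q.1, +oo[); last first.
      apply/seteqP; split=> z; rewrite /rV_coord/= in_itv/= andbT; first by split => //; lra.
      by move=> [_]; lra.
    exact: measurable_rV_coord.
  case: (k q) => //.
  set B := (X in measurable X).
  have -> : B = ~` [set z : 'rV[R]_n | q.2%:R * l <= z ord0 q.1 - x0 ord0 q.1 + D].
    2: exact: measurableC.
  apply/seteqP; split=> v /=; first by move=> ->.
  by move/negP/negbTE.
have B v j : enorm (v - x0) <= D -> 0 <= v ord0 j - x0 ord0 j + D <= D + D.
  move=> vD; have := le_trans (coord_le_enorm (v - x0) j) vD.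
  by rewrite !mxE ler_norml => /andP[h1 h2]; rewrite lerD2r h2 andbT; lra.
(* The highest level below the coordinate of [u] is, by equality of codes, also below that of
   [v]. *)
have H u v j : enorm (u - x0) <= D -> enorm (v - x0) <= D ->
    [ffun q : 'I_n * 'I_L => (q.2%:R * l <= u ord0 q.1 - x0 ord0 q.1 + D)] =
    [ffun q : 'I_n * 'I_L => (q.2%:R * l <= v ord0 q.1 - x0 ord0 q.1 + D)] ->
    u ord0 j - v ord0 j <= l.
  move=> uD vD E; have /andP[u0 u1] := B u j uD.
  set a := u ord0 j - _ + D in u0 u1.
  have al : 0 <= a / l by rewrite divr_ge0// ltW.
  have iL : (Num.truncn (a / l) < L)%N.
    by rewrite ltnS le_truncn// ler_pM2r// invr_gt0.
  have /andP[i1 i2] := truncn_itv al.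
  have := congr1 (fun f : {ffun 'I_n * 'I_L -> bool} => f (j, Ordinal iL)) E.
  rewrite !ffunE/= -/a -ler_pdivlMr// i1 => /esym; rewrite -ler_pdivlMr// => i3.
  have := lt_le_trans i2 (lexx _); rewrite -natr1 => i2'.
  have : a / l < (v ord0 j - x0 ord0 j + D) / l + 1.
    by rewrite (lt_le_trans i2')// lerD2r.
  rewrite ltr_pdivrMr// mulrDl mul1r divfK ?gt_eqF// /a => h.
  by apply: ltW; lra.
apply: le_trans (enorm_le_norm _) _.
apply: (@le_trans _ _ (n%:R * l)); last first.
  by rewrite /l mulrCA ler_piMr ?(ltW delta0)// ler_pdivrMr// mul1r ler_nat.
rewrite ler_wpM2l// /Num.norm/= mx_normrE; apply: bigmax_le; first exact: ltW.
move=> [i j] _ /=; rewrite (ord1 i) !mxE ler_norml.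
by rewrite (H _ _ j yD zD kE) andbT lerNl opprB (H _ _ j zD yD (esym kE)).
Qed.

Lemma enorm_le_ediam n (Omega : set 'rV[R]_n) x y : bounded_set Omega ->
  Omega x -> Omega y -> enorm (x - y) <= ediam Omega.
Proof.
move=> [B [_ HB]] Ox Oy; apply: ub_le_sup; last by exists (x, y).
exists (n%:R * (B + 1 + (B + 1))) => _ [[a b] [/= Oa Ob] <-].
apply: le_trans (enorm_le_norm _) _; rewrite ler_wpM2l//.
apply: le_trans (ler_normB _ _) _.
by apply: lerD; apply: HB => //; rewrite ltrDl.
Qed.

(** A cell that comes close to the boundary is small enough to fit, with room to spare, in one chart
    and takes its direction; the other cells take the direction [0]. The scale [t0] and the number
    [L] are fixed before [Omega]. *)
Lemma lipschitz_direction n (r M d : R) : 0 < r -> 0 < M ->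
  exists (t0 : R) (L : nat), 0 < t0 <= 1 /\
  forall (Omega : set 'rV[R]_n.+1) (m : nat), open Omega -> bounded_set Omega ->
  lipschitz_domain r m M Omega -> ediam Omega = d ->
  exists (kappa : 'rV[R]_n.+1 -> {ffun 'I_n.+1 * 'I_L -> bool})
    (E : {ffun 'I_n.+1 * 'I_L -> bool} -> 'rV[R]_n.+1),
  [/\ forall k, measurable (kappa @^-1` [set k]), forall k, enorm (E k) <= 1 &
      forall x z (t : R), 0 < t -> t <= t0 -> Omega (z - t *: E (kappa z)) ->
        enorm (x - z) <= t / (1 + M) -> Omega x].
Proof.
move=> r0 M0.
have M1 : 0 < 1 + M by rewrite addr_gt0.
have D0 : 0 < `|d| + 1 by rewrite ltr_wpDl.
have r4 : 0 < r / 4 by rewrite divr_gt0.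
have [L HL] := @finite_cells n.+1 _ _ D0 r4.
(* Budget inside the chart ball of radius [r]: [r / 2] from the boundary point to its cell, [r / 4]
   across the cell, [r / 8] for the translation or for [x - z]. The bound [1] keeps [z] within
   [|d| + 1] of [x0]. *)
exists (Num.min 1 (r / 8)), L; split.
  by rewrite lt_min ltr01 divr_gt0//= ge_min lexx.
move=> Omega m oO bO [k [U [oU UB _ chart]]] dO.
have [[x0 Ox0]|O0] := pselect (exists x0, Omega x0); last first.
  have [kappa [mk _]] := HL 0; exists kappa, (fun=> 0); split => //.
    by move=> _; rewrite enorm0.
  by move=> x z t _ _ Oz; exfalso; apply: O0; eexists; exact: Oz.
have [kappa [mk Hk]] := HL x0; exists kappa.
(* The bound on [|z - x0|] restricts to the region where equal codes force a distance of at most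
   [r / 4]. *)
pose near_bd k z b := [/\ kappa z = k, enorm (z - x0) <= `|d| + 1, boundary Omega b &
  enorm (z - b) < r / 2].
have /choice[E HE] : forall k, exists e : 'rV[R]_n.+1,
    ((exists z b, near_bd k z b) /\ (exists i b, [/\ exists z, near_bd k z b,
      eball b r `<=` U i, enorm e = 1 & forall x z (t : R),
    U i (z - t *: e) -> U i x -> Omega (z - t *: e) -> enorm (x - z) <= t / (1 + M) ->
    Omega x])) \/ (~ (exists z b, near_bd k z b) /\ e = 0).
  move=> c; have [[z [b H]]|H] := pselect (exists z b, near_bd c z b); last first.
    by exists 0; right.
  have [_ _ bb _] := H; have [i Ui] := UB _ bb.
  have [e e1 He] := lipschitz_chart_cone M0 (chart i).
  exists e; left; split; first by exists z, b.
  by exists i, b; split => //; exists z.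
exists E; split => //.
  by move=> c; have [[_ [i [b [_ _ -> _]]]]|[_ ->]] := HE c; rewrite ?enorm0.
move=> x z t tgt; rewrite le_min => /andP[t1 tr].
have E1 : enorm (E (kappa z)) <= 1.
  by have [[_ [i [b [_ _ -> _]]]]|[_ ->]] := HE (kappa z); rewrite ?enorm0.
move=> Oz xz.
have xzt : enorm (x - z) <= t.
  by rewrite (le_trans xz)// ler_pdivrMr// ler_peMr ?ltW//; lra.
have zE : enorm (z - (z - t *: E (kappa z))) <= t.
  by rewrite opprB addrC subrK enormZ gtr0_norm// ler_piMr// ltW.
have zx0 : enorm (z - x0) <= `|d| + 1.
  rewrite (le_trans (enorm_triangle (z - t *: E (kappa z)) _ _))// addrC lerD//.
    by rewrite (le_trans (enorm_le_ediam bO Oz Ox0))// dO ler_norm.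
  exact: le_trans t1.
have [[_ [i [b [[z' [kz z'x0 bb z'b]] bU e1 He]]]]|[nb E0]] := HE (kappa z).
  have zz' : enorm (z - z') <= r / 4 by apply: Hk.
  have zb : enorm (z - b) < r / 2 + r / 4.
    by rewrite (le_lt_trans (enorm_triangle z' _ _))// addrC ltr_leD.
  apply: (He x z t) => //; apply: bU; rewrite /eball/=.
    rewrite (le_lt_trans (enorm_triangle z _ _))// enormBC.
    rewrite (le_lt_trans (lerD zE (lexx _)))//; lra.
  rewrite (le_lt_trans (enorm_triangle z _ _))//.
  by rewrite (le_lt_trans (lerD xzt (lexx _)))//; lra.
(* Here [z] itself is in [Omega]. If [x] were outside, the segment from [z] would meet the boundary
   within [t <= r / 8], and the cell would have been marked as near it. *)
move: Oz; rewrite E0 scaler0 subr0 => Oz; apply: contrapT => nOx.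
have [a /andP[a0 a1] bb] := boundary_on_segment oO Oz nOx.
apply: nb; exists z, (z + a *: (x - z)); split => //.
rewrite opprD addrA subrr sub0r enormN enormZ ger0_norm//.
apply: (@le_lt_trans _ _ t); last lra.
by rewrite (le_trans _ xzt)// ler_piMl ?enorm_ge0.
Qed.

End lipschitz_geometry.

Lemma poweRD_le (R : realType) (p : R) (a b : \bar R) : (1 < p)%R ->
  (0 <= a)%E -> (0 <= b)%E ->
  ((a + b) `^ p <= (2 `^ (p - 1))%:E * (a `^ p + b `^ p))%E.
Proof.
move=> p1; have p0 : (p != 0)%R by rewrite gt_eqF// (lt_trans _ p1).
have P : (0 < (2 : R) `^ (p - 1))%R by exact: powR_gt0.
have yy x : (0 <= x -> (2 `^ (p - 1))%:E * (+oo `^ p + x) = +oo)%E.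
  by move=> x0; rewrite poweRyr// addye ?gt0_muley// gt_eqF// (lt_le_trans _ x0).
case: a b => [a| |] [b| |] // a0 b0.
- by rewrite -EFinD !poweR_EFin -EFinD -EFinM lee_fin powRD_le.
- by rewrite (addeC (_ `^ p)%E) yy ?poweR_ge0// leey.
- by rewrite yy ?poweR_ge0// leey.
- by rewrite yy ?poweR_ge0// leey.
Qed.

(* Translating [u] by [t *: E (kappa z)] pushes its support inside [Omega] by
   [t / (1 + M)]; half of this margin is the mollification radius, the other half
   keeps the closure of the support inside [Omega]. *)
Section piecewise_translation.
Context {R : realType} {n : nat} {I : finType}.
Variables (Omega : set 'rV[R]_n.+1) (M t0 : R)
  (kappa : 'rV[R]_n.+1 -> I) (E : I -> 'rV[R]_n.+1).
Hypothesis bO : bounded_set Omega.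
Hypothesis M0 : (0 < M)%R.
Hypothesis t01 : (t0 <= 1)%R.
Hypothesis mk : forall k, measurable (kappa @^-1` [set k]).
Hypothesis E1 : forall k, (enorm (E k) <= 1)%R.
Hypothesis cone : forall x z (t : R), (0 < t)%R -> (t <= t0)%R ->
  Omega (z - t *: E (kappa z))%R -> (enorm (x - z) <= t / (1 + M))%R -> Omega x.
Implicit Types (u v : 'rV[R]_n.+1 -> R) (t p : R).
Local Notation mu := (@lebesgue_rV R n.+1).

Let translate u t z := u (z - t *: E (kappa z)).

Let M1 : 0 < 1 + M. Proof. by rewrite addr_gt0. Qed.

Lemma measurable_shift u b : measurable_fun setT u ->
  measurable_fun setT (fun z : 'rV[R]_n.+1 => u (z - b)).
Proof.
by move=> mu'; apply: (measurableT_comp mu'); apply: measurable_rV_sub;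
  [exact: measurable_id|exact: measurable_cst].
Qed.

(** [kappa] takes finitely many values with measurable fibres, so the translate is a finite sum of
    shifts times indicators. *)
Lemma measurable_translate u t : measurable_fun setT u ->
  measurable_fun setT (translate u t).
Proof.
move=> mu'.
have -> : translate u t =
    (fun z => \sum_(k : I) (\1_(kappa @^-1` [set k]) z * u (z - t *: E k))).
  apply/funext => z; rewrite (bigD1 (kappa z))//= big1 ?addr0.
    by rewrite indicE mem_set// mul1r.
  by move=> k kz; rewrite indicE memNset ?mul0r//= => kE; rewrite kE eqxx in kz.
apply: measurable_sum => k; apply: measurable_funM; first exact: measurable_indic.
exact: measurable_shift.
Qed.

Lemma translate_neq0 u t z : test_fun Omega u -> translate u t z != 0 ->
  Omega (z - t *: E (kappa z)).
Proof.
move=> tu; apply: contraPP => nO.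
by rewrite /translate (tsupport_eq0 (test_fun_out tu nO)) eqxx.
Qed.

Lemma integrable_translate u t : 0 < t <= t0 -> test_fun Omega u ->
  mu.-integrable setT (EFin \o translate u t).
Proof.
move=> /andP[tgt tt0] tu; have [B B0 HB] := test_fun_bounded tu.
have [b [_ Hb]] := bO.
(* A Euclidean bound for [Omega], plus more than the translation length, which is at most [1]. *)
pose A := n.+1%:R * (`|b| + 1) + 2.
have A0 : 0 < A by rewrite ltr_wpDl// mulr_ge0// addr_ge0.
have OA z : Omega (z - t *: E (kappa z)) -> eball 0 A z.
  move=> Oz; rewrite /eball/= subr0.
  have := enormD (z - t *: E (kappa z)) (t *: E (kappa z)); rewrite subrK => /le_lt_trans; apply.
  rewrite /A ler_ltD//.
    rewrite (le_trans (enorm_le_norm _))// ler_wpM2l//.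
    by apply: Hb Oz; rewrite (le_lt_trans (ler_norm _))// ltrDl.
  rewrite enormZ gtr0_norm// (@le_lt_trans _ _ 1)// ?ltr1n//.
  by rewrite mulr_ile1 ?enorm_ge0 ?(ltW tgt)// (le_trans tt0).
apply: (@le_integrable _ _ _ mu _ measurableT _
  (fun z => B%:E * (EFin \o \1_(eball (0 : 'rV[R]_n.+1) A)) z)%E).
- apply/measurable_EFinP; apply: measurable_translate.
  exact: test_fun_measurable tu.
- move=> z _ /=; rewrite lee_fin normrM (ger0_norm B0).
  have [->|/(translate_neq0 tu)/OA zA] := eqVneq (translate u t z) 0.
    by rewrite normr0 mulr_ge0.
  by rewrite indicE mem_set// normr1 mulr1; exact: HB.
- apply: integrableZl => //; exact: integrable_eball.
Qed.

(** The direction at [z] is unknown, so all of them are summed, whence the factor [#|I|]. For a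
    fixed one, [h = z - t E k - x] satisfies [|h| < tau + t <= 2 t], and the dependence on the
    direction disappears. *)
Lemma integral_translate_le u t tau p x : 0 < t -> tau <= t -> measurable_fun setT u ->
  (\int[mu]_(z in eball x tau) (`|u x - translate u t z| `^ p)%:E <=
  #|I|%:R%:E * \int[mu]_h ((enorm h < 2 * t)%R%:R * `|u (x + h) - u x| `^ p)%:E)%E.
Proof.
move=> tgt taut mu'.
pose F (k : I) z : \bar R := (`|u x - u (z - t *: E k)| `^ p)%:E.
have mF k : measurable_fun setT (F k).
  apply/measurable_EFinP; apply: measurable_powR_fun; apply: measurableT_comp => //.
  by apply: measurable_funB => //; exact: measurable_shift.
have F0 k z : (0 <= F k z)%E by rewrite lee_fin powR_ge0.
apply: (@le_trans _ _ (\int[mu]_(z in eball x tau) \sum_(k : I) F k z)%E).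
  apply: ge0_le_integral_nomeas => z _; first by rewrite lee_fin powR_ge0.
  by rewrite (bigD1 (kappa z))//= /translate leeDl// sume_ge0.
rewrite ge0_integral_sum//; last 2 first.
- exact: measurable_eball.
- by move=> k; exact: measurable_funTS.
apply: (@le_trans _ _ (\sum_(k : I)
    \int[mu]_h ((enorm h < 2 * t)%R%:R * `|u (x + h)%R - u x| `^ p)%:E)%E); last first.
  by rewrite sumr_const mule_natl.
apply: lee_sum => k _.
pose f h : \bar R := ((enorm h < 2 * t)%R%:R * `|u (x + h)%R - u x| `^ p)%:E.
have mf : measurable_fun setT f.
  apply/measurable_EFinP; apply: measurable_funM.
    by apply: measurable_indic_lt => //; exact: measurable_enorm.
  apply: measurable_powR_fun; apply: measurableT_comp => //.
  apply: measurable_funB => //.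
  by apply: (measurableT_comp mu'); exact: measurable_rV_add.
have f0 h : (0 <= f h)%E by rewrite lee_fin mulr_ge0 ?powR_ge0.
rewrite -[leRHS](@ge0_integral_shift_rV R n.+1 (- (x + t *: E k)) f mf f0).
rewrite integral_mkcond; apply: ge0_le_integral_nomeas => z _.
  by rewrite patchE; case: ifPn.
rewrite patchE; case: ifPn => [|_]; last exact: f0.
rewrite inE /eball/= => zx.
have E2 : x + (z - (x + t *: E k)) = z - t *: E k.
  by rewrite addrCA opprD addNKr.
rewrite /f E2 /F distrC.
have -> : (enorm (z - (x + t *: E k)) < 2 * t)%R.
  rewrite opprD addrA (le_lt_trans (enormD _ _))// enormN enormZ gtr0_norm//.
  rewrite mulr2n mulrDl mul1r ltr_leD//; first exact: lt_le_trans taut.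
  by rewrite ler_piMr// ltW.
by rewrite mul1r.
Qed.

(** If [v x] is nonzero, the translate is nonzero within [tau] of [x]; a point of the closed support
    lies within [tau] of such an [x]. Altogether [2 tau = t / (1 + M)], which is the margin of the
    cone property. *)
Lemma mollified_translate (p C : R) u t v : (1 < p)%R -> 0 < t <= t0 ->
  test_fun Omega u -> smooth v ->
  (forall x a, ((`|a - v x| `^ p + (t / (2 * (1 + M))) `^ p * enorm (grad v x) `^ p)%R%:E <=
    C%:E * \int[mu]_(z in eball x (t / (2 * (1 + M)))) (`|a - translate u t z| `^ p)%:E)%E) ->
  test_fun Omega v.
Proof.
move=> p1 /andP[tgt tt0] tu sv Hv.
have p0 : 0 < p by exact: lt_trans p1.
set tau := t / (2 * (1 + M)) in Hv.
have tau0 : 0 < tau by rewrite divr_gt0// mulr_gt0.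
have V x : v x != 0 -> exists2 z, enorm (z - x) < tau & translate u t z != 0.
  move=> vx; apply: contrapT => H; move/negP: vx; apply.
  (* With [a = 0] the estimate forces [v x = 0] as soon as the translate vanishes on the ball. *)
  have := Hv x 0; rewrite integral0_eq; last first.
    move=> z xz; have [->|tz] := eqVneq (translate u t z) 0.
      by rewrite subrr normr0 powR0// gt_eqF.
    by exfalso; apply: H; exists z.
  rewrite mule0 lee_fin sub0r normrN => h.
  have : `|v x| `^ p <= 0.
    by rewrite (le_trans _ h)// lerDl mulr_ge0 ?powR_ge0.
  by rewrite le_eqVlt ltNge powR_ge0 orbF powR_eq0 normr_eq0 => /andP[].
have sO : tsupport v `<=` Omega.
  move=> y cy; have [x [/= vx xy]] := cy _ (near_eball y tau0).
  have [z zx tz] := V _ vx.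
  apply: (cone tgt tt0 (translate_neq0 tu tz)).
  have -> : t / (1 + M) = tau + tau by rewrite /tau; field; rewrite gt_eqF.
  by rewrite (le_trans (enorm_triangle x _ _))// lerD// ltW// enormBC.
split => //; apply: bounded_closed_compact; last exact: closed_closure.
have [b [rb Hb]] := bO; exists b; split => // c bc x /sO Ox; exact: Hb.
Qed.

Lemma K_functional_power_le (p C : R) u t : (1 < p)%R -> (0 < C)%R ->
  (forall tau : R, 0 < tau -> forall w : 'rV[R]_n.+1 -> R, mu.-integrable setT (EFin \o w) ->
    exists v, smooth v /\ forall x a,
    ((`|a - v x| `^ p + tau `^ p * enorm (grad v x) `^ p)%R%:E <=
    (C / tau ^+ n.+1)%R%:E * \int[mu]_(z in eball x tau) (`|a - w z| `^ p)%:E)%E) ->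
  0 < t <= t0 -> test_fun Omega u ->
  (K_functional Omega p u t `^ p <=
    (2 `^ (p - 1) * (1 + (2 * (1 + M)) `^ p) * (C * (2 * (1 + M)) ^+ n.+1 * #|I|%:R) /
      t ^+ n.+1)%:E *
    \int[mu]_h ((enorm h < 2 * t)%R%:R%:E * \int[mu]_x (`|u (x + h)%R - u x| `^ p)%:E))%E.
Proof.
move=> p1 C0 moll t0t tu; have /andP[tgt tt0] := t0t.
have p0 : 0 < p by exact: lt_trans p1.
have pn0 : p != 0 by rewrite gt_eqF.
set k := 2 * (1 + M); have k0 : 0 < k by rewrite mulr_gt0.
have k1 : 1 <= k by move: M0; rewrite /k; lra.
pose tau := t / k; have tau0 : 0 < tau by rewrite divr_gt0.
have tau_t : tau <= t by rewrite ler_pdivrMr// ler_peMr// ltW.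
have [v [sv Hv]] := moll _ tau0 _ (integrable_translate t0t tu).
have tv : test_fun Omega v by exact: mollified_translate Hv.
have mu' := test_fun_measurable tu.
have mv := test_fun_measurable tv.
have mgv := test_fun_grad_measurable tv.
pose g (z : 'rV[R]_n.+1 * 'rV[R]_n.+1) : \bar R :=
  ((enorm z.2 < 2 * t)%R%:R * `|u (z.1 + z.2) - u z.1| `^ p)%:E.
have mg : measurable_fun setT g.
  apply/measurable_EFinP; apply: measurable_funM.
    apply: measurable_indic_lt => //.
    exact: (measurableT_comp (@measurable_enorm R n.+1)).
  apply: measurable_powR_fun; apply: measurableT_comp => //.
  apply: measurable_funB; last exact: (measurableT_comp mu').
  by apply: (measurableT_comp mu'); exact: measurable_rV_add.
have g0 z : (0 <= g z)%E by rewrite lee_fin mulr_ge0 ?powR_ge0.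
pose J x := (\int[mu]_h g (x, h))%E.
have J0 x : (0 <= J x)%E by apply: integral_ge0 => h _.
have mJ : measurable_fun setT J.
  exact: (@measurable_fun_fubini_tonelli_F _ _ _ _ _ mu g mg g0).
have JE : (\int[mu]_x J x = \int[mu]_h ((enorm h < 2 * t)%R%:R%:E *
    \int[mu]_x (`|u (x + h)%R - u x| `^ p)%:E))%E.
  apply: (etrans (@fubini_tonelli _ _ _ _ _ mu mu g mg g0)).
  apply: eq_integral => h _; rewrite /fubini_G /g/=.
  rewrite -ge0_integralZl//.
  apply/measurable_EFinP; apply: measurable_powR_fun; apply: measurableT_comp => //.
  apply: measurable_funB => //.
  by apply: (measurableT_comp mu'); exact: measurable_rV_add.
pose c1 : R := C / tau ^+ n.+1 * #|I|%:R.
have c10 : 0 <= c1 by rewrite mulr_ge0// divr_ge0 ?ltW// exprn_gt0.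
(* The estimate is used with [a = u x], the value of the untranslated function. *)
have H x : ((`|u x - v x| `^ p + tau `^ p * enorm (grad v x) `^ p)%R%:E <= c1%:E * J x)%E.
  apply: le_trans (Hv x (u x)) _; rewrite /c1 (EFinM (C / _)) -muleA lee_wpmul2l//.
    by rewrite lee_fin divr_ge0 ?ltW// exprn_gt0.
  exact: integral_translate_le.
have cJ : (\int[mu]_x (c1%:E * J x) = c1%:E * \int[mu]_x J x)%E.
  by rewrite ge0_integralZl.
set IJ := (\int[mu]_x J x)%E in cJ JE.
have IJ0 : (0 <= IJ)%E by apply: integral_ge0 => x _.
have HA : (Lp_norm Omega p (u \- v)%R `^ p <= c1%:E * IJ)%E.
  rewrite Lp_norm_powerE//; last first.
    move=> x nx; rewrite /= (tsupport_eq0 (test_fun_out tu nx)).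
    by rewrite (tsupport_eq0 (test_fun_out tv nx)) subrr.
  rewrite -cJ; apply: ge0_le_integral_nomeas => x _; first by rewrite lee_fin powR_ge0.
  apply: le_trans (H x); rewrite lee_fin lerDl mulr_ge0 ?powR_ge0//.
have HB : ((tau `^ p)%:E * Lp_grad Omega p v `^ p <= c1%:E * IJ)%E.
  rewrite Lp_grad_test// -ge0_integralZl//; last 3 first.
  - by apply/measurable_EFinP; exact: measurable_powR_fun.
  - by move=> x _; rewrite lee_fin powR_ge0.
  - by rewrite lee_fin powR_ge0.
  rewrite -cJ; apply: ge0_le_integral_nomeas => x _.
    by rewrite mule_ge0 ?lee_fin ?powR_ge0.
  apply: le_trans (H x); rewrite -EFinM lee_fin lerDr powR_ge0//.
set a := Lp_norm Omega p (u \- v)%R in HA; set b := Lp_grad Omega p v in HB.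
have a0 : (0 <= a)%E by exact: Lp_norm_ge0.
have b0 : (0 <= b)%E by exact: Lp_norm_ge0.
have Kle : (K_functional Omega p u t <= a + t%:E * b)%E.
  by apply: ereal_inf_lbound; exists v.
have K0 : (0 <= K_functional Omega p u t)%E.
  apply: le_ereal_inf_tmp => _ [v' _ <-].
  by rewrite adde_ge0 ?mule_ge0 ?Lp_norm_ge0 ?lee_fin ?(ltW tgt).
rewrite -JE; apply: le_trans (le_poweR (ltW p0) K0 Kle) _.
apply: le_trans (poweRD_le p1 a0 (mule_ge0 (ltW (tgt : (0 < t%:E)%E)) b0)) _.
rewrite poweRM ?lee_fin ?(ltW tgt)// poweR_EFin.
have -> : t `^ p = k `^ p * tau `^ p.
  by rewrite -powRM ?(ltW k0) ?(ltW tau0)// /tau mulrC divfK ?gt_eqF.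
rewrite EFinM -(muleA (k `^ p)%:E).
apply: (@le_trans _ _ ((2 `^ (p - 1))%:E * (c1%:E * IJ + (k `^ p)%:E * (c1%:E * IJ)))%E).
  rewrite lee_wpmul2l ?lee_fin ?powR_ge0// leeD// lee_wpmul2l ?lee_fin ?powR_ge0//.
have E2 : (c1%:E * IJ + (k `^ p)%:E * (c1%:E * IJ) = ((1 + k `^ p) * c1)%:E * IJ)%E.
  rewrite (EFinM (1 + _)) -[RHS]muleA EFinD ge0_muleDl ?lee_fin ?powR_ge0//.
  by rewrite mul1e.
rewrite E2 muleA -EFinM.
rewrite le_eqVlt; apply/orP; left; apply/eqP; congr (_%:E * _)%E.
have tn0 : 0 < t ^+ n.+1 by exact: exprn_gt0.
have kn0 : 0 < k ^+ n.+1 by exact: exprn_gt0.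
rewrite /c1 /tau expr_div_n.
by field; rewrite !gt_eqF.
Qed.

End piecewise_translation.

(** * Comparison of the interpolation and Gagliardo norms *)

Section X_norm_upper_bound.
Context {R : realType}.
Local Open Scope ereal_scope.
Local Notation leb := (@lebesgue_measure R).

(** Tonelli: for fixed [h] the variable [t] runs over [t > |h| / 2]. At [h = 0] the integral in [t]
    would diverge, and [g 0 = 0] makes both sides vanish there. *)
Lemma integral_truncated_difference n (sigma : R) (g : 'rV[R]_n -> \bar R) :
  (0 < sigma)%R -> measurable_fun setT g -> (forall h, 0 <= g h) -> g 0%R = 0 ->
  \int[leb]_t \int[lebesgue_rV n]_h
    (((enorm h < 2 * t)%R%:R * t `^ (- sigma - 1))%:E * g h) =
  (2 `^ sigma / sigma)%:E * \int[lebesgue_rV n]_h ((enorm h `^ (- sigma))%:E * g h).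
Proof.
move=> s0 mg g0 g00.
pose f (z : 'rV[R]_n * measurableTypeR R) : \bar R :=
  ((enorm z.1 < 2 * z.2)%R%:R * z.2 `^ (- sigma - 1))%:E * g z.1.
have mf : measurable_fun setT f.
  apply: emeasurable_funM; last exact: measurableT_comp.
  apply/measurable_EFinP; apply: measurable_funM.
    apply: measurable_indic_lt => //.
    - exact: (measurableT_comp (@measurable_enorm R n)).
    - by apply: measurable_funM => //; exact: measurable_snd.
  by apply: measurable_powR_fun; exact: measurable_snd.
have f0 z : 0 <= f z by rewrite mule_ge0// lee_fin mulr_ge0 ?powR_ge0.
have -> : \int[leb]_t \int[lebesgue_rV n]_h
    (((enorm h < 2 * t)%R%:R * t `^ (- sigma - 1))%:E * g h) =
    \int[leb]_t \int[lebesgue_rV n]_h f (h, t) by [].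
rewrite -tonelli_rV_real//.
have mh : measurable_fun setT (fun h : 'rV[R]_n => (enorm h `^ (- sigma))%:E * g h).
  apply: emeasurable_funM => //; apply/measurable_EFinP.
  by apply: measurable_powR_fun; exact: measurable_enorm.
have h0 h : setT h -> 0 <= (enorm h `^ (- sigma))%:E * g h.
  by move=> _; rewrite mule_ge0// lee_fin powR_ge0.
have c0 : 0 <= (2 `^ sigma / sigma)%:E :> \bar R.
  by rewrite lee_fin divr_ge0 ?powR_ge0 ?ltW.
have <- := ge0_integralZl (lebesgue_rV n) measurableT mh h0 c0.
apply: eq_integral => h _; rewrite /f/=.
have [->|hn0] := eqVneq h 0%R.
  by rewrite g00 !mule0; apply: integral0_eq => t _; rewrite mule0.
have eh : (0 < enorm h)%R by rewrite lt_neqAle enorm_ge0 andbT eq_sym enorm_eq0.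
have eh2 : (0 < enorm h / 2)%R by rewrite divr_gt0.
have mt : measurable_fun setT (fun t : measurableTypeR R =>
    ((enorm h < 2 * t)%R%:R * t `^ (- sigma - 1))%:E).
  apply/measurable_EFinP; apply: measurable_funM.
    by apply: measurable_indic_lt => //; apply: measurable_funM.
  exact: measurable_powR_fun.
rewrite ge0_integralZr//; last by move=> t _; rewrite lee_fin mulr_ge0 ?powR_ge0.
rewrite muleA; congr (_ * _).
transitivity (\int[leb]_(t in `](enorm h / 2)%R, +oo[) (t `^ (- sigma - 1))%:E).
  rewrite [RHS]integral_mkcond; apply: eq_integral => t _.
  rewrite patchE mem_setE in_itv/= andbT ltr_pdivrMr// mulrC (mulrC t).
  by case: ifPn => ht; rewrite ?mulr1// mulr0.
rewrite integral_itv_obnd_cbnd; last first.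
  by apply: measurable_funTS; apply/measurable_EFinP; exact: measurable_powR.
rewrite integral_powR_tail// -EFinM; congr EFin.
have h2 : (0 <= 2^-1 :> R)%R by rewrite invr_ge0.
rewrite (powRM _ (ltW eh) h2) (powRV _ (_ : 0 < 2)%R)// (powRN 2) invrK.
by rewrite -mulrA mulrC.
Qed.

Lemma test_fun0 n (Omega : set 'rV[R]_n) : test_fun Omega (cst 0%R).
Proof.
apply: (@test_funI _ _ _ _ set0) => //; last exact: compact0.
move=> k; elim: k => [|k IH]; (split; first exact: cst_continuous) => //.
move=> i; split; first by move=> x; exact: derivable_cst.
by rewrite (_ : partial i _ = cst 0%R)//; apply/funext => x; exact: derive_cst.
Qed.

Lemma K_functional_ge0 n (Omega : set 'rV[R]_n) (p t : R) u : (0 <= t)%R ->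
  0 <= K_functional Omega p u t.
Proof.
move=> t0; apply: le_ereal_inf_tmp => _ [v _ <-].
by rewrite adde_ge0 ?mule_ge0 ?Lp_norm_ge0 ?lee_fin.
Qed.

Lemma K_functional_le_Lp n (Omega : set 'rV[R]_n) (p t : R) u : (0 < p)%R -> (0 <= t)%R ->
  K_functional Omega p u t <= Lp_norm Omega p u.
Proof.
move=> p0 t0; have pn0 : p != 0%R by rewrite gt_eqF.
apply: ereal_inf_lbound; exists (cst 0%R); first exact: test_fun0.
have -> : (u \- cst 0 = u)%R by apply/funext => x /=; rewrite subr0.
have : Lp_grad Omega p (cst 0%R) `^ p = 0.
  rewrite Lp_grad_test//; last exact: test_fun0.
  apply: integral0_eq => x _.
  have -> : grad (cst (0%R : R)) x = 0%R :> 'rV[R]_n.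
    by apply/rowP => i; rewrite !mxE /partial derive_cst.
  by rewrite enorm0 powR0.
move=> /poweR_eq0_eq0 ->; first by rewrite mule0 adde0.
exact: Lp_norm_ge0.
Qed.

(** For [|h| >= d], wherever [u x] is nonzero [u (x + h)] vanishes, so the difference dominates
    [|u x|] pointwise. *)
Lemma Lp_le_gagliardo n (Omega : set 'rV[R]_n) (s p d : R) u : (0 < p)%R -> (0 < s)%R ->
  (0 < d)%R -> (forall x y, Omega x -> Omega y -> (enorm (x - y) < d)%R) ->
  test_fun Omega u ->
  (n%:R / (s * p) * d `^ (- (s * p)))%:E * @omega_ball R n *
    \int[lebesgue_rV n]_x (`|u x| `^ p)%:E <= gagliardo s p u `^ p.
Proof.
move=> p0 s0 d0 dO tu; have sp0 : (0 < s * p)%R by rewrite mulr_gt0.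
have mu' := test_fun_measurable tu.
rewrite (gagliardo_powerE s p0 mu') -integral_power_outside_ball//.
set U := \int[lebesgue_rV n]_x (`|u x| `^ p)%:E.
have U0 : 0 <= U by apply: integral_ge0 => x _; rewrite lee_fin powR_ge0.
have mf : measurable_fun setT (fun x : 'rV[R]_n =>
    ((d <= enorm x)%R%:R * enorm x `^ (- (n%:R + s * p)))%:E).
  apply/measurable_EFinP; apply: measurable_funM.
    by apply: measurable_indic_le => //; exact: measurable_enorm.
  by apply: measurable_powR_fun; exact: measurable_enorm.
have f0 (x : 'rV[R]_n) : setT x ->
    0 <= ((d <= enorm x)%R%:R * enorm x `^ (- (n%:R + s * p)))%:E.
  by move=> _; rewrite lee_fin mulr_ge0 ?powR_ge0.
have <- := ge0_integralZr (lebesgue_rV n) measurableT mf f0 U0.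
apply: ge0_le_integral_nomeas => h _.
  rewrite mule_ge0 ?lee_fin ?mulr_ge0 ?powR_ge0//.
case: (leP d (enorm h)) => dh; last first.
  rewrite mul0r mul0e; apply: mule_ge0; first by rewrite lee_fin powR_ge0.
  by apply: integral_ge0 => x _; rewrite lee_fin powR_ge0.
rewrite mul1r; apply: lee_wpmul2l; first by rewrite lee_fin powR_ge0.
apply: ge0_le_integral_nomeas => x _; rewrite lee_fin ?powR_ge0//.
have [->|ux] := eqVneq (u x) 0%R; first by rewrite normr0 powR0 ?powR_ge0// gt_eqF.
have Ox : Omega x.
  by apply: contrapT => nO; rewrite (tsupport_eq0 (test_fun_out tu nO)) eqxx in ux.
have nOxh : ~ Omega (x + h)%R.
  by move=> /(dO _ _)/(_ Ox); rewrite addrAC subrr add0r ltNge dh.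
by rewrite (tsupport_eq0 (test_fun_out tu nOxh)) sub0r normrN.
Qed.

Lemma X_norm_powerE n (Omega : set 'rV[R]_n) (s p : R) u : (0 < p)%R ->
  X_norm Omega s p u `^ p =
  \int[leb]_(t in `]0%R, +oo[) ((t `^ (- (s * p) - 1))%:E * K_functional Omega p u t `^ p).
Proof.
move=> p0; rewrite /X_norm -poweRrM mulVf ?gt_eqF// poweRe1; last first.
  by apply: integral_ge0 => t /=; rewrite in_itv/= andbT => t0;
     rewrite mule_ge0 ?poweR_ge0// lee_fin invr_ge0 ltW.
apply: eq_integral => t; rewrite inE/= in_itv/= andbT => t0.
have ts0 : (0 < t `^ s)%R by exact: powR_gt0.
rewrite poweRM ?K_functional_ge0 ?lee_fin ?invr_ge0 ?ltW// poweR_EFin.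
rewrite muleAC -EFinM; congr (_%:E * _).
rewrite powRV// -powRrM -powRN -(powR_inv1 (ltW t0)) -powRD//.
by rewrite (gt_eqF t0) implybT.
Qed.

End X_norm_upper_bound.

Section X_norm_upper_bound_cone.
Context {R : realType}.
Local Open Scope ereal_scope.
Local Notation leb := (@lebesgue_measure R).

(** The integral in [t] is cut at [t0]: [A] dominates the part below and [B], from the choice
    [v = 0], the part above. The final constant is free of [s], which is why the powers are bounded
    at the end. *)
Lemma X_norm_le n (Omega : set 'rV[R]_n.+1) (s p C t0 d W : R) u :
  (1 < p)%R -> (0 < s < 1)%R -> (0 < t0)%R -> (t0 <= d)%R -> (0 <= C)%R ->
  (0 < W)%R -> @omega_ball R n.+1 = W%:E ->
  (forall x y, Omega x -> Omega y -> (enorm (x - y) < d)%R) ->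
  test_fun Omega u ->
  (forall t, (0 < t <= t0)%R -> K_functional Omega p u t `^ p <= (C / t ^+ n.+1)%:E *
    \int[lebesgue_rV n.+1]_h ((enorm h < 2 * t)%R%:R%:E *
       \int[lebesgue_rV n.+1]_x (`|u (x + h)%R - u x| `^ p)%:E)) ->
  X_norm Omega s p u `^ p <=
  (C * 2 `^ (n.+1%:R + p) / n.+1%:R + (d / t0) `^ p / (n.+1%:R * W))%:E *
    gagliardo s p u `^ p.
Proof.
move=> p1 /andP[s0 s1] t00 t0d C0 W0 WE dO tu HK.
have p0 : (0 < p)%R by exact: lt_trans p1.
have d0 : (0 < d)%R by exact: lt_le_trans t0d.
have sp0 : (0 < s * p)%R by rewrite mulr_gt0.
have mu' := test_fun_measurable tu.
pose N : R := n.+1%:R; have N0 : (0 < N)%R by rewrite ltr0n.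
pose sigma := (N + s * p)%R; have sg0 : (0 < sigma)%R by rewrite addr_gt0.
pose g h := \int[lebesgue_rV n.+1]_x (`|u (x + h)%R - u x| `^ p)%:E.
have g0 h : 0 <= g h by apply: integral_ge0 => x _; rewrite lee_fin powR_ge0.
have g00 : g 0%R = 0.
  apply: integral0_eq => x _.
  by rewrite addr0 subrr normr0 powR0// gt_eqF.
pose G (z : 'rV[R]_n.+1 * 'rV[R]_n.+1) : \bar R := (`|u (z.1 + z.2)%R - u z.1| `^ p)%:E.
have mG : measurable_fun setT G.
  apply/measurable_EFinP; apply: measurable_powR_fun; apply: measurableT_comp => //.
  apply: measurable_funB; last exact: (measurableT_comp mu').
  by apply: (measurableT_comp mu'); exact: measurable_rV_add.
have mg : measurable_fun setT g.
  apply: (@measurable_fun_fubini_tonelli_G _ _ _ _ _ (lebesgue_rV n.+1) G mG).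
  by move=> z; rewrite lee_fin powR_ge0.
set U := \int[lebesgue_rV n.+1]_x (`|u x| `^ p)%:E.
have U0 : 0 <= U by apply: integral_ge0 => x _; rewrite lee_fin powR_ge0.
pose A (t : R) := C%:E * \int[lebesgue_rV n.+1]_h
    (((enorm h < 2 * t)%R%:R * t `^ (- sigma - 1))%:E * g h).
pose B (t : R) := ((t0 <= t)%R%:R * t `^ (- (s * p) - 1))%:E * U.
have A0 t : 0 <= A t.
  rewrite mule_ge0 ?lee_fin//; apply: integral_ge0 => h _.
  by apply: mule_ge0 (g0 h); rewrite lee_fin mulr_ge0 ?powR_ge0.
have B0 t : 0 <= B t by rewrite mule_ge0 ?lee_fin ?mulr_ge0 ?powR_ge0.
have mAi : measurable_fun setT (fun t : measurableTypeR R => \int[lebesgue_rV n.+1]_h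
    (((enorm h < 2 * t)%R%:R * t `^ (- sigma - 1))%:E * g h)).
  pose f (z : 'rV[R]_n.+1 * measurableTypeR R) : \bar R :=
    ((enorm z.1 < 2 * z.2)%R%:R * z.2 `^ (- sigma - 1))%:E * g z.1.
  apply: (@measurable_fun_fubini_tonelli_G _ _ _ _ _ (lebesgue_rV n.+1) f).
    apply: emeasurable_funM; last exact: measurableT_comp.
    apply/measurable_EFinP; apply: measurable_funM.
      apply: measurable_indic_lt => //.
      - exact: (measurableT_comp (@measurable_enorm R n.+1)).
      - by apply: measurable_funM => //; exact: measurable_snd.
    by apply: measurable_powR_fun; exact: measurable_snd.
  by move=> z; apply: mule_ge0 (g0 z.1); rewrite lee_fin mulr_ge0 ?powR_ge0.
have mA : measurable_fun setT (A : measurableTypeR R -> \bar R).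
  exact: measurable_funeM.
have mBr : measurable_fun setT (fun t : measurableTypeR R =>
    ((t0 <= t)%R%:R * t `^ (- (s * p) - 1))%:E).
  apply/measurable_EFinP; apply: measurable_funM.
    exact: measurable_indic_le.
  exact: measurable_powR_fun.
have mB : measurable_fun setT (B : measurableTypeR R -> \bar R).
  by apply: emeasurable_funM; [exact: mBr|exact: measurable_cst].
rewrite X_norm_powerE//.
apply: (@le_trans _ _ (\int[leb]_t (A t + B t))).
  rewrite integral_mkcond; apply: ge0_le_integral_nomeas => t _.
    rewrite patchE; case: ifPn => // _.
    by rewrite mule_ge0 ?poweR_ge0 ?lee_fin ?powR_ge0.
  rewrite patchE mem_setE in_itv/= andbT; case: ifPn => t0'; last first.
    by rewrite adde_ge0.
  have tn0 : (0 < t ^+ n.+1)%R by exact: exprn_gt0.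
  case: (leP t0 t) => t0t; last first.
    apply: (@le_trans _ _ (A t)); last by rewrite leeDl.
    apply: (@le_trans _ _ ((t `^ (- (s * p) - 1))%:E * ((C / t ^+ n.+1)%:E *
      \int[lebesgue_rV n.+1]_h ((enorm h < 2 * t)%R%:R%:E * g h)))).
      rewrite lee_wpmul2l ?lee_fin ?powR_ge0//; apply: HK.
      by rewrite t0' ltW.
    rewrite muleA -EFinM.
    have -> : (t `^ (- (s * p) - 1) * (C / t ^+ n.+1) = C * t `^ (- sigma - 1))%R.
      rewrite mulrCA; congr (_ * _)%R; rewrite -(powR_mulrn _ (ltW t0')) -powRN -powRD.
        by congr (_ `^ _)%R; rewrite /sigma /N; ring.
      by rewrite (gt_eqF t0') implybT.
    rewrite EFinM -muleA lee_wpmul2l ?lee_fin//.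
    have mi : measurable_fun setT (fun h : 'rV[R]_n.+1 => (enorm h < 2 * t)%R%:R%:E * g h).
      apply: emeasurable_funM => //; apply/measurable_EFinP.
      by apply: measurable_indic_lt => //; exact: measurable_enorm.
    have i0 (h : 'rV[R]_n.+1) : setT h -> 0 <= (enorm h < 2 * t)%R%:R%:E * g h.
      by move=> _; apply: mule_ge0 (g0 h); rewrite lee_fin.
    have c0 : 0 <= (t `^ (- sigma - 1))%:E by rewrite lee_fin powR_ge0.
    have <- := ge0_integralZl (lebesgue_rV n.+1) measurableT mi i0 c0.
    rewrite le_eqVlt; apply/orP; left; apply/eqP; apply: eq_integral => h _.
    by rewrite muleA -EFinM mulrC.
  apply: (@le_trans _ _ (B t)); last by rewrite leeDr.
  rewrite /B t0t mul1r lee_wpmul2l ?lee_fin ?powR_ge0//.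
  rewrite /U -(Lp_norm_test _ tu) ?gt_eqF//.
  apply: le_poweR; first exact: ltW.
    by apply: K_functional_ge0; exact: ltW.
  by apply: K_functional_le_Lp => //; exact: ltW.
have -> := ge0_integralD leb measurableT (fun t _ => A0 t) mA (fun t _ => B0 t) mB.
rewrite EFinD ge0_muleDl; last 2 first.
- by rewrite lee_fin !mulr_ge0 ?powR_ge0 ?invr_ge0.
- by rewrite lee_fin !mulr_ge0 ?powR_ge0 ?invr_ge0 ?mulr_ge0 ?(ltW W0).
have gag0 : 0 <= gagliardo s p u `^ p by exact: poweR_ge0.
apply: leeD.
  have Ai0 (t : measurableTypeR R) : setT t -> 0 <= \int[lebesgue_rV n.+1]_h
      (((enorm h < 2 * t)%R%:R * t `^ (- sigma - 1))%:E * g h).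
    move=> _; apply: integral_ge0 => h _.
    by apply: mule_ge0 (g0 h); rewrite lee_fin mulr_ge0 ?powR_ge0.
  have -> := ge0_integralZl leb measurableT mAi Ai0 (C0 : 0 <= C%:E).
  rewrite (integral_truncated_difference sg0 mg g0 g00).
  rewrite -(gagliardo_powerE s p0 mu') muleA -EFinM lee_wpmul2r// lee_fin -!mulrA.
  rewrite ler_wpM2l//.
  (* Removes [s] from [2^sigma / sigma], using [N <= sigma <= N + p]. *)
  have sgN : (N <= sigma)%R by rewrite lerDl ltW.
  apply: (@le_trans _ _ (2 `^ (N + p) / sigma)%R).
    rewrite ler_wpM2r ?invr_ge0 ?(ltW sg0)//.
    apply: (@ler_powR R 2); first by rewrite ler1n.
    by rewrite /sigma lerD2l ger_pMl// ltW.
  by rewrite ler_wpM2l ?powR_ge0// lef_pV2// posrE.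
have Bi0 (t : measurableTypeR R) : setT t ->
    0 <= ((t0 <= t)%R%:R * t `^ (- (s * p) - 1))%:E.
  by move=> _; rewrite lee_fin mulr_ge0 ?powR_ge0.
have -> := ge0_integralZr leb measurableT mBr Bi0 U0.
have -> : \int[leb]_t ((t0 <= t)%R%:R * t `^ (- (s * p) - 1))%:E =
    (t0 `^ (- (s * p)) / (s * p))%:E.
  rewrite -integral_powR_tail// [RHS]integral_mkcond; apply: eq_integral => t _.
  by rewrite patchE mem_setE in_itv/= andbT; case: ifPn => ht; rewrite ?mul1r ?mul0r.
have := Lp_le_gagliardo p0 s0 d0 dO tu; rewrite -/U WE -EFinM => HU.
pose q := (t0 `^ (- (s * p)) / (s * p))%R.
pose r := (n.+1%:R / (s * p) * d `^ (- (s * p)) * W)%R.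
have r0 : (0 < r)%R by rewrite !mulr_gt0 ?powR_gt0 ?invr_gt0.
have -> : q%:E * U = (q / r)%:E * (r%:E * U).
  by rewrite muleA -EFinM divfK ?gt_eqF.
apply: le_trans (lee_wpmul2l _ HU) _.
  by rewrite lee_fin !mulr_ge0 ?powR_ge0 ?invr_ge0 ?(ltW r0) ?(ltW sp0).
rewrite lee_wpmul2r// lee_fin.
(* The singular factor [1 / (s p)] of the tail integral cancels that of [Lp_le_gagliardo]; what
   remains is bounded by its value at [s = 1], as [d / t0 >= 1]. *)
have -> : (q / r = (d / t0) `^ (s * p) / (N * W))%R.
  have t0V : (0 <= t0^-1)%R by rewrite invr_ge0 ltW.
  rewrite /q /r -/N (powRM _ (ltW d0) t0V) powRV// !powRN.
  have dp : (0 < d `^ (s * p))%R by exact: powR_gt0.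
  have tp : (0 < t0 `^ (s * p))%R by exact: powR_gt0.
  move: dp tp sp0; move: (d `^ (s * p))%R (t0 `^ (s * p))%R (s * p)%R => a b c a0 b0 c0.
  by field; rewrite !gt_eqF.
rewrite ler_wpM2r ?invr_ge0 ?mulr_ge0 ?(ltW W0)//.
have := @ler_powR R (d / t0)%R; apply; first by rewrite ler_pdivlMr// mul1r.
by rewrite ger_pMl// ltW.
Qed.

End X_norm_upper_bound_cone.

(** * Lower bound for the interpolation norm *)

Section X_norm_lower_bound.
Context {R : realType} {n : nat}.
Implicit Types (u v : 'rV[R]_n -> R) (Omega : set 'rV[R]_n) (s p t G : R).
Local Open Scope ereal_scope.
Local Notation mu := (@lebesgue_rV R n).
Local Notation leb := (@lebesgue_measure R).

Lemma ge0_le_integral_subset (D E : set R) (f g : R -> \bar R) : D `<=` E ->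
  (forall x, D x -> 0 <= f x) -> (forall x, D x -> f x <= g x) ->
  (forall x, E x -> 0 <= g x) ->
  \int[leb]_(x in D) f x <= \int[leb]_(x in E) g x.
Proof.
move=> DE f0 fg g0; rewrite integral_mkcond [leRHS]integral_mkcond.
apply: ge0_le_integral_nomeas => x _; rewrite !patchE.
  by case: ifPn => //; rewrite inE => /f0.
case: ifPn => [|_]; first by rewrite inE => Dx; rewrite mem_set ?fg//; exact: DE.
by case: ifPn => //; rewrite inE => /g0.
Qed.

Lemma test_fun_scale Omega u (c : R) : test_fun Omega u ->
  test_fun Omega (fun y => c * u (1 *: y + 0))%R.
Proof.
move=> [su cu uO]; apply: (test_funI (A := tsupport u)) => //.
  by move=> k; exact: Ck_affine.
by move=> x /tsupport_eq0; rewrite scale1r addr0 => ->; rewrite mulr0.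
Qed.

Lemma integral_test_fun_lty Omega u p : (0 < p)%R -> test_fun Omega u ->
  \int[mu]_x (`|u x| `^ p)%:E < +oo.
Proof.
move=> p0 tu; have [B B0 HB] := test_fun_bounded tu.
have [_ cu _] := tu; have [b [_ Hb]] := compact_bounded cu.
pose A := (n%:R * (`|b| + 1) + 1)%R.
have A0 : (0 < A)%R by rewrite ltr_wpDl// mulr_ge0// addr_ge0.
have uA x : ~ eball 0%R A x -> u x = 0%R.
  move=> nA; apply: tsupport_eq0 => ux; apply: nA; rewrite /eball/= subr0.
  rewrite /A ltr_pwDr// (le_trans (enorm_le_norm _))// ler_wpM2l//.
  by apply: Hb ux; rewrite (le_lt_trans (ler_norm _))// ltrDl.
apply: (@le_lt_trans _ _ (\int[mu]_(x in eball 0%R A) (cst (B `^ p)%:E x))).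
  rewrite [leRHS]integral_mkcond; apply: ge0_le_integral_nomeas => x _.
    by rewrite lee_fin powR_ge0.
  rewrite patchE; case: ifPn => [_|]; first by rewrite lee_fin ge0_ler_powR// ltW.
  by rewrite notin_setE => /uA ->; rewrite normr0 powR0// gt_eqF.
rewrite integral_cst//=; last exact: measurable_eball.
have /andP[_ w1] := @omega_ball_gt0_lty R n.
have E := @eball_scale R n 0%R A A0.
rewrite [X in _ * X]E muleA -EFinM lte_mul_pinfty// lee_fin mulr_ge0 ?powR_ge0//.
by rewrite exprn_ge0// ltW.
Qed.

Lemma poweRK p (x : \bar R) : (p != 0)%R -> 0 <= x -> (x `^ p) `^ p^-1 = x.
Proof. by move=> p0 x0; rewrite -poweRrM mulfV// poweRe1. Qed.

Lemma le_poweR_inv p (x y : \bar R) : (0 < p)%R -> 0 <= x -> 0 <= y ->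
  x `^ p <= y `^ p -> x <= y.
Proof.
move=> p0 x0 y0 xy; have pn0 : p != 0%R by rewrite gt_eqF.
rewrite -(poweRK pn0 x0) -(poweRK pn0 y0) le_poweR ?poweR_ge0//.
by rewrite invr_ge0 ltW.
Qed.

(** [G] is a real substitute for the [p]-th root of [lambda1], which may be infinite. Homogeneity
    reduces to norm [1]: the norm of [v] is finite, and if it is [0] the claim is trivial. *)
Lemma poincare_test Omega p G v : (0 < p)%R -> (0 < G)%R ->
  (G `^ p)%:E <= lambda1 p Omega -> test_fun Omega v ->
  G%:E * Lp_norm Omega p v <= Lp_grad Omega p v.
Proof.
move=> p0 G0 Gl tv; have pn0 : p != 0%R by rewrite gt_eqF.
have a0 := Lp_norm_ge0 Omega p v; have b0 : 0 <= Lp_grad Omega p v := Lp_norm_ge0 _ _ _.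
apply: (le_poweR_inv p0) => //; first by rewrite mule_ge0 ?lee_fin ?(ltW G0).
rewrite poweRM ?lee_fin ?(ltW G0)// poweR_EFin.
have fin := integral_test_fun_lty p0 tv.
rewrite (Lp_norm_test pn0 tv).
set A := \int[mu]_x _ in fin *.
have A0 : 0 <= A by apply: integral_ge0 => x _; rewrite lee_fin powR_ge0.
have [a AE] : exists a, A = a%:E by exists (fine A); rewrite fineK// ge0_fin_numE.
rewrite AE; have : (0 <= a)%R by rewrite -lee_fin -AE.
rewrite le_eqVlt => /predU1P[<-|agt]; first by rewrite mule0 poweR_ge0.
pose c := (a `^ (- p^-1))%R; have c0 : (0 < c)%R by exact: powR_gt0.
have cp : (c `^ p = a^-1)%R.
  by rewrite /c -powRrM mulNr mulVf// powR_inv1// ltW.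
pose w y := (c * v (1 *: y + 0))%R.
have tw : test_fun Omega w by exact: test_fun_scale.
have mv := test_fun_measurable tv; have mgv := test_fun_grad_measurable tv.
have w1 : Lp_norm Omega p w = 1.
  rewrite -(poweRK pn0 (Lp_norm_ge0 _ _ _)) (Lp_norm_test pn0 tw).
  have -> : \int[mu]_x (`|w x| `^ p)%:E = \int[mu]_x ((c `^ p)%:E * (`|v x| `^ p)%:E).
    apply: eq_integral => x _; rewrite /w scale1r addr0 normrM (gtr0_norm c0).
    by rewrite powRM ?(ltW c0)// EFinM.
  have mf : measurable_fun setT (fun x => (`|v x| `^ p)%:E).
    by apply/measurable_EFinP; apply: measurable_powR_fun; exact: measurableT_comp.
  have f0 x : setT x -> 0 <= (`|v x| `^ p)%:E by rewrite lee_fin powR_ge0.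
  have cp0 : 0 <= (c `^ p)%:E by rewrite lee_fin powR_ge0.
  have -> := ge0_integralZl mu measurableT mf f0 cp0.
  by rewrite -/A AE -EFinM cp mulVf ?gt_eqF// poweR1r.
have [sv _ _] := tv.
have gw x : grad w x = c *: grad v x.
  apply/rowP => i; rewrite !mxE.
  have := @partial_affine R n v c 1 0 i x (smooth_Ck1 sv).
  by rewrite mul1r scale1r addr0.
have wv : \int[mu]_x (enorm (grad w x) `^ p)%:E =
    \int[mu]_x ((c `^ p)%:E * (enorm (grad v x) `^ p)%:E).
  apply: eq_integral => x _.
  by rewrite gw enormZ (gtr0_norm c0) (powRM _ (ltW c0) (enorm_ge0 _)) EFinM.
have mf : measurable_fun setT (fun x => (enorm (grad v x) `^ p)%:E).
  by apply/measurable_EFinP; exact: measurable_powR_fun.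
have f0 x : setT x -> 0 <= (enorm (grad v x) `^ p)%:E by rewrite lee_fin powR_ge0.
have cp0 : 0 <= (c `^ p)%:E by rewrite lee_fin powR_ge0.
have gwE := etrans (etrans (Lp_grad_test pn0 tw) wv)
  (ge0_integralZl mu measurableT mf f0 cp0).
have : (G `^ p)%:E <= (c `^ p)%:E * \int[mu]_x (enorm (grad v x) `^ p)%:E.
  by apply: le_trans Gl _; apply: ereal_inf_lbound; exists w.
rewrite -(Lp_grad_test pn0 tv) cp lee_pdivlMl//; by rewrite muleC.
Qed.

Lemma Lp_norm_test_sum Omega p u v : (1 <= p)%R -> test_fun Omega u -> test_fun Omega v ->
  Lp_norm Omega p u <= Lp_norm Omega p (u \- v)%R + Lp_norm Omega p v.
Proof.
move=> p1 tu tv.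
have E f : (forall x, ~ Omega x -> f x = 0%R) -> Lp_norm Omega p f = 'N[mu]_p%:E[EFin \o f].
  move=> f0; rewrite /Lp_norm; apply: eq_Lnorm => x; rewrite patchE.
  by case: ifPn => //; rewrite notin_setE => /f0 /= ->.
have u0 x : ~ Omega x -> u x = 0%R by move=> /(test_fun_out tu)/tsupport_eq0.
have v0 x : ~ Omega x -> v x = 0%R by move=> /(test_fun_out tv)/tsupport_eq0.
rewrite !E//; last by move=> x nx /=; rewrite u0// v0// subrr.
have mu' := test_fun_measurable tu; have mv := test_fun_measurable tv.
have := @minkowski_EFin _ _ R mu (u \- v)%R v p (measurable_funB mu' mv) mv p1.
by rewrite (_ : (u \- v \+ v)%R = u)//; apply/funext => x /=; rewrite subrK.
Qed.

(** For every [v], multiply [1 <= ||u - v|| + ||v||] by the minimum: use it as [1] on the first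
    term, and as [t G] with the Poincaré inequality on the second. *)
Lemma K_functional_ge Omega p G u t : (1 < p)%R -> (0 < G)%R -> (0 < t)%R ->
  (G `^ p)%:E <= lambda1 p Omega -> test_fun Omega u -> Lp_norm Omega p u = 1 ->
  (Num.min 1 (t * G))%:E <= K_functional Omega p u t.
Proof.
move=> p1 G0 t0 Gl tu u1; have p0 : (0 < p)%R by exact: lt_trans p1.
apply: le_ereal_inf_tmp => _ [v tv <-].
set m := Num.min _ _.
have m0 : (0 <= m)%R by rewrite le_min ler01 mulr_ge0 ?ltW.
have := Lp_norm_test_sum (ltW p1) tu tv; rewrite u1 => H.
have a0 := Lp_norm_ge0 Omega p (u \- v)%R; have b0 := Lp_norm_ge0 Omega p v.
rewrite -[leLHS]mule1; apply: le_trans (lee_wpmul2l (m0 : 0 <= m%:E) H) _.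
rewrite ge0_muleDr//; apply: leeD.
  by rewrite -[leRHS]mul1e lee_wpmul2r// lee_fin ge_min lexx.
apply: (@le_trans _ _ (t%:E * (G%:E * Lp_norm Omega p v))).
  by rewrite muleA -EFinM lee_wpmul2r// lee_fin ge_min lexx orbT.
by rewrite lee_wpmul2l ?lee_fin ?(ltW t0)//; exact: poincare_test.
Qed.

(** The range [t >= 1 / G], where the minimum is [1], gives [G^(sp) / (sp)]; the range [t <= 1 / G]
    gives [G^(sp) / (p - sp)]. *)
Lemma X_norm_ge Omega s p G u : (1 < p)%R -> (0 < s < 1)%R -> (0 < G)%R ->
  (G `^ p)%:E <= lambda1 p Omega -> test_fun Omega u -> Lp_norm Omega p u = 1 ->
  (G `^ (s * p))%:E <= (2 * p * (s * (1 - s)))%:E * X_norm Omega s p u `^ p.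
Proof.
move=> p1 /andP[s0 s1] G0 Gl tu u1; have p0 : (0 < p)%R by exact: lt_trans p1.
have sp0 : (0 < s * p)%R by rewrite mulr_gt0.
have s1' : (0 < 1 - s)%R by rewrite subr_gt0.
have psp0 : (0 < p - s * p)%R by rewrite -[X in (X - _)%R]mul1r -mulrBl mulr_gt0.
have GV0 : (0 < G^-1)%R by rewrite invr_gt0.
have X0 : 0 <= X_norm Omega s p u `^ p by exact: poweR_ge0.
have GG : (0 < G `^ (s * p))%R by exact: powR_gt0.
have GE : (G^-1 `^ (- (s * p)) = G `^ (s * p))%R by rewrite powRN powRV// invrK.
have K0 t : `]0%R, +oo[%classic t ->
    0 <= (t `^ (- (s * p) - 1))%:E * K_functional Omega p u t `^ p.
  by move=> _; rewrite mule_ge0 ?poweR_ge0 ?lee_fin ?powR_ge0.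
have H1 : (G `^ (s * p) / (s * p))%:E <= X_norm Omega s p u `^ p.
  rewrite X_norm_powerE// -GE -integral_powR_tail//.
  apply: ge0_le_integral_subset => // t /=; rewrite ?in_itv/= ?andbT.
  - exact: lt_le_trans.
  - by move=> _; rewrite lee_fin powR_ge0.
  - move=> Gt; have t0 : (0 < t)%R by exact: lt_le_trans Gt.
    rewrite -[leLHS]mule1 lee_wpmul2l ?lee_fin ?powR_ge0//.
    have := K_functional_ge p1 G0 t0 Gl tu u1.
    rewrite min_l; last by rewrite -ler_pdivrMr// div1r.
    by move=> /(le_poweR (ltW p0) lee01); rewrite poweR1r.
have H2 : (G `^ (s * p) / (p - s * p))%:E <= X_norm Omega s p u `^ p.
  have -> : (G `^ (s * p) / (p - s * p))%:E =
      (G `^ p)%:E * \int[leb]_(t in `]0%R, G^-1%R]) (t `^ (p - s * p - 1))%:E.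
    rewrite integral_powR_head// -EFinM mulrA; congr (_ / _)%:E.
    rewrite powRV// powRB; last by rewrite (gt_eqF G0) implybT.
    by rewrite invf_div mulrCA mulfV ?mulr1// gt_eqF// powR_gt0.
  have mf : measurable_fun `]0%R, G^-1%R] (fun t => (t `^ (p - s * p - 1))%:E).
    by apply: measurable_funTS; apply/measurable_EFinP; exact: measurable_powR.
  have f0 t : `]0%R, G^-1%R]%classic t -> 0 <= (t `^ (p - s * p - 1))%:E.
    by rewrite lee_fin powR_ge0.
  have c0 : 0 <= (G `^ p)%:E by rewrite lee_fin powR_ge0.
  have <- := ge0_integralZl leb (measurable_itv _) mf f0 c0.
  rewrite X_norm_powerE//; apply: ge0_le_integral_subset => // t /=; rewrite ?in_itv/= ?andbT.
  - by case/andP.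
  - by move=> _; rewrite mule_ge0 ?lee_fin ?powR_ge0.
  - move=> /andP[t0 tG].
    have := K_functional_ge p1 G0 t0 Gl tu u1.
    rewrite min_r; last by rewrite -ler_pdivlMr// div1r.
    have tG0 : (0 <= t * G)%R by rewrite mulr_ge0 ?ltW.
    move=> /(le_poweR (ltW p0) (tG0 : 0 <= (t * G)%:E)); rewrite poweR_EFin => H.
    apply: le_trans (lee_wpmul2l _ H); last by rewrite lee_fin powR_ge0.
    rewrite -!EFinM lee_fin powRM ?(ltW t0) ?(ltW G0)// mulrA -powRD.
      rewrite mulrC; have -> // : (- (s * p) - 1 + p = p - s * p - 1)%R by ring.
    by rewrite (gt_eqF t0) implybT.
have [[y yE]|XE] : (exists y, X_norm Omega s p u `^ p = y%:E) \/ X_norm Omega s p u `^ p = +oo.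
  by case: (X_norm Omega s p u `^ p) X0 => // [y|] _; [left; exists y|right].
- move: H1 H2; rewrite yE -EFinM !lee_fin !ler_pdivrMr// => H1 H2.
  have y0 : (0 <= y)%R by rewrite -lee_fin -yE.
  (* Only the larger of the two bounds is kept; the other factor of [s (1 - s)] is then at least
     [1/2], whence the [2]. *)
  have [sh|sh] := leP s (2^-1)%R.
    apply: (le_trans H1); rewrite mulrC ler_wpM2r//.
    have : (1 <= 2 * (1 - s))%R by lra.
    move=> h; rewrite (_ : 2 * p * (s * (1 - s)) = (2 * (1 - s)) * (s * p))%R; last by ring.
    by rewrite ler_peMl// ltW.
  apply: (le_trans H2); rewrite mulrC ler_wpM2r//.
  have : (1 <= 2 * s)%R by lra.
  move=> h; rewrite (_ : 2 * p * (s * (1 - s)) = (2 * s) * (p - s * p))%R; last by ring.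
  by rewrite ler_peMl// ltW.
- by rewrite XE gt0_muley ?leey// lte_fin !mulr_gt0.
Qed.

(** Returns from real [G] to [lambda1]: a finite positive value is attained by its [p]-th root, and
    an infinite one admits arbitrarily large [G], forcing [Y] to be infinite. *)
Lemma poweR_le_of_lower s p (l Y : \bar R) : (0 < s)%R -> (0 < p)%R -> 0 <= l -> 0 <= Y ->
  (forall G, (0 < G)%R -> (G `^ p)%:E <= l -> (G `^ (s * p))%:E <= Y) -> l `^ s <= Y.
Proof.
move=> s0 p0 l0 Y0 H; have pn0 : p != 0%R by rewrite gt_eqF.
case: l l0 H => [a| |]//.
  rewrite lee_fin le_eqVlt => /predU1P[<-|a0] H; first by rewrite poweR_EFin powR0// gt_eqF.
  rewrite poweR_EFin; have := H (a `^ p^-1)%R (powR_gt0 _ a0).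
  rewrite -!powRrM mulVf// powRr1 ?(ltW a0)// (mulrC s) mulKf//.
  by apply.
move=> _ H; case: Y Y0 H => [y| |]// y0 H; last by rewrite leey.
have y1 : (0 < y + 1)%R by rewrite ltr_wpDl.
have := H ((y + 1) `^ (s * p)^-1)%R (powR_gt0 _ y1) (leey _).
rewrite -powRrM mulVf ?mulf_neq0 ?gt_eqF// powRr1 ?(ltW y1)// lee_fin.
by rewrite gerDl ler10.
Qed.

End X_norm_lower_bound.

Section lipschitz_comparison.
Context {R : realType}.
Local Open Scope ereal_scope.

Lemma lipschitz_X_norm_le n (p r M d : R) : (1 < p)%R -> (0 < r)%R -> (0 < M)%R ->
  exists2 C : R, (0 < C)%R & forall (s : R) (Omega : set 'rV[R]_n.+1) (m : nat),
    (0 < s < 1)%R -> open Omega -> bounded_set Omega -> lipschitz_domain r m M Omega ->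
    ediam Omega = d -> forall u, test_fun Omega u ->
    X_norm Omega s p u `^ p <= C%:E * gagliardo s p u `^ p.
Proof.
move=> p1 r0 M0.
have [t0 [L [/andP[t00 t01] HL]]] := @lipschitz_direction R n r M d r0 M0.
have [C C0 moll] := @mollification R n p p1.
have /andP[w0 w1] := @omega_ball_gt0_lty R n.+1.
have WE : @omega_ball R n.+1 = (fine (@omega_ball R n.+1))%:E.
  by rewrite fineK// ge0_fin_numE// ltW.
have W0 : (0 < fine (@omega_ball R n.+1))%R by rewrite -lte_fin -WE.
set W := fine _ in WE W0.
have M1 : (0 < 2 * (1 + M))%R by rewrite mulr_gt0// addr_gt0.
pose D := (2 `^ (p - 1) * (1 + (2 * (1 + M)) `^ p) *
  (C * (2 * (1 + M)) ^+ n.+1 * #|{ffun 'I_n.+1 * 'I_L -> bool}|%:R))%R.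
have D0 : (0 <= D)%R.
  by rewrite !mulr_ge0 ?powR_ge0 ?exprn_ge0 ?(ltW C0) ?(ltW M1)// addr_ge0 ?powR_ge0.
(* [|d| + 1] is a strict bound for the diameter and is at least [t0], as [X_norm_le] requires. *)
have d1 : (0 < `|d| + 1)%R by rewrite ltr_wpDl.
exists (D * 2 `^ (n.+1%:R + p) / n.+1%:R + ((`|d| + 1) / t0) `^ p / (n.+1%:R * W))%R.
  apply: ltr_wpDl; last first.
    by apply: divr_gt0; [apply: powR_gt0; exact: divr_gt0|exact: mulr_gt0].
  by rewrite divr_ge0// mulr_ge0// powR_ge0.
move=> s Omega m s01 oO bO lip dE u tu.
have [kappa [E [mk E1 cone]]] := HL _ _ oO bO lip dE.
apply: (X_norm_le p1 s01 t00 _ D0 W0 WE _ tu) => [|x y Ox Oy|t t0t].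
- by rewrite (le_trans t01)// lerDr.
- rewrite (le_lt_trans (enorm_le_ediam bO Ox Oy))// dE.
  by rewrite (le_lt_trans (ler_norm _))// ltrDl.
- exact: (K_functional_power_le bO M0 t01 mk E1 cone p1 C0 moll t0t tu).
Qed.

(** The comparison constant is enlarged by the factor [2 p] of [X_norm_ge], so that one constant
    serves both conclusions. *)
Lemma lipschitz_lambda_frac_ge n (p r M d : R) : (1 < p)%R -> (0 < r)%R -> (0 < M)%R ->
  exists2 C : R, (0 < C)%R & forall (s : R) (Omega : set 'rV[R]_n.+1) (m : nat),
    (0 < s < 1)%R -> open Omega -> bounded_set Omega -> lipschitz_domain r m M Omega ->
    ediam Omega = d ->
    (forall u, test_fun Omega u -> X_norm Omega s p u `^ p <= C%:E * gagliardo s p u `^ p) /\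
    (C^-1)%R%:E * lambda1 p Omega `^ s <= (s * (1 - s))%R%:E * lambda_frac s p Omega.
Proof.
move=> p1 r0 M0; have p0 : (0 < p)%R by exact: lt_trans p1.
have [C C0 HC] := @lipschitz_X_norm_le n p r M d p1 r0 M0.
have p2 : (1 <= 2 * p)%R by rewrite (le_trans (ltW p1))// ler_peMl ?(ltW p0)// ler1n.
have C2 : (0 < 2 * p * C)%R by rewrite !mulr_gt0.
exists (2 * p * C)%R => // s Omega m s01 oO bO lip dE.
have /andP[s0 s1] := s01.
have s1' : (0 < s * (1 - s))%R by rewrite mulr_gt0// subr_gt0.
have HX u (tu : test_fun Omega u) := HC s Omega m s01 oO bO lip dE u tu.
split=> [u tu|].
  apply: le_trans (HX u tu) _; rewrite lee_wpmul2r ?poweR_ge0// lee_fin.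
  by rewrite ler_peMl// ltW.
apply: lambda_frac_ge => // u tu u1.
rewrite lee_pdivrMl//; apply: (poweR_le_of_lower s0 p0) => [||G G0 Gl].
- exact: lambda1_ge0.
- by rewrite !mule_ge0 ?poweR_ge0 ?lee_fin ?(ltW C2) ?(ltW s1').
- apply: le_trans (X_norm_ge p1 s01 G0 Gl tu u1) _.
  have c0 : (0 <= (2 * p * (s * (1 - s)))%:E) by rewrite lee_fin !mulr_ge0 ?(ltW p0) ?(ltW s0) ?subr_ge0 ?(ltW s1).
  apply: le_trans (lee_wpmul2l c0 (HX u tu)) _.
  rewrite !muleA -!EFinM lee_wpmul2r ?poweR_ge0// lee_fin le_eqVlt; apply/orP; left.
  by apply/eqP; ring.
Qed.

End lipschitz_comparison.

Local Open Scope ereal_scope.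

(* The dimension is N = n.+1. *)
Theorem theorem6p1 (R : realType) (n : nat) (p : R) (hp : (1 < p)%R) :
  [/\ forall (s : R) (Omega : set 'rV[R]_n.+1), (0 < s < 1)%R -> open Omega ->
        (s * (1 - s))%R%:E * lambda_frac s p Omega <=
          (2 `^ (p * (1 - s)) * n.+1%:R)%R%:E * @omega_ball R n.+1
            * lambda1 p Omega `^ s,
      exists C1 : R -> R -> nat -> R -> R,
        (forall d r m M, (0 < C1 d r m M)%R) /\
        forall (s : R) (Omega : set 'rV[R]_n.+1) (r : R) (m : nat) (M : R),
          (0 < s < 1)%R -> open Omega -> bounded_set Omega ->
          (0 < r)%R -> (0 < M)%R -> lipschitz_domain r m M Omega ->
          let C := C1 (ediam Omega) r m M in
          (forall u, test_fun Omega u ->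
             X_norm Omega s p u `^ p <= C%:E * gagliardo s p u `^ p) /\
          (C^-1)%R%:E * lambda1 p Omega `^ s <=
            (s * (1 - s))%R%:E * lambda_frac s p Omega &
      forall C : R, @hardy_constant R n.+1 p C ->
        forall (s : R) (Omega : set 'rV[R]_n.+1),
          (0 < s < 1)%R -> open Omega -> convex_set Omega ->
          let C2 := lambda1 p (@eball R n.+1 0%R 1%R) `^ s / C%:E in
          C2^-1 * lambda1 p Omega `^ s <=
            (s * (1 - s))%R%:E * lambda_frac s p Omega].
Proof.
have p0 : (0 < p)%R by exact: lt_trans hp.
split.
- by move=> s Omega s01 _; exact: lambda_frac_le.
- have /choice[C HC] : forall z : R * R * R, exists C : R, (0 < C)%R /\
      ((0 < z.1.2)%R -> (0 < z.2)%R ->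
      forall (s : R) (Omega : set 'rV[R]_n.+1) (m : nat),
      (0 < s < 1)%R -> open Omega -> bounded_set Omega ->
      lipschitz_domain z.1.2 m z.2 Omega -> ediam Omega = z.1.1 ->
      (forall u, test_fun Omega u ->
        X_norm Omega s p u `^ p <= C%:E * gagliardo s p u `^ p) /\
      (C^-1)%R%:E * lambda1 p Omega `^ s <=
        (s * (1 - s))%R%:E * lambda_frac s p Omega).
    (* [C1] has to be positive everywhere, so it takes the value [1] where [r] or [M] is not
       positive. *)
    move=> [[d r] M] /=; have [r0|r0] := ltP 0%R r; last first.
      by exists 1%R; split => //.
    have [M0|M0] := ltP 0%R M; last by exists 1%R; split => //.
    have [C C0 HC] := @lipschitz_lambda_frac_ge R n p r M d hp r0 M0.
    by exists C; split => // _ _; exact: HC.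
  exists (fun d r _ M => C (d, r, M)); split=> [d r m M|s Omega r m M s01 oO bO r0 M0 lip /=].
    by have [] := HC (d, r, M).
  have [_ H] := HC (ediam Omega, r, M).
  exact: (H r0 M0 s Omega m s01 oO bO lip erefl).
- by move=> C HC s Omega s01 oO cO; exact: convex_lambda_frac_ge.
Qed.
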